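(* Suppose that $y_0\in H_0^1(\Omega)\cap L^\infty(\Omega)$. If $y$ is a solution, corresponding to some feedback control $u$, of the system $$y_t-\Delta y=\chi_\omega u\ \text{ in }\Omega,\ t>0;\qquad y=0\ \text{ on }\partial\Omega,\ t>0;\qquad y(x,0)=y_0(x)\ \text{ in }\Omega,$$ and $y$ belongs to $C([0,t_{max});L^\infty(\Omega))$, where $[0,t_{max})$ denotes the maximal interval of existence of $y$, then no point $a\in\Omega\setminus\overline\omega$ can be the unique blowup point of $y$.
   Context: $\Omega\subset\mathbb{R}^n$ is a bounded domain with smooth boundary $\partial\Omega$, $\omega\subset\Omega$ is a nonempty open subset, and $\chi_\omega$ is the characteristic function of $\omega$. Blowup: $T>0$ is the blowup time and $a\in\Omega$ is a blowup point of the solution $y$ if there are sequences $a_j\to a$ and $t_j\to T$ such that $|y(a_j,t_j)|\to+\infty$ as $j\to\infty$. (Here the blowup time is $T=t_{max}$.) *)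

(* Defs.v *)
From HB Require Import structures.
From mathcomp Require Import all_boot all_order all_algebra.
From mathcomp Require Import all_classical all_reals all_analysis.

Set Implicit Arguments.
Unset Strict Implicit.
Unset Printing Implicit Defensive.
Import Order.TTheory GRing.Theory Num.Theory.
Import numFieldNormedType.Exports.

Local Open Scope classical_set_scope.
Local Open Scope ring_scope.

(** * Lebesgue measure on ['rV[R]_n] *)

Section measurable_rV.
Context {R : realType} {n : nat}.

(* The sigma-algebra generated by the coordinates, i.e. the Borel sets. *)
Let coords : 'I_n -> 'rV[R]_n -> measurableTypeR R := fun i x => x ord0 i.

Let rV_set0 : g_sigma_preimage coords set0.
Proof. exact: sigma_algebra0. Qed.

Let rV_setC A : g_sigma_preimage coords A -> g_sigma_preimage coords (~` A).
Proof. exact: sigma_algebraC. Qed.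

Let rV_bigcup (F : (set 'rV[R]_n)^nat) :
  (forall i, g_sigma_preimage coords (F i)) ->
  g_sigma_preimage coords (\bigcup_i (F i)).
Proof. exact: sigma_algebra_bigcup. Qed.

HB.instance Definition _ := @isMeasurable.Build
  default_measure_display 'rV[R]_n (g_sigma_preimage coords)
  rV_set0 rV_setC rV_bigcup.

Lemma measurable_rV_coord (i : 'I_n) :
  measurable_fun [set: 'rV[R]_n]
    (fun x : 'rV[R]_n => x ord0 i : measurableTypeR R).
Proof.
move=> _ Y mY; rewrite setTI; apply: sub_sigma_algebra => /=.
rewrite -bigcup_seq/=; exists i => /=; first by rewrite mem_index_enum.
by exists Y => //; rewrite setTI.
Qed.

Lemma measurable_fun_rVP d (T : measurableType d) (f : T -> 'rV[R]_n) :
  (forall i, measurable_fun setT (fun x => f x ord0 i : measurableTypeR R)) ->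
  measurable_fun setT f.
Proof.
move=> mf _ A mA; rewrite setTI.
have /(_ A mA) : g_sigma_preimage coords `<=`
    [set B | measurable (f @^-1` B)].
  apply: smallest_sub.
    split => /=.
    - by rewrite preimage_set0.
    - by move=> B mB; rewrite setTD preimage_setC; exact: measurableC.
    - by move=> F mF; rewrite preimage_bigcup; exact: bigcupT_measurable.
  move=> B; rewrite -bigcup_seq => -[i _ [C mC <-]] /=.
  by rewrite setTI; have := mf i measurableT C mC; rewrite setTI.
by [].
Qed.

End measurable_rV.

Section lebesgue_rV.
Context {R : realType}.

Definition consrV n (p : measurableTypeR R * 'rV[R]_n) : 'rV[R]_n.+1 :=
  \row_i oapp (p.2 ord0) p.1 (unlift ord0 i).

Definition unconsrV n (x : 'rV[R]_n.+1) : measurableTypeR R * 'rV[R]_n :=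
  (x ord0 ord0, \row_i x ord0 (lift ord0 i)).

Lemma consrVK n : cancel (@consrV n) (@unconsrV n).
Proof.
move=> [r x]; congr (_, _); first by rewrite mxE unlift_none.
by apply/rowP => i; rewrite !mxE liftK.
Qed.

Lemma measurable_consrV n : measurable_fun setT (@consrV n).
Proof.
apply: measurable_fun_rVP => i; case: (unliftP ord0 i) => [j|] ->.
- under eq_fun do rewrite mxE liftK /=.
  exact: (measurableT_comp (@measurable_rV_coord R n j) measurable_snd).
- under eq_fun do rewrite mxE unlift_none /=.
  exact: measurable_fst.
Qed.

Lemma measurable_unconsrV n : measurable_fun setT (@unconsrV n).
Proof.
apply/measurable_fun_pairP; split; first exact: measurable_rV_coord.
apply: measurable_fun_rVP => i.
under eq_fun do rewrite /= mxE.
exact: measurable_rV_coord.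
Qed.

Section lebesgue_succ.
Local Open Scope ereal_scope.
Variables (n : nat) (mu : {sigma_finite_measure set 'rV[R]_n -> \bar R}).

Definition lebesgue_succ : set 'rV[R]_n.+1 -> \bar R :=
  pushforward (lebesgue_measure \x mu) (@consrV n).

Let lebesgue_succ0 : lebesgue_succ set0 = 0.
Proof. by rewrite /lebesgue_succ /pushforward preimage_set0 measure0. Qed.

Let lebesgue_succ_ge0 A : 0 <= lebesgue_succ A.
Proof. exact: (measure_ge0 (lebesgue_measure \x mu)). Qed.

Let lebesgue_succ_sigma_additive : semi_sigma_additive lebesgue_succ.
Proof.
move=> F mF tF mUF; rewrite /lebesgue_succ /pushforward preimage_bigcup.
have mc A : measurable A -> measurable (@consrV n @^-1` A).
  by move=> mA; rewrite -[X in measurable X]setTI; exact: measurable_consrV.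
apply: (@measure_semi_sigma_additive _ _ _ (lebesgue_measure \x mu)) => //.
- by move=> i; exact: mc.
- apply/trivIsetP => /= i j _ _ ij; rewrite -preimage_setI.
  by move/trivIsetP : tF => /(_ _ _ _ _ ij) ->//; rewrite preimage_set0.
- by rewrite -preimage_bigcup; exact: mc.
Qed.

HB.instance Definition _ := isMeasure.Build _ _ _ lebesgue_succ
  lebesgue_succ0 lebesgue_succ_ge0 lebesgue_succ_sigma_additive.

Let lebesgue_succ_sigma_finite : sigma_finite setT lebesgue_succ.
Proof.
have /sigma_finiteP[F [TF ndF Foo]] :=
  sigma_finiteT (@lebesgue_measure R : {sigma_finite_measure set _ -> \bar R}).
have /sigma_finiteP[G [TG ndG Goo]] := sigma_finiteT mu.
exists (fun i => @unconsrV n @^-1` (F i `*` G i)).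
  rewrite -preimage_bigcup [X in _ @^-1` X](_ : _ = setT) ?preimage_setT//.
  rewrite -setXTT TF TG predeqE => -[x y]; split.
    by move=> [i _ []/= ? ?]; split; exists i.
  move=> [/= [i _ Fix] [k _ Gky]]; exists (maxn i k) => //; split.
  - by move: x Fix; exact/subsetPset/ndF/leq_maxl.
  - by move: y Gky; exact/subsetPset/ndG/leq_maxr.
move=> i; have [? ?] := Foo i; have [? ?] := Goo i; split.
  rewrite -[X in measurable X]setTI.
  by apply: measurable_unconsrV => //; exact: measurableX.
rewrite /lebesgue_succ /pushforward -comp_preimage.
rewrite (_ : _ \o _ = id); last by apply/funext => p /=; rewrite consrVK.
by rewrite preimage_id product_measure1E// lte_mul_pinfty// ge0_fin_numE.
Qed.

HB.instance Definition _ := Measure_isSigmaFinite.Build _ _ _ lebesgue_succ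
  lebesgue_succ_sigma_finite.

End lebesgue_succ.

Fixpoint lebesgue_rV n : {sigma_finite_measure set 'rV[R]_n -> \bar R} :=
  match n with
  | 0 => \d_ (0 : 'rV[R]_0)
  | m.+1 => lebesgue_succ (lebesgue_rV m)
  end.

End lebesgue_rV.

Section lebesgue_rV_box.
Context {R : realType}.
Local Open Scope ereal_scope.

Lemma lebesgue_rV_box n (A : 'I_n -> set (measurableTypeR R)) :
  (forall i, measurable (A i)) ->
  lebesgue_rV n [set x | forall i, A i (x ord0 i)]
    = \prod_(i < n) lebesgue_measure (A i).
Proof.
elim: n A => [|n IHn] A mA.
  rewrite big_ord0 [X in lebesgue_rV 0 X](_ : _ = setT) /= ?diracT//.
  by apply/seteqP; split => x //= _ [].
rewrite big_ord_recl -IHn; last by move=> i; exact: mA.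
rewrite -product_measure1E//; last first.
  rewrite [X in measurable X](_ : _ = \bigcap_(i in [set: 'I_n])
      ((fun x : 'rV[R]_n => x ord0 i : measurableTypeR R) @^-1`
        A (lift ord0 i))).
    apply: fin_bigcap_measurable => // i _; rewrite -[X in measurable X]setTI.
    exact: measurable_rV_coord.
  by apply/seteqP; split => x /= Ax => [i _|i]; exact: Ax.
rewrite /= /lebesgue_succ /pushforward; congr product_measure1.
apply/seteqP; split => -[r x] /= => [Ax|[Ar Ax] i].
  split=> [|i]; first by have := Ax ord0; rewrite mxE unlift_none.
  by have := Ax (lift ord0 i); rewrite mxE liftK.
by rewrite mxE; case: unliftP => [j|] ->.
Qed.

End lebesgue_rV_box.

(** * Function spaces *)

Section function_spaces.
Context {R : realType}.

Definition Lp_norm d (T : measurableType d) (mu : {measure set T -> \bar R})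
    (p : \bar R) (D : set T) (f : T -> R) : \bar R :=
  ('N[mu]_p[EFin \o (f \_ D)])%E.

Definition Lp d (T : measurableType d) (mu : {measure set T -> \bar R})
    (p : \bar R) (D : set T) (f : T -> R) : Prop :=
  measurable_fun D f /\ (Lp_norm mu p D f < +oo)%E.

Context {n : nat}.
Local Notation V := 'rV[R]_n.
Local Notation mu := (lebesgue_rV n).
Implicit Types (Omega : set V) (f phi : V -> R).

Definition partial (i : 'I_n) f : V -> R := 'D_(delta_mx ord0 i) f.

Definition partials (s : seq 'I_n) f : V -> R := foldr partial f s.

Definition smooth_on (U : set V) f : Prop :=
  forall s x, U x ->
    {for x, continuous (partials s f)} /\
    forall i, derivable (partials s f) x (delta_mx ord0 i).

(* C_c^oo(Omega) *)
Definition test_function Omega phi : Prop :=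
  smooth_on setT phi /\
  exists2 K : set V, compact K /\ K `<=` Omega & forall x, ~ K x -> phi x = 0.

(* [f] is in H_0^1(Omega), the closure of C_c^oo(Omega) in H^1(Omega), and
   [g] is its weak gradient. *)
Definition H10_grad Omega f (g : 'I_n -> V -> R) : Prop :=
  [/\ Lp mu 2%:E Omega f, forall i, Lp mu 2%:E Omega (g i) &
    exists phi : nat -> V -> R,
      [/\ forall k, test_function Omega (phi k),
          Lp_norm mu 2%:E Omega (f \- phi k) @[k --> \oo] --> 0%E &
          forall i, Lp_norm mu 2%:E Omega (g i \- partial i (phi k))
            @[k --> \oo] --> 0%E]].

Definition H10 Omega f : Prop := exists g, H10_grad Omega f g.

(* A defining function [rho], with nonzero gradient, near each boundary point;
   as [Omega] is open, its boundary is [closure Omega `\` Omega]. *)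
Definition smooth_boundary Omega : Prop :=
  forall p, (closure Omega `\` Omega) p ->
  exists (U : set V) (rho : V -> R),
    [/\ open U, U p, smooth_on U rho, exists i, partial i rho p != 0 &
        Omega `&` U = [set x | rho x < 0] `&` U].

Definition bounded_smooth_domain Omega : Prop :=
  [/\ open Omega, connected Omega, Omega !=set0, bounded_set Omega &
      smooth_boundary Omega].

End function_spaces.

(** * The controlled heat equation

   A function of time and space is a map [y : R -> 'rV[R]_n -> R], with [y t]
   the state at time [t]. *)

Section heat.
Context {R : realType} {n : nat}.
Local Notation V := 'rV[R]_n.
Local Notation mu := (lebesgue_rV n).
Implicit Types (Omega omega : set V) (T : \bar R) (y z : R -> V -> R).

(* [0, T) with T possibly infinite *)
Definition times T : set R := [set t | 0 <= t /\ (t%:E < T)%E].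

(* Equality as functions from [0, T) to Lebesgue classes on Omega. *)
Definition same_class Omega T y z : Prop :=
  forall t, times T t -> {ae mu, forall x, Omega x -> y t x = z t x}.

(* y in C([0, T); L^oo(Omega)) *)
Definition C_Linfty Omega T y : Prop :=
  (forall t, times T t -> Lp mu +oo%E Omega (y t)) /\
  (forall t, times T t ->
     Lp_norm mu +oo%E Omega (y s \- y t)
       @[s --> within (times T) (nbhs t)] --> 0%E).

(* A feedback law computes the control from the time and the current state. *)
Definition feedback : Type := R -> (V -> R) -> (V -> R).

(* Weak solutions on [0, T): y is in L^2_loc([0, T); H_0^1(Omega)), which
   contains the boundary condition, chi_omega u is in
   L^1_loc([0, T); L^1(Omega)), and the equation, tested against functions of
   x, is integrated in time from 0 to t. *)
Definition solution Omega omega (F : feedback) (y0 : V -> R) T y : Prop :=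
  exists (u : R -> V -> R) (g : 'I_n -> R -> V -> R),
  [/\ {ae lebesgue_measure, forall t, 0 < t -> (t%:E < T)%E ->
         {ae mu, forall x, omega x -> u t x = F t (y t) x}},
      forall tau, 0 < tau -> (tau%:E < T)%E ->
        [/\ (lebesgue_measure \x mu)%E.-integrable (`]0, tau[ `*` omega)
              (fun p => (u p.1 p.2)%:E),
            Lp (lebesgue_measure \x mu)%E 2%:E (`]0, tau[ `*` Omega)
              (fun p => y p.1 p.2) &
            forall i, Lp (lebesgue_measure \x mu)%E 2%:E (`]0, tau[ `*` Omega)
              (fun p => g i p.1 p.2)],
      (forall t, times T t -> Lp mu 2%:E Omega (y t)) /\
      {ae lebesgue_measure, forall t, 0 < t -> (t%:E < T)%E ->
         H10_grad Omega (y t) (fun i => g i t)},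
      forall t phi, times T t -> test_function Omega phi ->
        \int[mu]_(x in Omega) (y t x * phi x)
          - \int[mu]_(x in Omega) (y 0 x * phi x) =
        \int[lebesgue_measure]_(s in `]0, t[)
          (\int[mu]_(x in Omega) (\1_omega x * u s x * phi x)
           - \sum_(i < n) \int[mu]_(x in Omega) (g i s x * partial i phi x)) &
      {ae mu, forall x, Omega x -> y 0 x = y0 x}].

(* [0, tmax) is the maximal interval of existence of y: y has no extension to
   a longer interval that is still a solution of class C([0, T); L^oo). *)
Definition maximal_interval Omega omega (F : feedback) (y0 : V -> R)
    (tmax : \bar R) y : Prop :=
  forall T z, (tmax < T)%E ->
    solution Omega omega F y0 T z -> C_Linfty Omega T z ->
    ~ same_class Omega tmax z y.

(* The values y(a_j, t_j) of a Lebesgue class are those of a representative: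
   the divergence is required of every representative, so that changing y on
   null sets does not create blowup points.  When each [y t] is continuous on
   Omega, this is the divergence for y itself. *)
Definition blowup_point Omega (tmax : \bar R) y (a : V) : Prop :=
  Omega a /\
  exists2 T : R, tmax = T%:E &
  forall z, same_class Omega tmax z y ->
  exists (a_ : nat -> V) (t_ : nat -> R),
    [/\ forall j, Omega (a_ j), forall j, times tmax (t_ j),
        a_ @ \oo --> a, t_ @ \oo --> T &
        `|z (t_ j) (a_ j)| @[j --> \oo] --> +oo].

Definition unique_blowup_point Omega (tmax : \bar R) y (a : V) : Prop :=
  blowup_point Omega tmax y a /\
  forall b, blowup_point Omega tmax y b -> b = a.

End heat.

(* Main.v *)
From mathcomp Require Import all_boot all_order all_algebra.
From mathcomp Require Import all_classical all_reals all_analysis.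
From mathcomp Require Import measurable_realfun ess_sup_inf.
From mathcomp Require Import ring lra.
Require Import Defs.

Set Implicit Arguments.
Unset Strict Implicit.
Unset Printing Implicit Defensive.
Import Order.TTheory GRing.Theory Num.Theory.
Import numFieldNormedType.Exports.
Local Open Scope classical_set_scope.
Local Open Scope ring_scope.

(** Away from the closure of the control region, [y] solves the free heat
    equation, and a solution of the free heat equation cannot blow up at an
    isolated point: a bound for [y] on a shell around [a], uniform up to the
    blowup time [T], propagates to the inside of the shell.

    All cubes are centred at [a], of half-sides [r0 < r1 < r2], and the largest
    one lies in [Omega] off the closure of [omega].  The shell consists of the
    points of the largest cube that are not in the interior of the middle one.
    If [a] is the only blowup point, no point of the shell is one, so by
    compactness [y] is bounded on the shell by some [M], uniformly for [t] near
    [T] ([compact_bounded_off_blowup]).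

    The bound is moved inside by duality, because [y t] is only a class of
    functions and the equation only holds in the weak sense.  For a box [A] in
    the smallest cube and a time [t], let [Phi s] be the product of a cutoff,
    equal to 1 on the middle cube and to 0 off the largest, and of the solution
    of the backward heat equation that becomes the indicator of [A] at time
    [t + eps], where [eps] will tend to 0.  If [Phi] solved the backward heat
    equation, the integral of [y s * Phi s] would not depend on [s].  Because
    of the cutoff, its derivative is the integral of [y s] times a commutator
    ([is_derive_moving_pair], [laplacian_heatbox]), which lives on the shell,
    at distance at least [r1 - r0] from [A].  There the Gaussian decay beats
    every power of [(t + eps - s)^(-1/2)], and the commutator is at most
    [C * |A|], with [C] independent of [A], [t], [eps] and [s]
    ([heatbox_c_bound]).  At a fixed earlier time the integral of [y s * Phi s]
    is at most [C * |A|] too, because the heat kernel is bounded there.  Hence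
    the integral of [y t] over [A] is at most [C * |A|] in absolute value, with
    the same [C] for all [A] and all [t] close to [T] ([box_integral_bound]).

    Boxes determine measurable sets up to small measure, so [|y t| <= C] almost
    everywhere on the smallest cube ([box_nonneg_ae], [state_ae_bound]).
    Changing each [y t] on a null set then gives a representative that is
    bounded near [(a, T)], so that [a] is not a blowup point after all
    ([not_blowup_of_ae_bounded]).

    The backward heat evolution of a box is a product of differences of error
    functions of one variable, so everything about [Phi] reduces to calculus on
    the real line.  The weak formulation is brought to the form needed here by
    integrating by parts against test functions ([weak_gradient],
    [is_derive_pair]). *)

(** * Smooth functions of one variable *)

Section smooth_real.
Context {R : realType}.
Implicit Types (f g : R -> R) (x : R).

Lemma is_derive1D f g x df dg : is_derive x 1 f df -> is_derive x 1 g dg ->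
  is_derive x 1 (fun y => f y + g y) (df + dg).
Proof. by move=> ? ?; exact: is_deriveD. Qed.

Lemma is_derive1M f g x df dg : is_derive x 1 f df -> is_derive x 1 g dg ->
  is_derive x 1 (fun y => f y * g y) (df * g x + f x * dg).
Proof.
move=> ? ?; apply: (@is_derive_eq _ _ _ (f * g)).
by rewrite /GRing.scale /= addrC mulrC.
Qed.

Lemma is_derive1N f x df : is_derive x 1 f df ->
  is_derive x 1 (fun y => - f y) (- df).
Proof. by move=> ?; exact: is_deriveN. Qed.

Lemma is_derive1B f g x df dg : is_derive x 1 f df -> is_derive x 1 g dg ->
  is_derive x 1 (fun y => f y - g y) (df - dg).
Proof. by move=> ? ?; exact: is_deriveB. Qed.

Lemma is_derive1Zl (c : R) f x df : is_derive x 1 f df ->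
  is_derive x 1 (fun y => c * f y) (c * df).
Proof. by move=> ?; exact: is_deriveZ. Qed.

Lemma is_derive1V f x df : f x != 0 -> is_derive x 1 f df ->
  is_derive x 1 (fun y => (f y)^-1) (- df / f x ^+ 2).
Proof.
move=> fx0 [d <-]; split; first exact: derivableV.
by rewrite deriveV// /GRing.scale /=; field.
Qed.

Lemma is_derive1_chain f g x df dg : is_derive (g x) 1 f df ->
  is_derive x 1 g dg -> is_derive x 1 (fun y => f (g y)) (df * dg).
Proof. by move=> ? ?; exact: is_derive1_comp. Qed.

Lemma derive1_is f df x : is_derive x 1 f df -> derive1 f x = df.
Proof. by move=> d; rewrite derive1E derive_val. Qed.

Lemma is_derive_derive1 f x : derivable f x 1 -> is_derive x 1 f (derive1 f x).
Proof. by move=> d; rewrite derive1E; exact: derivableP. Qed.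

Lemma derive1_funext f df : (forall x, is_derive x 1 f (df x)) -> derive1 f = df.
Proof. by move=> d; apply/funext => x; exact: derive1_is. Qed.

Lemma is_derive_continuous f x df : is_derive x 1 f df ->
  {for x, continuous f}.
Proof.
by move=> [d _]; apply/differentiable_continuous; rewrite -derivable1_diffP.
Qed.

(** Serves at the points where a function defined by cases is flat. *)
Lemma is_derive_quadratic f x d c : 0 <= c ->
  (forall h, `|f (h + x) - f x - h * d| <= c * h ^+ 2) -> is_derive x 1 f d.
Proof.
move=> c0 fd.
have lim : h^-1 *: ((f \o shift x) (h *: 1) - f x) @[h --> 0^'] --> d.
  apply/cvgrPdist_lt => e e0; near=> h.
  have h0 : h != 0 by near: h; exact: nbhs_dnbhs_neq.
  rewrite /= /GRing.scale /= mulr1.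
  have h1 : 0 < `|h| by rewrite normr_gt0.
  rewrite -(ltr_pM2l h1) -normrM mulrBr mulrA mulfV// mul1r.
  rewrite distrC (le_lt_trans (fd h))// -[h ^+ 2]ger0_norm ?sqr_ge0// normrX.
  rewrite expr2 mulrCA ltr_pM2l//.
  have : `|h| < e / (c + 1).
    by near: h; apply: dnbhs0_lt; rewrite divr_gt0// ltr_wpDl.
  rewrite ltr_pdivlMr ?ltr_wpDl// => /(le_lt_trans _); apply.
  by rewrite mulrC ler_wpM2l// lerDl.
split; first by apply/cvg_ex; exists d.
exact: cvg_lim.
Unshelve. all: by end_near. Qed.

(** Stated for a function that vanishes at [a], since it is applied to a
    remainder term. *)
Lemma is_derive_little (f : R -> R) (a : R) : f a = 0 ->
  (forall e, 0 < e -> exists2 d, 0 < d & forall h, `|h| < d ->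
     `|f (h + a)| <= e * `|h|) -> is_derive a 1 f 0.
Proof.
move=> fa0 hf.
have lim : h^-1 *: ((f \o shift a) (h *: 1) - f a) @[h --> 0^'] --> 0.
  apply/cvgr0Pnorm_le => e e0; have [d d0 hd] := hf e e0; near=> h.
  have h0 : h != 0 by near: h; exact: nbhs_dnbhs_neq.
  rewrite /= fa0 subr0 /GRing.scale /= mulr1 normrM normfV mulrC.
  rewrite ler_pdivrMr ?normr_gt0//; apply: hd.
  by near: h; exact: dnbhs0_lt.
split; first by apply/cvg_ex; exists 0.
exact: cvg_lim.
Unshelve. all: by end_near. Qed.

Lemma derive_bound_lipschitz (f df : R -> R) (c d L : R) :
  (forall r, c < r < d -> is_derive r 1 f (df r)) ->
  (forall r, c < r < d -> `|df r| <= L) ->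
  forall a b, c < a < d -> c < b < d -> `|f a - f b| <= L * `|a - b|.
Proof.
move=> hder hL.
have H a b : c < a -> b < d -> a <= b -> `|f b - f a| <= L * `|b - a|.
  move=> ca bd ab.
  have cd z : z \in `[a, b] -> c < z < d.
    by rewrite in_itv/= => /andP[z1 z2]; rewrite (lt_le_trans ca z1) (le_lt_trans z2 bd).
  have cf : {within `[a, b], continuous f}.
    by apply: derivable_within_continuous => z /cd/hder[].
  have [z zab ->] := @MVT_segment _ f df a b ab
      (fun z zab => hder z (cd z (subset_itv_oo_cc zab))) cf.
  by rewrite normrM ler_wpM2r// hL// cd.
move=> a b /andP[ca ad] /andP[cb bd]; have [ab|/ltW ba] := leP a b; last exact: H.
by rewrite distrC (distrC a); exact: H.
Qed.

(** [k] times differentiable, without continuity of the last derivative: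
    having this for all [k] is smoothness, and the recursion on the derivative
    makes every stability property a short induction. *)
Fixpoint Cn k f : Prop :=
  if k is k.+1 then (forall x, derivable f x 1) /\ Cn k (derive1 f) else True.

Lemma CnS k f : Cn k.+1 f -> Cn k f.
Proof.
by elim: k f => // k IH f [d1] /= [d2 d3]; split => //; exact: IH.
Qed.

Lemma Cn_is k f df : (forall x, is_derive x 1 f (df x)) -> Cn k df -> Cn k.+1 f.
Proof.
move=> d c; split; last by rewrite (derive1_funext d).
by move=> x; have [] := d x.
Qed.

Lemma Cn_derive k f x : Cn k.+1 f -> is_derive x 1 f (derive1 f x).
Proof. by move=> [d _]; exact: is_derive_derive1. Qed.

Lemma Cn_cst k (c : R) : Cn k (fun=> c).
Proof.
elim: k c => // k IH c; by apply: (@Cn_is _ _ (fun=> 0)).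
Qed.

Lemma Cn_id k : Cn k (fun x : R => x).
Proof.
case: k => // k; by apply: (@Cn_is _ _ (fun=> 1)); exact: Cn_cst.
Qed.

Lemma CnD k f g : Cn k f -> Cn k g -> Cn k (fun x => f x + g x).
Proof.
elim: k f g => // k IH f g cf cg.
apply: Cn_is (fun x => is_derive1D (Cn_derive x cf) (Cn_derive x cg)) _.
by apply: IH; [case: cf|case: cg].
Qed.

Lemma CnM k f g : Cn k f -> Cn k g -> Cn k (fun x => f x * g x).
Proof.
elim: k f g => // k IH f g cf cg.
apply: Cn_is (fun x => is_derive1M (Cn_derive x cf) (Cn_derive x cg)) _.
apply: CnD; apply: IH.
- by case: cf. - exact: CnS. - exact: CnS. - by case: cg.
Qed.

Lemma Cn_comp k f g : Cn k f -> Cn k g -> Cn k (fun x => f (g x)).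
Proof.
elim: k f g => // k IH f g cf cg.
apply: Cn_is (fun x => is_derive1_chain (Cn_derive _ cf) (Cn_derive x cg)) _.
by apply: CnM; [apply: IH; [case: cf|exact: CnS]|case: cg].
Qed.

Lemma CnV k f : (forall x, f x != 0) -> Cn k f -> Cn k (fun x => (f x)^-1).
Proof.
move=> f0; elim: k => // k IH cf.
apply: Cn_is (fun x => is_derive1V (f0 x) (Cn_derive x cf)) _.
have -> : (fun x => - derive1 f x / f x ^+ 2) =
    (fun x => (-1) * (derive1 f x * ((f x)^-1 * (f x)^-1))).
  by apply/funext => x; field.
have cV := IH (CnS cf).
by apply: CnM; [exact: Cn_cst|apply: CnM; [case: cf|exact: CnM]].
Qed.

Lemma Cn_expR k : Cn k (@expR R).
Proof.
by elim: k => // k IH; apply: (@Cn_is _ _ (@expR R)) => // x.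
Qed.

(** One term of the exponential series is at most its sum. *)
Lemma expR_pow_bound n x : 0 <= x -> x ^+ n * expR (- x) <= n`!%:R.
Proof.
move=> x0; rewrite expRN ler_pdivrMr ?expR_gt0//.
case: n => [|n].
  by rewrite expr0 fact0 mul1r; case: ltgtP x0 => //[x0|<-];
    rewrite ?expR0// ltW// expR_gt1.
have := expR_ge1Dxn n x0.
rewrite -[leLHS]/(1 + x ^+ n.+1 / (n.+1)`!%:R) => h.
have : x ^+ n.+1 / (n.+1)`!%:R <= expR x by apply: le_trans h; rewrite lerDr.
by rewrite ler_pdivrMr ?ltr0n ?fact_gt0// mulrC.
Qed.

(** The usual smooth function [exp(-1/x)] that vanishes on the negative
    half-line is [flat 0]; the powers of [x] are there because the derivative of
    [flat k] is a combination of [flat k.+1] and [flat k.+2]. *)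
Definition flat k x : R := if 0 < x then x ^- k * expR (- x^-1) else 0.

Lemma flat_bound k x : `|flat k x| <= (k.+2)`!%:R * x ^+ 2.
Proof.
rewrite /flat; case: ifPn => [x0|_]; last first.
  by rewrite normr0 mulr_ge0// sqr_ge0.
rewrite ger0_norm ?mulr_ge0 ?expR_ge0 ?invr_ge0 ?exprn_ge0 ?(ltW x0)//.
have xi : 0 <= x^-1 by rewrite invr_ge0 ltW.
have := expR_pow_bound k.+2 xi => h.
rewrite -ler_pdivrMr ?exprn_gt0//; apply: le_trans h.
by rewrite mulrAC -exprVn -exprVn -exprD addn2.
Qed.

Lemma is_derive_flat k x :
  is_derive x 1 (flat k) (flat k.+2 x - k%:R * flat k.+1 x).
Proof.
case: (ltgtP x 0) => x0.
- have near0 : \near x, cst 0 x = flat k x.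
    have : \near x, x < 0 by exact: lt_nbhsl.
    by apply: filterS => z z0; rewrite /flat ltNge (ltW z0).
  rewrite /flat ltNge (ltW x0) /= mulr0 subr0.
  exact: near_eq_is_derive near0 _.
- have near0 : \near x, x ^- k * expR (- x^-1) = flat k x.
    have : \near x, 0 < x by exact: lt_nbhsr.
    by apply: filterS => z z0; rewrite /flat z0.
  apply: near_eq_is_derive near0 _.
  have xn0 : x != 0 by rewrite gt_eqF.
  have dV : is_derive x 1 (fun y : R => y^-1) (- 1 / x ^+ 2).
    by apply: is_derive1V => //; exact: is_derive_id.
  have dX : is_derive x 1 (fun y : R => y ^- k) (- (k%:R * x ^+ k.-1) / (x ^+ k) ^+ 2).
    apply: is_derive1V; first by rewrite expf_neq0.
    by split; [exact: exprn_derivable|rewrite exp_derive /GRing.scale /= mulr1 mulr_natl].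
  have dN : is_derive x 1 (fun y : R => - y^-1) (- (- 1 / x ^+ 2)).
    exact: is_deriveN.
  have dE := @is_derive1_chain (@expR R) (fun y : R => - y^-1) x _ _
    (is_derive_expR (- x^-1)) dN.
  refine (is_derive_eq (is_derive1M dX dE) _).
  rewrite /flat x0; case: k {dX} => [|k] /=; first by field.
  have : x ^+ k != 0 by rewrite expf_neq0.
  by rewrite !exprS; move: (x ^+ k) (k.+1%:R) => u v u0; field; rewrite u0.
- rewrite x0 /flat ltxx mulr0 subr0.
  apply: (@is_derive_quadratic _ _ _ (k.+2)`!%:R) => // h.
  by rewrite addr0 /flat ltxx subr0 mulr0 subr0; exact: flat_bound.
Qed.

Lemma Cn_flat m k : Cn m (flat k).
Proof.
elim: m k => // m IH k; apply: Cn_is (is_derive_flat k) _.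
have -> : (fun x => flat k.+2 x - k%:R * flat k.+1 x) =
    (fun x => flat k.+2 x + (- k%:R) * flat k.+1 x).
  by apply/funext => x; rewrite mulNr.
by apply: CnD; [exact: IH|apply: CnM; [exact: Cn_cst|exact: IH]].
Qed.

Lemma flat_ge0 k x : 0 <= flat k x.
Proof.
rewrite /flat; case: ifPn => // x0.
by rewrite mulr_ge0 ?expR_ge0// invr_ge0 exprn_ge0// ltW.
Qed.

Lemma flat_gt0 k x : 0 < x -> 0 < flat k x.
Proof. by move=> x0; rewrite /flat x0 mulr_gt0 ?expR_gt0// invr_gt0 exprn_gt0. Qed.

Lemma flat_eq0 k x : x <= 0 -> flat k x = 0.
Proof. by move=> x0; rewrite /flat ltNge x0. Qed.

(** With [p = flat 0 (r2^2 - x^2)] and [q = flat 0 (x^2 - r1^2)], the function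
    [p / (p + q)] has the required values, and [p + q] never vanishes because
    [r1 < r2]. *)
Lemma smooth_plateau (r1 r2 : R) : 0 < r1 -> r1 < r2 ->
  exists b : R -> R, [/\ forall k, Cn k b, forall x, 0 <= b x <= 1,
    forall x, `|x| <= r1 -> b x = 1 & forall x, r2 <= `|x| -> b x = 0].
Proof.
move=> r10 r12; have r20 := lt_trans r10 r12.
pose p x := flat 0 (r2 ^+ 2 - x ^+ 2); pose q x := flat 0 (x ^+ 2 - r1 ^+ 2).
have p0 x : 0 <= p x by exact: flat_ge0.
have q0 x : 0 <= q x by exact: flat_ge0.
have sq : r1 ^+ 2 < r2 ^+ 2 by rewrite ltr_pXn2r// nnegrE ltW.
have pq x : 0 < p x + q x.
  have [h|h] := ltP (x ^+ 2) (r2 ^+ 2).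
    by rewrite ltr_pwDl// /p flat_gt0// subr_gt0.
  by rewrite ltr_wpDl// /q flat_gt0// subr_gt0 (lt_le_trans sq).
have C k c d : Cn k (fun x : R => c * (x * x) + d).
  apply: CnD; last exact: Cn_cst.
  by apply: CnM; [exact: Cn_cst|apply: CnM; exact: Cn_id].
have Cp k : Cn k p.
  have -> : p = (fun x => flat 0 ((-1) * (x * x) + r2 ^+ 2)).
    by apply/funext => x; rewrite /p; congr flat; ring.
  by apply: (@Cn_comp _ (flat 0)); [exact: Cn_flat|exact: C].
have Cq k : Cn k q.
  have -> : q = (fun x => flat 0 (1 * (x * x) + - r1 ^+ 2)).
    by apply/funext => x; rewrite /q; congr flat; ring.
  by apply: (@Cn_comp _ (flat 0)); [exact: Cn_flat|exact: C].
exists (fun x => p x * (p x + q x)^-1); split.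
- move=> k; apply: CnM => //; apply: CnV; last exact: CnD.
  by move=> x; rewrite gt_eqF.
- move=> x; rewrite divr_ge0 ?(ltW (pq x))//=.
  by rewrite ler_pdivrMr// mul1r lerDl.
- move=> x xr; have q00 : q x = 0.
    apply: flat_eq0; rewrite subr_le0 -(real_normK (num_real x)).
    by rewrite ler_pXn2r// nnegrE// ltW.
  by have := pq x; rewrite q00 addr0 => /gt_eqF px; rewrite divff// px.
- move=> x xr; have -> : p x = 0.
    apply: flat_eq0; rewrite subr_le0 -(real_normK (num_real x)).
    by rewrite ler_pXn2r// nnegrE// ltW.
  by rewrite mul0r.
Qed.

End smooth_real.

(** * The heat flow of an interval *)

Section heat_profile.
Context {R : realType}.
Local Notation mu := (@lebesgue_measure R).
Implicit Types (x y s t q c al be : R).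

(** An antiderivative of [exp(-x^2)]: only its derivative and the existence of
    distinct limits at both ends matter, not its normalization. *)
Definition erfR (x : R) : R := \int[mu]_(t in `]-oo, x]) gauss_fun t.

Lemma is_derive_erfR x : is_derive x 1 erfR (expR (- x ^+ 2)).
Proof.
have h : derivable erfR x 1 /\ derive1 erfR x = gauss_fun x.
  apply: (@continuous_FTC1 R gauss_fun -oo%O x (x + 1)).
  - by rewrite ltrDl.
  - by apply: (integrableS _ _ _ integrableT_gauss).
  - by rewrite ltNyr.
  - exact: continuous_gauss_fun.
have [d e] := h; rewrite -[X in is_derive _ _ _ X]/(gauss_fun x) -e.
exact: is_derive_derive1.
Qed.

Lemma erfR_MVT x y : x < y ->
  exists2 c, x < c < y & erfR y - erfR x = expR (- c ^+ 2) * (y - x).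
Proof.
move=> xy.
have [z zxy ->] := @MVT _ erfR (fun z => expR (- z ^+ 2)) x y xy
  (fun z _ => is_derive_erfR z)
  (continuous_subspaceT (fun z => is_derive_continuous (is_derive_erfR z))).
by exists z.
Qed.

Lemma erfR_nondecreasing x y : x <= y -> erfR x <= erfR y.
Proof.
rewrite le_eqVlt => /orP[/eqP->//|/[dup] xy /erfR_MVT[c _ e]].
by rewrite -subr_ge0 e mulr_ge0 ?expR_ge0// subr_ge0 ltW.
Qed.

Lemma erfR_increasing x y : x < y -> erfR x < erfR y.
Proof.
move=> /[dup] xy /erfR_MVT[c _ e].
by rewrite -subr_gt0 e mulr_gt0 ?expR_gt0// subr_gt0.
Qed.

Lemma erfR_ge0 x : 0 <= erfR x.
Proof. by apply: Rintegral_ge0 => t _; exact: gauss_fun_ge0. Qed.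

Lemma erfR_bounded x : erfR x <= \int[mu]_t gauss_fun t.
Proof.
rewrite /erfR Rintegral_mkcond.
apply: le_Rintegral => //.
- rewrite -restrict_EFin; apply/integrable_restrict => //.
  by rewrite setTI; apply: (integrableS _ _ _ integrableT_gauss).
- exact: integrableT_gauss.
- by move=> t _; rewrite patchE; case: ifP => // _; exact: gauss_fun_ge0.
Qed.

(** [G0] and [G1] are the limits of [erfR] at the two ends; monotonicity turns
    the infimum and the supremum into limits. *)
Lemma erfR_limits : exists G0 G1 : R, [/\ G0 < G1,
   forall x, G0 <= erfR x <= G1 &
   forall e, 0 < e -> exists A, 0 < A /\ forall x, A <= x ->
     G1 - e < erfR x /\ erfR (- x) < G0 + e].
Proof.
pose S := range erfR.
have hs : has_sup S.
  split; first by exists (erfR 0); exists 0.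
  by exists (\int[mu]_t gauss_fun t) => _ [x _ <-]; exact: erfR_bounded.
have hi : has_inf S.
  split; first by exists (erfR 0); exists 0.
  by exists 0 => _ [x _ <-]; exact: erfR_ge0.
have lb x : inf S <= erfR x by apply: ge_inf; [case: hi|exists x].
have ub x : erfR x <= sup S by apply: ub_le_sup; [case: hs|exists x].
exists (inf S), (sup S); split.
- exact: (le_lt_trans (lb 0) (lt_le_trans (erfR_increasing ltr01) (ub 1))).
- by move=> x; rewrite lb ub.
- move=> e e0; have [_ [x _ <-] hx] := sup_adherent e0 hs.
  have [_ [y _ <-] hy] := inf_adherent e0 hi.
  exists (`|x| + `|y| + 1); split; first by rewrite ltr_wpDl// addr_ge0.
  move=> z zA; split.
    apply: (lt_le_trans hx); apply: erfR_nondecreasing; apply: le_trans zA.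
    by rewrite -addrA (le_trans (ler_norm _))// lerDl addr_ge0.
  apply: le_lt_trans hy; apply: erfR_nondecreasing.
  rewrite lerNl; apply: le_trans zA; rewrite (le_trans (ler_norm _))// normrN.
  by rewrite addrAC lerDr addr_ge0.
Qed.

Lemma Cn_erfR k : Cn k erfR.
Proof.
case: k => // k; apply: Cn_is is_derive_erfR _.
apply: (@Cn_comp _ _ (@expR R)); first exact: Cn_expR.
have -> : (fun x : R => - x ^+ 2) = (fun x => (-1) * (x * x)).
  by apply/funext => x; ring.
by apply: CnM; [exact: Cn_cst|apply: CnM; exact: Cn_id].
Qed.

(** The Gaussian decay away from the interval beats the powers of [q = (4s)^(-1/2)]
    that come from differentiating the heat kernel; with constants independent
    of [q], this makes the commutator bound uniform in time. *)
Lemma expR_pow_gauss_bound k (c : R) : 0 < c ->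
  exists C, forall q, 0 <= q -> q ^+ k * expR (- (c * q ^+ 2)) <= C.
Proof.
move=> c0; exists (1 + k`!%:R / c ^+ k) => q q0.
have h : (q ^+ 2) ^+ k * expR (- (c * q ^+ 2)) <= k`!%:R / c ^+ k.
  rewrite ler_pdivlMr ?exprn_gt0// mulrAC mulrC -[_ * c ^+ k]mulrC -exprMn.
  by rewrite mulrC; apply: expR_pow_bound; rewrite mulr_ge0 ?sqr_ge0// ltW.
have q1 : q ^+ k <= 1 + (q ^+ 2) ^+ k.
  have [q1|q1] := leP q 1.
    by rewrite (le_trans (exprn_ile1 _ _ _))// lerDl exprn_ge0// sqr_ge0.
  rewrite -exprM mulnC exprM expr2.
  by rewrite ler_wpDl// ler_peMl ?exprn_ge0// exprn_ege1// ltW.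
apply: (@le_trans _ _ ((1 + (q ^+ 2) ^+ k) * expR (- (c * q ^+ 2)))).
  by rewrite ler_wpM2r// expR_ge0.
rewrite mulrDl mul1r lerD// -expR0 ler_expR oppr_le0.
by rewrite mulr_ge0 ?sqr_ge0// ltW.
Qed.

(** The factor [(4s)^(-1/2)] of the heat kernel at time [s]. *)
Definition hscale (s : R) : R := (2 * Num.sqrt s)^-1.

Lemma hscale_gt0 s : 0 < s -> 0 < hscale s.
Proof. by move=> s0; rewrite invr_gt0 mulr_gt0// sqrtr_gt0. Qed.

Lemma hscale_le s t : 0 < s -> s <= t -> hscale t <= hscale s.
Proof.
move=> s0 st; have t0 := lt_le_trans s0 st.
by rewrite /hscale lef_pV2 ?posrE ?mulr_gt0 ?sqrtr_gt0// ler_pM2l// ler_wsqrtr.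
Qed.

Lemma is_derive_hscale s : 0 < s ->
  is_derive s 1 hscale (- (2 * hscale s ^+ 3)).
Proof.
move=> s0; have q0 : 0 < Num.sqrt s by rewrite sqrtr_gt0.
have d1 := is_derive1Zl 2 (is_derive1_sqrt s0).
have n0 : 2 * Num.sqrt s != 0 by rewrite gt_eqF// mulr_gt0.
refine (is_derive_eq (@is_derive1V _ (fun y => 2 * Num.sqrt y) s _ n0 d1) _).
by rewrite /hscale; field; rewrite gt_eqF.
Qed.

(** With [q = hscale s], this is, up to the factor [G1 - G0], the solution at
    time [s] of the heat equation on the line issued from the indicator of
    [[al, be]].  Its first two derivatives in [x] follow; by the heat equation,
    the second one is also the derivative in time. *)
Definition hbox (al be q x : R) : R :=
  erfR (q * (x - al)) - erfR (q * (x - be)).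
Definition hbox' (al be q x : R) : R :=
  q * (expR (- (q * (x - al)) ^+ 2) - expR (- (q * (x - be)) ^+ 2)).
Definition hbox'' (al be q x : R) : R :=
  - (2 * q ^+ 3) * ((x - al) * expR (- (q * (x - al)) ^+ 2) -
                    (x - be) * expR (- (q * (x - be)) ^+ 2)).

Lemma is_derive_affine q c x : is_derive x 1 (fun y => q * (y - c)) q.
Proof.
refine (is_derive_eq (is_derive1Zl q
  (is_derive1B (is_derive_id x 1) (is_derive_cst c x 1))) _).
by rewrite subr0 mulr1.
Qed.

Lemma is_derive_gauss_affine q c x :
  is_derive x 1 (fun y => expR (- (q * (y - c)) ^+ 2))
   (- (2 * q ^+ 2) * ((x - c) * expR (- (q * (x - c)) ^+ 2))).
Proof.
have d1 := is_derive_affine q c x.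
have d2 := is_derive1N (is_derive1M d1 d1).
have d3 := @is_derive1_chain _ (@expR R) _ x _ _
  (is_derive_expR (- (q * (x - c) * (q * (x - c))))) d2.
rewrite [X in is_derive _ _ X _](_ : _ =
    (fun y => expR (- (q * (y - c) * (q * (y - c)))))); last first.
  by apply/funext => y; rewrite expr2.
by refine (is_derive_eq d3 _); rewrite expr2; ring.
Qed.

Lemma is_derive_hbox al be q x :
  is_derive x 1 (hbox al be q) (hbox' al be q x).
Proof.
have d c := @is_derive1_chain _ erfR _ x _ _
  (is_derive_erfR (q * (x - c))) (is_derive_affine q c x).
refine (is_derive_eq (is_derive1B (d al) (d be)) _).
by rewrite /hbox'; ring.
Qed.

Lemma is_derive_hbox' al be q x :
  is_derive x 1 (hbox' al be q) (hbox'' al be q x).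
Proof.
have d c := is_derive_gauss_affine q c x.
refine (is_derive_eq (is_derive1Zl q (is_derive1B (d al) (d be))) _).
by rewrite /hbox''; ring.
Qed.

Lemma is_derive_hbox_time al be s x : 0 < s ->
  is_derive s 1 (fun s => hbox al be (hscale s) x) (hbox'' al be (hscale s) x).
Proof.
move=> s0.
have d c := @is_derive1_chain _ erfR _ s _ _ (is_derive_erfR _)
  (is_derive1M (is_derive_hscale s0) (is_derive_cst (x - c) s 1)).
refine (is_derive_eq (is_derive1B (d al) (d be)) _).
by rewrite /hbox'' /=; ring.
Qed.

Lemma Cn_hbox k al be q : Cn k (hbox al be q).
Proof.
have c e : Cn k (fun x : R => erfR (q * (x - e))).
  apply: (@Cn_comp _ _ erfR); first exact: Cn_erfR.
  by apply: CnM; [exact: Cn_cst|apply: CnD; [exact: Cn_id|exact: Cn_cst]].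
have -> : hbox al be q = (fun x => erfR (q * (x - al)) +
    (-1) * erfR (q * (x - be))).
  by apply/funext => x; rewrite mulN1r.
by apply: CnD => //; apply: CnM => //; exact: Cn_cst.
Qed.

(** The factor [be - al] is what eventually produces the volume of the box;
    the point [u] is a difference between [x] and a point of the interval, so
    that the Gaussian is small when [x] is far from it. *)
Lemma hbox_MVT al be q x : al < be -> 0 < q ->
  exists2 u, x - be < u < x - al &
    hbox al be q x = q * (be - al) * expR (- (q * u) ^+ 2).
Proof.
move=> albe q0.
have lt : q * (x - be) < q * (x - al) by rewrite ltr_pM2l// ltrD2l ltrN2.
have [c /andP[c1 c2]] := erfR_MVT lt; rewrite /hbox => ->.
exists (q^-1 * c).
  by rewrite -(ltr_pM2l q0) -[X in _ && X](ltr_pM2l q0) mulVKf ?gt_eqF// c1.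
by rewrite mulVKf ?gt_eqF//; ring.
Qed.

Lemma hbox'_MVT al be q x : al < be -> 0 < q ->
  exists2 u, x - be < u < x - al &
    hbox' al be q x = - (2 * q ^+ 3 * (be - al) * u * expR (- (q * u) ^+ 2)).
Proof.
move=> albe q0.
have lt : x - be < x - al by rewrite ltrD2l ltrN2.
pose f y := expR (- (q * (y - 0)) ^+ 2).
have df y : is_derive y 1 f (- (2 * q ^+ 2) *
  ((y - 0) * expR (- (q * (y - 0)) ^+ 2))) := is_derive_gauss_affine q 0 y.
have [u ux e] := @MVT _ f _ _ _ lt (fun z _ => df z)
  (continuous_subspaceT (fun z => is_derive_continuous (df z))).
exists u => //; move: e; rewrite /f !subr0 /hbox' => ->.
by ring.
Qed.

(** As the time decreases to 0 the two error functions converge to their limits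
    at infinity, on the side given by the position of [x]. *)
Lemma hbox_limit G0 G1 al be :
  (forall e, 0 < e -> exists A, 0 < A /\ forall x, A <= x ->
     G1 - e < erfR x /\ erfR (- x) < G0 + e) ->
  (forall x, G0 <= erfR x <= G1) -> al < be ->
  forall x (s : R^nat), (forall k, 0 < s k) -> s k @[k --> \oo] --> 0 ->
  x != al -> x != be ->
  hbox al be (hscale (s k)) x @[k --> \oo] -->
    (G1 - G0) * \1_(`]al, be[%classic) x.
Proof.
move=> lim bd albe x s s0 sc xal xbe.
have qy A : 0 < A -> \forall k \near \oo, A <= hscale (s k).
  move=> A0; have e0 : 0 < (2 * A)^-1 ^+ 2 by rewrite exprn_gt0// invr_gt0 mulr_gt0.
  have /cvgr0_norm_lt /(_ _ e0) := sc; apply: filterS => k.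
  rewrite gtr0_norm// /hscale => h.
  rewrite -[leLHS]invrK lef_pV2 ?posrE ?invr_gt0 ?mulr_gt0 ?sqrtr_gt0//.
  rewrite -ler_pdivlMl// -invfM mulrC -[leRHS]ger0_norm ?invr_ge0 ?mulr_ge0 ?(ltW A0)//.
  by rewrite -sqrtr_sqr mulrC ler_wsqrtr// ltW.
have L c : x != c -> erfR (hscale (s k) * (x - c)) @[k --> \oo] -->
    (if c < x then G1 else G0).
  move=> xc; apply/cvgrPdist_lt => e e0.
  have [A [A0 hA]] := lim _ e0.
  have xc0 : 0 < `|x - c| by rewrite normr_gt0 subr_eq0.
  have := qy (A / `|x - c|) (divr_gt0 A0 xc0); apply: filterS => k.
  rewrite ler_pdivrMr// => /hA[h1 h2].
  case: ifPn => [cx|]; last rewrite -leNgt => cx.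
    move: h1; rewrite gtr0_norm ?subr_gt0// => h1.
    have /andP[_ b] := bd (hscale (s k) * (x - c)).
    by rewrite ger0_norm ?subr_ge0// ltrBlDr -ltrBlDl.
  move: h2; rewrite ler0_norm ?subr_le0// mulrN opprK => h2.
  have /andP[b _] := bd (hscale (s k) * (x - c)).
  by rewrite ler0_norm ?subr_le0// opprB ltrBlDl.
have -> : (G1 - G0) * \1_`]al, be[%classic x =
    (if al < x then G1 else G0) - (if be < x then G1 else G0); last first.
  exact: cvgB (L al xal) (L be xbe).
rewrite indicE; case: (ltP al x) => alx; case: (ltP be x) => bex.
- by rewrite memNset ?mulr0 ?subrr//= in_itv/= alx/= => /(lt_trans bex); rewrite ltxx.
- rewrite mem_set ?mulr1//= in_itv/= alx/= lt_neqAle bex andbT//.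
- by move: (lt_le_trans (lt_trans albe bex) alx); rewrite ltxx.
- by rewrite memNset ?mulr0 ?subrr//= in_itv/= ltNge alx.
Qed.

End heat_profile.

(** * The heat flow of an interval with a cutoff *)

Section cutoff_profile.
Context {R : realType}.
Implicit Types (x y s t q c al be u v e : R).

Lemma compactly_supported_bounded (f : R -> R) (r : R) : 0 < r ->
  (forall x, {for x, continuous f}) -> (forall x, r < `|x| -> f x = 0) ->
  exists B, forall x, `|f x| <= B.
Proof.
move=> r0 fc f0.
have rr : - r <= r by rewrite ge0_cp// ltW.
have : {within `[- r, r], continuous (fun x => `|f x|)}.
  by apply: continuous_subspaceT => x; apply: continuous_comp;
    [exact: fc|exact: norm_continuous].
move=> /(EVT_max rr)[x0 _ h].
exists `|f x0| => x; have [xr|xr] := leP `|x| r; last by rewrite f0// normr0.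
by apply: h; rewrite in_itv/= -ler_norml.
Qed.

Lemma near_cst_derive1 (f : R -> R) x k : (\near x, f x = k) -> derive1 f x = 0.
Proof.
move=> h; have h' : \near x, cst k x = f x by apply: filterS h => y ->.
exact: derive1_is (near_eq_is_derive h' (is_derive_cst k x 1)).
Qed.

Lemma near_cst_derive1_near (f : R -> R) x k : (\near x, f x = k) ->
  \near x, derive1 f x = 0.
Proof.
by move/near_join; apply: filterS => y; exact: near_cst_derive1.
Qed.

Variables (b : R -> R) (r0 r1 r2 B : R).
Hypotheses (r0_gt0 : 0 < r0) (r01 : r0 < r1) (r12 : r1 < r2).
Hypothesis b_smooth : forall k, Cn k b.
Hypothesis b01 : forall x, 0 <= b x <= 1.
Hypothesis b1 : forall x, `|x| <= r1 -> b x = 1.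
Hypothesis b0 : forall x, r2 <= `|x| -> b x = 0.
Local Notation b' := (derive1 b).
Local Notation b'' := (derive1 (derive1 b)).

Lemma cutoff_near x : `|x| < r1 \/ r2 < `|x| -> exists k, \near x, b x = k.
Proof.
case=> xr; [exists 1|exists 0].
  have : \near x, `|x| < r1.
    by have := @norm_continuous _ R x => /(_ _ (lt_nbhsl xr)).
  by apply: filterS => y yr; rewrite b1// ltW.
have : \near x, r2 < `|x|.
  by have := @norm_continuous _ R x => /(_ _ (lt_nbhsr xr)).
by apply: filterS => y yr; rewrite b0// ltW.
Qed.

Lemma cutoff_derive0 x : `|x| < r1 \/ r2 < `|x| -> b' x = 0 /\ b'' x = 0.
Proof.
move=> /cutoff_near[k hk]; split; first exact: near_cst_derive1 hk.
exact: near_cst_derive1 (near_cst_derive1_near hk).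
Qed.

Lemma cutoff_derive_bounded : exists2 B, 0 <= B &
  forall x, `|b' x| <= B /\ `|b'' x| <= B.
Proof.
have r20 : 0 < r2 by rewrite (lt_trans _ r12)// (lt_trans _ r01).
have [] := @compactly_supported_bounded b' r2 r20.
- move=> x; have h : Cn 1 b' by case: (b_smooth 2).
  exact: is_derive_continuous (Cn_derive x h).
- by move=> x xr; have [] := cutoff_derive0 (or_intror xr).
move=> B1 h1; have [] := @compactly_supported_bounded b'' r2 r20.
- move=> x; have h : Cn 1 b'' by case: (b_smooth 3) => _ [].
  exact: is_derive_continuous (Cn_derive x h).
- by move=> x xr; have [] := cutoff_derive0 (or_intror xr).
move=> B2 h2; exists (`|B1| + `|B2|) => // x; split.
  by rewrite (le_trans (h1 x))// (le_trans (ler_norm _))// lerDl.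
by rewrite (le_trans (h2 x))// (le_trans (ler_norm _))// lerDr.
Qed.

Hypothesis B_ge0 : 0 <= B.
Hypothesis bB : forall x, `|b' x| <= B /\ `|b'' x| <= B.

Definition cuth c al be s x : R := b (x - c) * hbox al be (hscale s) x.
Definition cuth_t c al be s x : R := b (x - c) * hbox'' al be (hscale s) x.
(** The commutator of the second derivative with the cutoff, applied to the
    heat evolution, by the Leibniz rule. *)
Definition commut c al be s x : R := 2 * b' (x - c) * hbox' al be (hscale s) x +
  b'' (x - c) * hbox al be (hscale s) x.

Lemma Cn_shift k f c : Cn k f -> Cn k (fun x : R => f (x - c)).
Proof.
move=> cf; apply: (@Cn_comp _ _ f) => //.
by apply: CnD; [exact: Cn_id|exact: Cn_cst].
Qed.

Lemma Cn_cuth k c al be s : Cn k (cuth c al be s).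
Proof. by apply: CnM; [exact: Cn_shift|exact: Cn_hbox]. Qed.

(** The product fails to solve the heat equation by the commutator only. *)
Lemma cuth_derive2 c al be s x :
  derive1 (derive1 (cuth c al be s)) x = cuth_t c al be s x + commut c al be s x.
Proof.
have db (f : R -> R) y : (forall k, Cn k f) ->
    is_derive y 1 (fun z => f (z - c)) (derive1 f (y - c)).
  move=> fs; refine (is_derive_eq (is_derive1_chain (Cn_derive _ (fs 1))
    (is_derive1B (is_derive_id y 1) (is_derive_cst c y 1))) _).
  by rewrite subr0 mulr1.
have b's k : Cn k b' by have [] := b_smooth k.+1.
have d1 y := is_derive1M (db b y b_smooth) (is_derive_hbox al be (hscale s) y).
rewrite (derive1_funext d1).
have d2 := is_derive1D
  (is_derive1M (db b' x b's) (is_derive_hbox al be (hscale s) x))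
  (is_derive1M (db b x b_smooth) (is_derive_hbox' al be (hscale s) x)).
by rewrite (derive1_is d2) /cuth_t /commut; ring.
Qed.

Lemma is_derive_cuth_t c al be s x : 0 < s ->
  is_derive s 1 (fun s => cuth c al be s x) (cuth_t c al be s x).
Proof. by move=> s0; apply: is_derive1Zl; exact: is_derive_hbox_time. Qed.

Lemma cuth_eq0 c al be s x : r2 <= `|x - c| -> cuth c al be s x = 0.
Proof. by move=> xr; rewrite /cuth b0// mul0r. Qed.

(** The commutator only involves derivatives of the cutoff, which is constant
    on both regions. *)
Lemma commut_eq0 c al be s x : `|x - c| < r1 \/ r2 < `|x - c| ->
  commut c al be s x = 0.
Proof.
by move=> /cutoff_derive0[h1 h2]; rewrite /commut h1 h2 mulr0 !mul0r addr0.
Qed.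

Lemma cuth_bound c al be s x : 0 < s -> al < be ->
  0 <= cuth c al be s x <= hscale s * (be - al).
Proof.
move=> s0 albe; have q0 := hscale_gt0 s0; have /andP[bg0 bl1] := b01 (x - c).
have [u _ e] := hbox_MVT x albe q0; rewrite /cuth e.
have p0 : 0 <= hscale s * (be - al) by rewrite mulr_ge0 ?subr_ge0 ?ltW.
rewrite !mulr_ge0 ?expR_ge0 ?subr_ge0 ?(ltW q0) ?(ltW albe)//=.
rewrite (le_trans (ler_piMl _ bl1)) ?(mulr_ge0 p0) ?expR_ge0//.
by rewrite ler_piMr// -expR0 ler_expR oppr_le0 sqr_ge0.
Qed.

Lemma cuth_le (G : R) c al be s x : 0 < s -> al < be -> 0 <= G ->
  (forall y z, erfR y - erfR z <= G) -> cuth c al be s x <= G.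
Proof.
move=> s0 albe G0 hG; have /andP[bg0 bl1] := b01 (x - c).
have h0 : 0 <= hbox al be (hscale s) x.
  rewrite subr_ge0; apply: erfR_nondecreasing; rewrite ler_pM2l ?hscale_gt0//.
  by rewrite lerD2l lerN2 ltW.
by rewrite (le_trans (ler_piMl h0 bl1))// /hbox.
Qed.

Section box_inside.
Variables (c al be : R).
Hypotheses (al_ge : c - r0 <= al) (albe : al < be) (be_le : be <= c + r0).

(** On the support of the commutator, [x] is at distance at least [r1 - r0]
    from the interval, which gives the Gaussian factor; the powers of [hscale s]
    that it dominates are kept explicit since those of the other coordinates
    still have to be multiplied in. *)
Lemma commut_bound s x : 0 < s -> `|commut c al be s x| <= (be - al) *
  (B * (8 * r2 * hscale s ^+ 3 + hscale s) *
   expR (- ((r1 - r0) ^+ 2 * hscale s ^+ 2))).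
Proof.
move=> s0; have q0 := hscale_gt0 s0; set q := hscale s in q0 *.
have ba : 0 <= be - al by rewrite subr_ge0 ltW.
have r20 : 0 < r2 by rewrite (lt_trans _ r12)// (lt_trans _ r01).
have [[xr|xr]|/not_orP[/negP xr1 /negP xr2]] :=
    pselect (`|x - c| < r1 \/ r2 < `|x - c|).
- rewrite commut_eq0 ?normr0; last by left.
  by rewrite !mulr_ge0 ?expR_ge0// addr_ge0 ?mulr_ge0 ?exprn_ge0 ?(ltW r20) ?(ltW q0).
- rewrite commut_eq0 ?normr0; last by right.
  by rewrite !mulr_ge0 ?expR_ge0// addr_ge0 ?mulr_ge0 ?exprn_ge0 ?(ltW r20) ?(ltW q0).
rewrite -leNgt in xr1; rewrite -leNgt in xr2.
have ub u : x - be < u < x - al -> r1 - r0 <= `|u| <= 2 * r2.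
  move: r0_gt0 r01 r12 al_ge albe be_le => ? ? ? ? ? ?.
  move=> /andP[u1 u2]; move: xr2; rewrite ler_norml => /andP[x3 x4].
  apply/andP; split.
    by move: xr1; rewrite !ler_normr => /orP[h|h]; apply/orP; [left|right]; lra.
  by rewrite ler_norml; apply/andP; split; lra.
have E u : x - be < u < x - al ->
    expR (- (q * u) ^+ 2) <= expR (- ((r1 - r0) ^+ 2 * q ^+ 2)).
  move=> /ub/andP[h _]; rewrite ler_expR lerN2 exprMn mulrC ler_wpM2l ?sqr_ge0//.
  rewrite -[leRHS](real_normK (num_real u)) ler_pXn2r ?nnegrE//.
  by rewrite subr_ge0 ltW.
have [u ux eu] := hbox_MVT x albe q0; have [v vx ev] := hbox'_MVT x albe q0.
have [B1 B2] := bB (x - c).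
rewrite /commut -/q eu ev; set X := expR (- (_ * q ^+ 2)) in E *.
have q3 : 0 <= q ^+ 3 by rewrite exprn_ge0// ltW.
move: (q ^+ 3) q3 {ev} => Q Q0.
apply: (@le_trans _ _ (2 * B * (2 * Q * (be - al) * (2 * r2) * X) +
    B * (q * (be - al) * X))).
  rewrite (le_trans (ler_normD _ _))// lerD//.
    rewrite !normrM normrN !normrM (ger0_norm ba) ger0_norm//.
    rewrite (ger0_norm (expR_ge0 _)) (ger0_norm Q0).
    rewrite ler_pM ?mulr_ge0 ?expR_ge0 ?exprn_ge0 ?(ltW q0)// ?ler_wpM2l//.
    rewrite ler_pM ?mulr_ge0 ?expR_ge0 ?exprn_ge0 ?(ltW q0)// ?ler_wpM2l ?mulr_ge0//.
      by have /andP[] := ub v vx.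
    exact: E.
  rewrite normrM ler_pM// ger0_norm ?mulr_ge0 ?expR_ge0 ?(ltW q0)//.
  by rewrite ler_wpM2l ?mulr_ge0 ?(ltW q0)//; exact: E.
by rewrite le_eqVlt; apply/orP; left; apply/eqP; ring.
Qed.

Lemma cuth_t_bound s x : 0 < s ->
  `|cuth_t c al be s x| <= 8 * r2 * hscale s ^+ 3.
Proof.
move=> s0; have q0 := hscale_gt0 s0; rewrite /cuth_t; set q := hscale s in q0 *.
have r20 : 0 < r2 by rewrite (lt_trans _ r12)// (lt_trans _ r01).
have [xr|xr] := leP r2 `|x - c|.
  by rewrite b0// mul0r normr0 !mulr_ge0 ?exprn_ge0 ?(ltW r20) ?(ltW q0).
have e1 u : expR (- (q * u) ^+ 2) <= 1.
  by rewrite -expR0 ler_expR oppr_le0 sqr_ge0.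
have T e : c - r0 <= e <= c + r0 ->
    `|(x - e) * expR (- (q * (x - e)) ^+ 2)| <= 2 * r2.
  move=> /andP[e2 e3]; rewrite normrM (ger0_norm (expR_ge0 _)).
  rewrite -[leRHS]mulr1 ler_pM ?expR_ge0//.
  move: xr; rewrite ltr_norml => /andP[x3 x4].
  move: r0_gt0 r01 r12 => ? ? ?.
  by rewrite ler_norml; apply/andP; split; lra.
have /andP[bg0 bl1] := b01 (x - c).
rewrite normrM -[leRHS]mul1r ler_pM//; first by rewrite ger0_norm.
rewrite /hbox'' normrM normrN normrM ger0_norm// ger0_norm ?exprn_ge0 ?(ltW q0)//.
have -> : 8 * r2 * q ^+ 3 = 2 * q ^+ 3 * (2 * r2 + 2 * r2) by ring.
rewrite ler_wpM2l ?mulr_ge0 ?exprn_ge0 ?(ltW q0)//.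
move: r0_gt0 al_ge albe be_le => ? ? ? ?.
by rewrite (le_trans (ler_normB _ _))// lerD// T//; apply/andP; split; lra.
Qed.

End box_inside.
End cutoff_profile.

(** * Products of functions of one variable *)

Section tensor.
Context {R : realType}.

Definition upd (n : nat) (T : Type) (f : 'I_n -> T) (i : 'I_n) (g : T) :=
  fun j => if j == i then g else f j.

Lemma is_derive_prod (V : normedModType R) n (f : 'I_n -> V -> R)
    (df : 'I_n -> R) (x v : V) :
  (forall i, is_derive x v (f i) (df i)) ->
  is_derive x v (fun y => \prod_i f i y)
    (\sum_i \prod_j upd (f ^~ x) i (df i) j).
Proof.
elim: n f df => [|n IH] f df d.
  rewrite big_ord0 [X in is_derive _ _ X _](_ : _ = cst 1).
    exact: is_derive_cst.
  by apply/funext => y; rewrite big_ord0.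
rewrite [X in is_derive _ _ X _](_ : _ =
    f ord0 * (fun y => \prod_(i < n) f (lift ord0 i) y)); last first.
  by apply/funext => y; rewrite big_ord_recl.
have := IH (fun i => f (lift ord0 i)) (fun i => df (lift ord0 i))
  (fun i => d (lift ord0 i)).
move=> dI; refine (is_derive_eq (is_deriveM (d ord0) dI) _).
rewrite big_ord_recl big_ord_recl /= addrC /GRing.scale /=; congr (_ + _).
  by rewrite {1}/upd eqxx mulrC; congr (_ * _); apply: eq_bigr.
rewrite big_distrr /=; apply: eq_bigr => i _; rewrite big_ord_recl.
by rewrite {2}/upd (negPf (neq_lift ord0 i)); congr (_ * _).
Qed.

Context {n : nat}.
Implicit Types (f : 'I_n -> R -> R) (z : 'rV[R]_n).

Definition tens f z : R := \prod_i f i (z ord0 i).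

Lemma is_derive_coord (g : R -> R) (i j : 'I_n) z dg :
  is_derive (z ord0 j) 1 g dg ->
  is_derive z (delta_mx ord0 i) (fun y : 'rV[R]_n => g (y ord0 j))
    (if i == j then dg else 0).
Proof.
move=> d.
suff [e1 e2] : is_derive (0 : R) 1 (fun h : R => g ((h *: delta_mx ord0 i + z) ord0 j))
    (if i == j then dg else 0).
  split; first exact/derivable1P.
  rewrite -e2 /derive; set F1 := fun h => h^-1 *: _; set F2 := fun h => h^-1 *: _.
  suff -> : F1 = F2 by [].
  by apply/funext => h; rewrite /F1 /F2 /= addr0 scale0r add0r [h *: 1]mulr1.
move: d; have [<-|ij] := eqVneq i j => d.
  rewrite [X in is_derive _ _ X _](_ : _ = (fun h => g (1 * (h - (- z ord0 i))))).
    have d' : is_derive (1 * (0 - (- z ord0 i))) 1 g dg by rewrite mul1r sub0r opprK.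
    refine (is_derive_eq (@is_derive1_chain _ g (fun h => 1 * (h - (- z ord0 i))) 0 _ _ d'
      (is_derive_affine 1 (- z ord0 i) 0)) _).
    by rewrite mulr1.
  by apply/funext => h; rewrite !mxE !eqxx mulr1 opprK mul1r.
rewrite [X in is_derive _ _ X _](_ : _ = cst (g (z ord0 j))).
  exact: is_derive_cst.
by apply/funext => h; rewrite !mxE eqxx eq_sym (negPf ij) mulr0 add0r.
Qed.

Lemma is_derive_tens f i z : (forall j x, derivable (f j) x 1) ->
  is_derive z (delta_mx ord0 i) (tens f) (tens (upd f i (derive1 (f i))) z).
Proof.
move=> df; rewrite /tens.
have d j := is_derive_coord i (is_derive_derive1 (df j (z ord0 j))).
refine (is_derive_eq (is_derive_prod d) _).
rewrite (bigD1 i)//= [X in _ + X]big1 ?addr0; last first.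
  move=> j ji; apply/eqP/prodf_eq0; exists j => //.
  by rewrite /upd eqxx [i == j]eq_sym (negPf ji).
apply: eq_bigr => j _; rewrite /upd; case: (eqVneq j i) => [->|//].
by rewrite eqxx.
Qed.

Lemma partial_tens f i : (forall j x, derivable (f j) x 1) ->
  partial i (tens f) = tens (upd f i (derive1 (f i))).
Proof.
move=> df; apply/funext => z; rewrite /partial.
by have [_ ->] := is_derive_tens i z df.
Qed.

Definition smoothR (g : R -> R) := forall k, Cn k g.

Lemma smoothR_derivable g (x : R) : smoothR g -> derivable g x 1.
Proof. by move=> /(_ 1)[]. Qed.

Lemma smoothR_derive1 g : smoothR g -> smoothR (derive1 g).
Proof. by move=> h k; have [] := h k.+1. Qed.

Lemma smoothR_upd f i g : (forall j, smoothR (f j)) -> smoothR g ->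
  forall j, smoothR (upd f i g j).
Proof. by move=> hf hg j; rewrite /upd; case: ifP. Qed.

Lemma partials_tens (s : seq 'I_n) f : (forall i, smoothR (f i)) ->
  exists2 g, (forall i, smoothR (g i)) & partials s (tens f) = tens g.
Proof.
move=> hf; elim: s => [|i s [g hg e]]; first by exists f.
exists (upd g i (derive1 (g i))).
  by apply: smoothR_upd => //; exact: smoothR_derive1.
rewrite /= -/(partials s (tens f)) e partial_tens// => j x.
exact: smoothR_derivable.
Qed.

Lemma continuous_prod (T : topologicalType) m (f : 'I_m -> T -> R) (x : T) :
  (forall i, {for x, continuous (f i)}) ->
  {for x, continuous (fun y => \prod_i f i y)}.
Proof.
elim: m f => [|m IH] f fc.
  rewrite (_ : (fun y => _) = cst 1); first exact: cst_continuous.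
  by apply/funext => y; rewrite big_ord0.
rewrite (_ : (fun y => _) =
    f ord0 \* (fun y => \prod_(i < m) f (lift ord0 i) y)); last first.
  by apply/funext => y; rewrite big_ord_recl.
by apply: continuousM; [exact: fc|apply: IH => i; exact: fc].
Qed.

Lemma continuous_tens f : (forall i x, {for x, continuous (f i)}) ->
  continuous (tens f).
Proof.
move=> fc z; apply: continuous_prod => i.
by apply: continuous_comp; [exact: coord_continuous|exact: fc].
Qed.

Lemma smoothR_continuous g (x : R) : smoothR g -> {for x, continuous g}.
Proof. by move=> h; exact: is_derive_continuous (Cn_derive x (h 1)). Qed.

Lemma tens_smooth f : (forall i, smoothR (f i)) -> smooth_on setT (tens f).
Proof.
move=> hf s x _; have [g hg ->] := partials_tens s hf; split.
  by apply: continuous_tens => i y; exact: smoothR_continuous.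
move=> i; have [//] := is_derive_tens i x (fun j y => @smoothR_derivable (g j) y (hg j)).
Qed.

Definition cube (c : 'rV[R]_n) (r : R) : set 'rV[R]_n :=
  [set z | forall i, `|z ord0 i - c ord0 i| <= r].

Lemma cube_compact c r : compact (cube c r).
Proof.
have -> : cube c r = [set z | forall i, `[c ord0 i - r, c ord0 i + r]%classic (z ord0 i)].
  by apply/seteqP; split => z h i; have := h i; rewrite /= in_itv/= ler_distl.
by apply: (@rV_compact R n (fun i => `[c ord0 i - r, c ord0 i + r]%classic)) => i;
  exact: segment_compact.
Qed.

(** A product of smooth functions of the coordinates, each vanishing off an
    interval, is smooth with support in a cube. *)
Lemma tens_test (Omega : set 'rV[R]_n) c r f : cube c r `<=` Omega ->
  (forall i, smoothR (f i)) ->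
  (forall i x, r < `|x - c ord0 i| -> f i x = 0) ->
  test_function Omega (tens f).
Proof.
move=> cO hf f0; split; first exact: tens_smooth.
exists (cube c r); first by split => //; exact: cube_compact.
move=> z /existsNP[i /negP]; rewrite -ltNge => /f0 h.
by apply/eqP/prodf_eq0; exists i => //; rewrite h.
Qed.

Lemma partial2_tens f i : (forall j, smoothR (f j)) ->
  partial i (partial i (tens f)) = tens (upd f i (derive1 (derive1 (f i)))).
Proof.
move=> hf; rewrite partial_tens => [|j x]; last exact: smoothR_derivable.
rewrite partial_tens => [|j x]; last first.
  apply: smoothR_derivable; apply: smoothR_upd => //.
  exact: smoothR_derive1.
apply/funext => z; apply: eq_bigr => j _; rewrite /upd eqxx.
by case: eqVneq.
Qed.

Lemma tens_updB f i g h z :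
  tens (upd f i (fun x => g x + h x)) z =
  tens (upd f i g) z + tens (upd f i h) z.
Proof.
rewrite /tens (bigD1 i)// [X in _ = X + _](bigD1 i)// [X in _ = _ + X](bigD1 i)//.
rewrite /= /upd !eqxx mulrDl; congr (_ * _ + _ * _);
  by apply: eq_bigr => j /negPf ->.
Qed.

End tensor.

(** * Sets decided by finitely many rational half-spaces *)

Section grid.
Context {R : realType} {n : nat}.
Local Notation V := 'rV[R]_n.
Local Notation mu := (@lebesgue_rV R n).
Implicit Types (x y : V) (A G : set V) (k : nat) (i : 'I_n).

(** An enumeration of the rationals as real numbers. *)
Definition ratq (m : nat) : R := ratr (odflt 0 (@unpickle rat m)).

Lemma ratq_between (a b : R) : a < b -> exists m, a < ratq m < b.
Proof.
move=> /rat_in_itvoo[q h].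
by exists (pickle q); move: h; rewrite /ratq pickleK in_itv.
Qed.

(** The positions of the coordinates of [x] with respect to the first [k]
    rationals.  The fibres are products of intervals, there are finitely many of
    them, and they get finer as [k] grows. *)
Definition qcode k x : {ffun 'I_n * 'I_k -> bool} :=
  [ffun p : 'I_n * 'I_k => x ord0 p.1 < ratq p.2].

Lemma qcode_le k l x y : (k <= l)%N -> qcode l x = qcode l y -> qcode k x = qcode k y.
Proof.
move=> kl /ffunP h; apply/ffunP => -[i m]; rewrite !ffunE/=.
by have := h (i, widen_ord kl m); rewrite !ffunE.
Qed.

Lemma measurable_halfspace i (c : R) : measurable [set x : V | x ord0 i < c].
Proof.
have := @measurable_rV_coord R n i measurableT `]-oo, c[%classic.
rewrite setTI => h; rewrite [X in measurable X](_ : _ =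
  (fun x : V => x ord0 i : measurableTypeR R) @^-1` `]-oo, c[%classic).
  exact: h.
by apply/seteqP; split => x /=; rewrite in_itv.
Qed.

Definition cell k (c : {ffun 'I_n * 'I_k -> bool}) : set V :=
  [set x | qcode k x = c].

Lemma measurable_cell k (c : {ffun 'I_n * 'I_k -> bool}) : measurable (cell c).
Proof.
rewrite (_ : cell c = \bigcap_(p in [set: 'I_n * 'I_k])
   (if c p then [set x : V | x ord0 p.1 < ratq p.2]
    else ~` [set x : V | x ord0 p.1 < ratq p.2])).
  apply: fin_bigcap_measurable => // p _; case: ifP => _.
    exact: measurable_halfspace.
  by apply: measurableC; exact: measurable_halfspace.
apply/seteqP; split => x /=.
  by move=> <- p _; rewrite ffunE; case: ifPn => // /negP.
move=> h; apply/ffunP => p; rewrite ffunE.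
by have := h p I; case: (c p) => //= /negP/negPf.
Qed.

(** Unions of fibres of [qcode k].  For [k] fixed they form a finite algebra,
    and for all [k] together they generate the Borel sets. *)
Definition saturated k G := forall x y, qcode k x = qcode k y -> G x -> G y.

Lemma saturated_le k l G : (k <= l)%N -> saturated k G -> saturated l G.
Proof. by move=> kl h x y e; apply: h; exact: qcode_le e. Qed.

Lemma saturatedC k G : saturated k G -> saturated k (~` G).
Proof. by move=> h x y e Gx Gy; apply: Gx; exact: h Gy. Qed.

Lemma saturatedU k G H : saturated k G -> saturated k H -> saturated k (G `|` H).
Proof. by move=> h1 h2 x y e [Gx|Hx]; [left; exact: h1 Gx|right; exact: h2 Hx]. Qed.

Definition cellin k G (c : {ffun 'I_n * 'I_k -> bool}) : set V :=
  if `[< cell c `<=` G >] then cell c else set0.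

Lemma saturatedE k G : saturated k G ->
  G = \big[setU/set0]_(c <- enum {ffun 'I_n * 'I_k -> bool}) cellin G c.
Proof.
move=> sG; rewrite -bigcup_seq; apply/seteqP; split => x.
  move=> Gx; exists (qcode k x); first by rewrite /= mem_enum.
  rewrite /cellin asboolT// => y; rewrite /cell/= => e.
  exact: sG (esym e) Gx.
by move=> [c _]; rewrite /cellin; case: asboolP => // h; exact: h.
Qed.

Lemma measurable_cellin k G (c : {ffun 'I_n * 'I_k -> bool}) : measurable (cellin G c).
Proof. by rewrite /cellin; case: ifP => // _; exact: measurable_cell. Qed.

Lemma measurable_saturated k G : saturated k G -> measurable G.
Proof.
move=> /saturatedE ->; apply: bigsetU_measurable => c _.
exact: measurable_cellin.
Qed.

(** An open set is the countable union of the cells that it contains, although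
    the measurable sets are defined by the coordinates and not by the topology. *)
Lemma open_measurable_rV (U : set V) : open U -> measurable U.
Proof.
move=> oU; pose G k := [set x : V | cell (qcode k x) `<=` U].
have sG k : saturated k (G k) by move=> x y e; rewrite /G /= e.
rewrite (_ : U = \bigcup_k G k).
  by apply: bigcupT_measurable => k; exact: measurable_saturated.
apply/seteqP; split => x.
  move=> Ux; have /nbhs_ballP[e /= e0 xeU] : nbhs x U by apply: open_nbhs_nbhs.
  have /choice[p hp] : forall i, exists m, x ord0 i - e < ratq m < x ord0 i.
    by move=> i; apply: ratq_between; rewrite ltrBlDr ltrDl.
  have /choice[q hq] : forall i, exists m, x ord0 i < ratq m < x ord0 i + e.
    by move=> i; apply: ratq_between; rewrite ltrDl.
  pose k := (\max_i maxn (p i) (q i)).+1; exists k => // y /= ey; apply: xeU.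
  have pk i : (p i < k)%N.
    by rewrite ltnS (leq_trans (leq_maxl _ (q i)))//; exact: (leq_bigmax i).
  have qk i : (q i < k)%N.
    by rewrite ltnS (leq_trans (leq_maxr (p i) _))//; exact: (leq_bigmax i).
  split => // j i; rewrite (ord1 j) -ball_normE/= ltr_distlC.
  have /ffunP/(_ (i, Ordinal (pk i))) := ey; rewrite !ffunE/=.
  have /ffunP/(_ (i, Ordinal (qk i))) := ey; rewrite !ffunE/=.
  have /andP[h1 h2] := hp i; have /andP[h3 h4] := hq i.
  rewrite h3 [x ord0 i < ratq (p i)]ltNge (ltW h2) /= => h5 /negbT h6.
  rewrite (lt_trans _ h4) ?h5// andbT (lt_le_trans h1)//.
  by rewrite leNgt.
by move=> [k _]; apply.
Qed.

Lemma continuous_measurable_rV (f : V -> R) : continuous f ->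
  measurable_fun setT f.
Proof.
move=> cf; apply: (measurability _ (RGenOInfty.measurableE R)).
move=> /= _ [_ [a ->] <-]; rewrite setTI; apply: open_measurable_rV.
by apply: open_comp; [move=> x _; exact: cf|exact: interval_open].
Qed.

Variable Q : set V.
Hypotheses (mQ : measurable Q) (muQ : (mu Q < +oo)%E).

Definition symd A G := (A `\` G) `|` (G `\` A).

(** Approximation in measure, inside [Q], by finite unions of cells.  The sets
    that have it form a sigma-algebra, which contains the half-spaces. *)
Definition approx A := measurable A /\ forall e : R, 0 < e ->
  exists k G, saturated k G /\ (mu (symd A G `&` Q) < e%:E)%E.

Lemma measurable_symd A G : measurable A -> measurable G ->
  measurable (symd A G `&` Q).
Proof.
by move=> mA mG; apply: measurableI => //; apply: measurableU; exact: measurableD.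
Qed.

Lemma approxC A : approx A -> approx (~` A).
Proof.
move=> [mA h]; split; first exact: measurableC.
move=> e /h[k [G [sG he]]]; exists k, (~` G); split; first exact: saturatedC.
suff -> : symd (~` A) (~` G) = symd A G by [].
rewrite /symd; apply/seteqP; split => x /=.
  move=> [[h1 /contrapT h2]|[h1 /contrapT h2]]; [right|left] => //.
by move=> [[h1 h2]|[h1 h2]]; [right|left]; split => //; apply.
Qed.

Lemma approxU A B : approx A -> approx B -> approx (A `|` B).
Proof.
move=> [mA hA] [mB hB]; split; first exact: measurableU.
move=> e e0; have e20 : 0 < e / 2 by rewrite divr_gt0.
have [k [G [sG hG]]] := hA _ e20; have [l [H [sH hH]]] := hB _ e20.
exists (maxn k l), (G `|` H); split.
  by apply: saturatedU; [apply: saturated_le sG; exact: leq_maxl|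
                         apply: saturated_le sH; exact: leq_maxr].
have mG := measurable_saturated sG; have mH := measurable_saturated sH.
apply: (@le_lt_trans _ _ (mu (symd A G `&` Q) + mu (symd B H `&` Q))%E).
  apply: (le_trans _ (measureU2 _ _ _)); try exact: measurable_symd.
  apply: le_measure; rewrite ?inE.
  - by apply: measurable_symd; exact: measurableU.
  - by apply: measurableU; exact: measurable_symd.
  - by move=> x [[[[a|a]]|[[a|a]]] /not_orP[h1 h2]] q;
      [left|right|left|right]; split => //; [left|left|right|right].
by rewrite [e]splitr EFinD lteD.
Qed.

Lemma approx0 : approx set0.
Proof.
split => // e e0; exists 0%N, set0; split; first by move=> x y.
by rewrite /symd !setD0 setU0 set0I measure0 lte_fin.
Qed.

(** The union is first cut to finitely many terms, at a small cost since [Q]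
    has finite measure. *)
Lemma approx_bigcup (F : (set V)^nat) : (forall j, approx (F j)) ->
  approx (\bigcup_j F j).
Proof.
move=> hF; have mF j := (hF j).1; have mU : measurable (\bigcup_j F j).
  exact: bigcupT_measurable.
split => // e e0; have e20 : 0 < e / 2 by rewrite divr_gt0.
pose U N := \big[setU/set0]_(j < N) F j.
have mUN N : measurable (U N) by apply: bigsetU_measurable.
have aU N : approx (U N).
  rewrite /U; elim: N => [|N IH]; first by rewrite big_ord0; exact: approx0.
  by rewrite big_ord_recr; exact: approxU.
pose D N := ((\bigcup_j F j) `\` U N) `&` Q.
have mD N : measurable (D N) by apply: measurableI => //; exact: measurableD.
have D0 : \bigcap_N D N = set0.
  apply/seteqP; split => // x h; have [[[j _ Fx] _] _] := h 0%N I.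
  have [[_ /(_ _)]] := h j.+1 I; case.
  by rewrite /U -bigcup_mkord; exists j => /=.
have : mu (D N) @[N --> \oo] --> mu (\bigcap_N D N).
  apply: nonincreasing_cvg_mu => //.
  - by rewrite (le_lt_trans _ muQ)// le_measure ?inE// => x [].
  - exact: bigcap_measurable.
  - move=> k l kl; apply/subsetPset => x [[Fx Ux] Qx]; split => //; split => //.
    by apply: contra_not Ux; rewrite /U -!bigcup_mkord => -[j /= jk Fj];
      exists j => //=; exact: leq_trans kl.
rewrite D0 measure0 => /fine_cvgP[fD /cvgr0_norm_lt /(_ _ e20)].
move=> /(filterI fD)[N _ /(_ N (leqnn _))[/= fN hN]].
have [mUU /(_ _ e20)[k [G [sG hG]]]] := aU N.
exists k, G; split => //; have mG := measurable_saturated sG.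
apply: (@le_lt_trans _ _ (mu (D N) + mu (symd (U N) G `&` Q))%E).
  apply: (le_trans _ (measureU2 _ _ _)) => //; try exact: measurable_symd.
  apply: le_measure; rewrite ?inE.
  - exact: measurable_symd.
  - by apply: measurableU => //; exact: measurable_symd.
  - move=> x [[[Fx Gx]|[Gx Fx]] Qx].
      by have [Ux|Ux] := pselect (U N x); [right; split => //; left|left].
    right; split => //; right; split => // Ux; apply: Fx.
    by move: Ux; rewrite /U -bigcup_mkord => -[j _ Fj]; exists j.
rewrite [e]splitr EFinD lteD// -(fineK fN) lte_fin.
by move: hN; rewrite ger0_norm// fine_ge0.
Qed.

Lemma approx_measurable A : measurable A -> approx A.
Proof.
have aC : sigma_algebra setT approx.
  split; first exact: approx0.
  - by move=> B aB; rewrite setTD; exact: approxC.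
  - by move=> F aF; exact: approx_bigcup.
have : g_sigma_preimage (fun i (x : V) => x ord0 i : measurableTypeR R) `<=` approx.
  apply: smallest_sub => // B; rewrite -bigcup_seq => -[i _ [C mC <-]].
  rewrite setTI.
  have : <<s @RGenInftyO.G R >> `<=`
      [set C | approx ((fun x : V => x ord0 i : measurableTypeR R) @^-1` C)].
    apply: smallest_sub.
      split => /=.
      - by rewrite preimage_set0; exact: approx0.
      - by move=> D aD; rewrite setTD preimage_setC; exact: approxC.
      - by move=> F aF; rewrite preimage_bigcup; exact: approx_bigcup.
    move=> _ [c ->] /=.
    rewrite (_ : _ @^-1` _ = \bigcup_m
        (if ratq m <= c then [set x : V | x ord0 i < ratq m] else set0)).
      apply: approx_bigcup => m; case: ifP => _; last exact: approx0.
      split; first exact: measurable_halfspace.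
      move=> e e0; exists m.+1, [set x : V | x ord0 i < ratq m]; split.
        move=> x y /ffunP/(_ (i, Ordinal (ltnSn m))).
        by rewrite !ffunE /= => ->.
      by rewrite /symd !setDv setU0 set0I measure0 lte_fin.
    apply/seteqP; split => x /=; rewrite in_itv/=.
      move=> /ratq_between[m /andP[m1 m2]]; exists m => //.
      by rewrite (ltW m2).
    by move=> [m _]; case: ifP => // mc /lt_le_trans; apply.
  have e : <<s @ocitv R >> = <<s @RGenInftyO.G R >> := RGenInftyO.measurableE R.
  by apply; rewrite -e.
exact.
Qed.

End grid.

(** * Functions with nonnegative integrals over boxes *)

Section integral_toolbox.
Context d (T : measurableType d) (R : realType) (mu : {measure set T -> \bar R}).
Implicit Types (D : set T) (f g : T -> R).

Lemma bounded_integrable D f (K : R) : measurable D -> (mu D < +oo)%E ->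
  measurable_fun D f -> (forall x, D x -> `|f x| <= K) ->
  mu.-integrable D (EFin \o f).
Proof.
move=> mD muD mf fK; apply: measurable_bounded_integrable => //.
exists K; split; first exact: num_real.
by move=> M KM x Dx; exact: le_trans (fK x Dx) (ltW KM).
Qed.

Lemma integrable_cst D (K : R) : measurable D -> (mu D < +oo)%E ->
  mu.-integrable D (fun=> K%:E).
Proof. by move=> mD muD; apply: (@bounded_integrable D (cst K) `|K|). Qed.

Lemma bounded_Rintegral D f (K : R) : measurable D -> (mu D < +oo)%E ->
  measurable_fun D f -> (forall x, D x -> `|f x| <= K) ->
  `|\int[mu]_(x in D) f x| <= K * fine (mu D).
Proof.
move=> mD muD mf fK; have fi := bounded_integrable mD muD mf fK.
apply: (le_trans (le_normr_Rintegral mD fi)).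
rewrite -Rintegral_cst//; apply: le_Rintegral => //.
- exact: integrable_norm.
- exact: integrable_cst.
Qed.
End integral_toolbox.

Section box_density.
Context {R : realType} {n : nat}.
Local Notation V := 'rV[R]_n.
Local Notation mu := (@lebesgue_rV R n).

Definition box (al be : 'I_n -> R) : set V :=
  [set z | forall i, al i <= z ord0 i < be i].

Lemma measurable_box al be : measurable (box al be).
Proof.
rewrite (_ : box al be = \bigcap_(i in [set: 'I_n])
   ((~` [set x : V | x ord0 i < al i]) `&` [set x : V | x ord0 i < be i])).
  apply: fin_bigcap_measurable => // i _; apply: measurableI.
    by apply: measurableC; exact: measurable_halfspace.
  exact: measurable_halfspace.
apply/seteqP; split => x /= h i.
  by move=> _; have /andP[h1 h2] := h i; split=> //; apply/negP; rewrite -leNgt.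
by have [/negP h1 h2] := h i I; rewrite leNgt h1.
Qed.

Lemma lebesgue_box al be : (forall i, al i <= be i) ->
  mu (box al be) = (\prod_i (be i - al i))%:E.
Proof.
move=> albe.
have -> : box al be = [set x : V | forall i, (`[al i, be i[%classic : set (measurableTypeR R)) (x ord0 i)].
  by apply/seteqP; split => x /= h i; have := h i; rewrite in_itv.
have := @lebesgue_rV_box R n (fun i => `[al i, be i[%classic).
move=> -> => [|i]; last exact: measurable_itv.
rewrite -prodEFin; apply: eq_bigr => i _.
by rewrite lebesgue_measure_itv/= lte_fin; case: ltgtP (albe i) => // -> _;
  rewrite subrr.
Qed.

(** Deciding the order relation of [x] to finitely many points inside an
    interval leaves an interval. *)
Lemma itv_refine (s : seq (R * bool)) (a b : R) :
  exists a' b', [/\ a <= a', b' <= b & forall x,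
    (a <= x < b) && all (fun p => (x < p.1) == p.2) s = (a' <= x < b')].
Proof.
elim: s => [|[q t] s [a1 [b1 [ha hb h]]]].
  by exists a, b; split => // x; rewrite andbT.
case: t; [exists a1, (Num.min b1 q)|exists (Num.max a1 q), b1].
  split => //; first by rewrite ge_min hb.
  by move=> x; rewrite /= andbCA h lt_min eqb_id andbC andbA.
split => //; first by rewrite le_max ha.
by move=> x; rewrite /= andbCA h ge_max eqbF_neg -leNgt; case: (a1 <= x);
  case: (q <= x); rewrite ?andbT ?andbF.
Qed.

Lemma cell_box k (c : {ffun 'I_n * 'I_k -> bool}) al be :
  exists al' be', [/\ forall i, al i <= al' i, forall i, be' i <= be i &
    cell c `&` box al be = box al' be'].
Proof.
have /choice[p hp] : forall i, exists p : R * R, [/\ al i <= p.1, p.2 <= be i &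
    forall x, (al i <= x < be i) && all (fun p => (x < p.1) == p.2)
      [seq (@ratq R m, c (i, m)) | m : 'I_k] = (p.1 <= x < p.2)].
  move=> i; have [a [b h]] := itv_refine [seq (@ratq R m, c (i, m)) | m : 'I_k] (al i) (be i).
  by exists (a, b).
exists (fun i => (p i).1), (fun i => (p i).2); split.
- by move=> i; have [] := hp i.
- by move=> i; have [] := hp i.
apply/seteqP; split => z.
  move=> [zc zb] i; have [_ _ <-] := hp i; rewrite zb/=.
  by apply/allP => _ /mapP[m _ ->] /=; rewrite -zc ffunE.
move=> h; split.
  apply/ffunP => -[i m]; rewrite ffunE /=; have := h i; have [_ _ <-] := hp i.
  move=> /andP[_ /allP/(_ (@ratq R m, c (i, m)))]; rewrite /= => /(_ _)/eqP; apply.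
  by apply/mapP; exists m; rewrite ?mem_enum.
by move=> i; have := h i; have [_ _ <-] := hp i => /andP[].
Qed.

Section nonneg.
Variables (a0 b0 : 'I_n -> R) (g : V -> R) (K : R).
Hypothesis ab0 : forall i, a0 i <= b0 i.
Local Notation Q := (box a0 b0).
Hypothesis mg : measurable_fun Q g.
Hypothesis gK : forall x, Q x -> `|g x| <= K.
Hypothesis g_box : forall al be, (forall i, a0 i <= al i) ->
  (forall i, al i < be i) -> (forall i, be i <= b0 i) ->
  0 <= \int[mu]_(x in box al be) g x.

Let mQ : measurable Q. Proof. exact: measurable_box. Qed.
Let muQ : (mu Q < +oo)%E. Proof. by rewrite lebesgue_box// ltry. Qed.
Let ig : mu.-integrable Q (EFin \o g).
Proof. exact: bounded_integrable gK. Qed.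

Lemma saturated_nonneg k G : saturated k G -> (0 <= \int[mu]_(x in G `&` Q) (g x)%:E)%E.
Proof.
move=> sG; have := saturatedE sG; rewrite -bigcup_seq => GE.
pose F (c : {ffun 'I_n * 'I_k -> bool}) := cellin G c `&` Q.
have mF c : measurable (F c) by apply: measurableI => //; exact: measurable_cellin.
have -> : G `&` Q = \big[setU/set0]_(c <- enum {ffun 'I_n * 'I_k -> bool}) F c.
  by rewrite -bigcup_seq [in LHS]GE setI_bigcupl.
rewrite integral_bigsetU_EFin//.
- apply: sume_ge0 => c _; rewrite /F /cellin; case: ifP => _; last first.
    by rewrite set0I integral_set0.
  have [al [be [ha hb ->]]] := cell_box c a0 b0.
  have [h|/existsNP[i /negP]] := pselect (forall i, al i < be i).
    have := g_box ha h hb; rewrite -lee_fin /Rintegral fineK//.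
    apply: integrable_fin_num; first exact: measurable_box.
    apply: integrableS ig => //; first exact: measurable_box.
    move=> x hx i; have /andP[h1 h2] := hx i.
    by rewrite (le_trans (ha i))//= (lt_le_trans h2).
  rewrite -leNgt => bai; rewrite (_ : box al be = set0) ?integral_set0//.
  apply/seteqP; split => // x /(_ i)/andP[h1 h2].
  by have := lt_le_trans h2 (le_trans bai h1); rewrite ltxx.
- exact: enum_uniq.
- apply/trivIsetP => c c' _ _ cc'; apply/seteqP; split => // x [[+ _] [+ _]].
  rewrite /cellin; case: ifP => // _; case: ifP => // _ /= h1 h2.
  by move: cc'; rewrite -h1 -h2 eqxx.
- apply/measurable_EFinP; apply: measurable_funS mg => //.
  by rewrite -bigcup_seq => x [c _ []].
Qed.

(** [g] is bounded, so replacing [A] by a finite union of cells changes the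
    integral by little. *)
Lemma measurable_nonneg A : measurable A -> A `<=` Q ->
  0 <= \int[mu]_(x in A) g x.
Proof.
move=> mA AQ; apply/ler_addgt0Pl => e e0.
have K1 : 0 < `|K| + 1 by rewrite ltr_wpDl.
have [_ /(_ (e / (`|K| + 1)))] := approx_measurable mQ muQ mA.
move=> /(_ (divr_gt0 e0 K1))[k [G [sG hG]]]; have mG := measurable_saturated sG.
have msym : measurable (symd A G `&` Q) by exact: measurable_symd.
have mGQ : measurable (G `&` Q) by exact: measurableI.
have iGQ : mu.-integrable (G `&` Q) (EFin \o g).
  by apply: integrableS ig => // x [].
have iA : mu.-integrable A (EFin \o g) by exact: integrableS ig.
have hG0 : 0 <= \int[mu]_(x in G `&` Q) g x.
  by rewrite fine_ge0//; exact: saturated_nonneg sG.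
have gres B : measurable B -> mu.-integrable Q (EFin \o (g \_ B)).
  move=> mB; rewrite -restrict_EFin; apply/integrable_restrict => //.
  by apply: integrableS ig => //; exact: measurableI.
have eA : \int[mu]_(x in A) g x = \int[mu]_(x in Q) (g \_ A) x.
  by rewrite -Rintegral_mkcondr setIidr.
have eG : \int[mu]_(x in G `&` Q) g x = \int[mu]_(x in Q) (g \_ G) x.
  by rewrite -Rintegral_mkcondl.
have hd : `|\int[mu]_(x in Q) ((g \_ A) x - (g \_ G) x)| <= e.
  rewrite (_ : \int[mu]_(x in Q) _ =
      \int[mu]_(x in symd A G `&` Q) ((g \_ A) x - (g \_ G) x)); last first.
    rewrite Rintegral_mkcondl; apply: eq_Rintegral => x _; rewrite !patchE.
    have [|xS] := boolP (x \in symd A G); first by [].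
    move: xS; rewrite notin_setE => /not_orP[h1 h2].
    have [/set_mem xA|] := boolP (x \in A);
      have [/set_mem xG|] := boolP (x \in G);
      rewrite ?notin_setE ?subrr => //= h3.
      by exfalso; apply: h1.
    by exfalso; apply: h2.
  have := @bounded_Rintegral _ _ _ mu (symd A G `&` Q)
    (fun x => (g \_ A) x - (g \_ G) x) (`|K| + 1) msym.
  move=> /(_ _ _ _)/le_trans; apply.
  - by rewrite (le_lt_trans _ muQ)// le_measure ?inE// => x [].
  - have /integrableP[/measurable_EFinP m1 _] := gres A mA.
    have /integrableP[/measurable_EFinP m2 _] := gres G mG.
    by apply: measurable_funS (measurable_funB m1 m2) => // x [].
  - move=> x [sx Qx]; rewrite !patchE; have gx := gK Qx.
    have gx1 : `|g x| <= `|K| + 1.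
      by rewrite (le_trans gx)// (le_trans (ler_norm K))// lerDl.
    by case: ifP => _; case: ifP => _;
      rewrite ?subr0 ?sub0r ?subrr ?normr0 ?normrN// ltW.
  rewrite mulrC -ler_pdivlMr// -lee_fin fineK ?ltW//.
  by rewrite ge0_fin_numE// (lt_trans hG)// ltry.
move: hd; rewrite RintegralB//; [|exact: gres..].
rewrite -eA -eG ler_norml => /andP[+ _].
have aux (a b c : R) : 0 <= b -> - c <= a - b -> 0 <= c + a.
  by move=> ? ?; lra.
exact: aux.
Qed.

(** The set where [g] is negative is a measurable set over which its integral
    is nonnegative, hence a null set. *)
Lemma box_nonneg_ae : {ae mu, forall x, Q x -> 0 <= g x}.
Proof.
pose A := Q `&` g @^-1` `]-oo, 0[%classic.
have mA : measurable A by apply: mg => //; exact: measurable_itv.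
have AQ : A `<=` Q by move=> x [].
have iA : mu.-integrable A (EFin \o g) by exact: integrableS ig.
have g0 := measurable_nonneg mA AQ.
have iAn : mu.-integrable A (EFin \o (fun x => `|g x|)).
  exact: integrable_norm.
have absg : \int[mu]_(x in A) `|g x| = - \int[mu]_(x in A) g x.
  rewrite -mulN1r -RintegralZl//; apply: eq_Rintegral => x /set_mem[_ /=].
  by rewrite in_itv/= => gx; rewrite mulN1r ltr0_norm.
have : (\int[mu]_(x in A) `|(g x)%:E| = 0)%E.
  rewrite -[LHS](@fineK _ (\int[mu]_(x in A) `|(g x)%:E|)); last first.
    exact: integrable_fin_num iAn.
  congr EFin; apply/eqP; rewrite eq_le.
  rewrite -[fine _]/(\int[mu]_(x in A) `|g x|) {1}absg oppr_le0 g0/=.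
  by apply: Rintegral_ge0.
move/(ae_eq_integral_abs mu mA (measurable_int _ iA)).
apply: filterS => x; rewrite /= => h Qx; rewrite leNgt; apply/negP => gx.
have : A x by split => //=; rewrite in_itv.
by move=> /h [] gx0; move: gx; rewrite gx0 ltxx.
Qed.

End nonneg.
End box_density.

(** * Integrals of partial derivatives *)

Section bounded_support.
Context d (T : measurableType d) (R : realType) (mu : {measure set T -> \bar R}).

Lemma bounded_support_integrable (Q : set T) (f : T -> R) (K : R) :
  measurable Q -> (mu Q < +oo)%E -> measurable_fun setT f ->
  (forall x, `|f x| <= K) -> (forall x, ~ Q x -> f x = 0) ->
  mu.-integrable setT (EFin \o f).
Proof.
move=> mQ muQ mf fK f0.
have -> : EFin \o f = (EFin \o f) \_ Q.
  apply/funext => x; rewrite patchE; case: ifPn => //.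
  by rewrite notin_setE => /f0 /= ->.
apply/integrable_restrict => //; rewrite setTI.
by apply: (bounded_integrable (K := K)) => //; exact: measurable_funS mf.
Qed.

End bounded_support.

Section ibp.
Context {R : realType}.

(** Directional derivatives commute with a map that is affine along the line;
    it identifies partial derivatives with those of the slices of [f]. *)
Lemma derive_comp_line (V W : normedModType R) (u : V -> W) (f : W -> R)
    (x v : V) (w : W) : (forall h : R, u (h *: v + x) = h *: w + u x) ->
  (derivable f (u x) w -> derivable (f \o u) x v) /\
  'D_v (f \o u) x = 'D_w f (u x).
Proof.
move=> uE.
have e : (fun h => h^-1 *: (((f \o u) \o shift x) (h *: v) - (f \o u) x)) =
         (fun h => h^-1 *: ((f \o shift (u x)) (h *: w) - f (u x))).
  by apply/funext => h /=; rewrite uE.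
by split; rewrite ?/derivable ?/derive e.
Qed.

Lemma consrV_ball n (t t' : R) (x x' : 'rV[R]_n) (e : R) : ball t e t' ->
  ball x e x' -> ball (@consrV R n (t, x)) e (consrV (t', x')).
Proof.
move=> tt' [e0 xx']; split => // i j; rewrite !mxE.
by case: (unliftP ord0 j) => [k|] _ /=.
Qed.

Lemma consrV_continuousl n (x : 'rV[R]_n) :
  continuous (fun t : R => @consrV R n (t, x) : 'rV[R]_n.+1).
Proof.
move=> t A /nbhs_ballP[e /= e0 h]; apply/nbhs_ballP; exists e => // t' tt'.
by apply: h; apply: consrV_ball => //; exact: ballxx.
Qed.

Lemma consrV_continuousr n (t : R) :
  continuous (fun x : 'rV[R]_n => @consrV R n (t, x) : 'rV[R]_n.+1).
Proof.
move=> x A /nbhs_ballP[e /= e0 h]; apply/nbhs_ballP; exists e => // x' xx'.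
by apply: h; apply: consrV_ball => //; exact: ballxx.
Qed.

Lemma consrV_line0 n (t h : R) (x : 'rV[R]_n) :
  @consrV R n (h *: (1 : R) + t, x) =
  h *: delta_mx ord0 ord0 + consrV (t, x) :> 'rV[R]_n.+1.
Proof.
apply/rowP => i; rewrite !mxE; case: (unliftP ord0 i) => [k|] ->.
  rewrite (_ : (lift ord0 k == ord0) = false) ?andbF ?mulr0 ?add0r//.
by [].
Qed.

Lemma consrV_lineS n (t h : R) (x : 'rV[R]_n) j :
  @consrV R n (t, h *: delta_mx ord0 j + x) =
  h *: delta_mx ord0 (lift ord0 j) + consrV (t, x) :> 'rV[R]_n.+1.
Proof.
apply/rowP => i; rewrite !mxE; case: (unliftP ord0 i) => [k|] ->.
  by rewrite /= !mxE (inj_eq (@lift_inj _ _)).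
by rewrite (_ : (ord0 == lift ord0 j) = false) ?andbF ?mulr0 ?add0r.
Qed.

Definition off_cube n (r : R) (x : 'rV[R]_n) := exists j, r < `|x ord0 j|.

Lemma continuous_off_cube_bounded n (f : 'rV[R]_n -> R) (r : R) : 0 < r ->
  continuous f -> (forall x, off_cube r x -> f x = 0) ->
  exists K, forall x, `|f x| <= K.
Proof.
move=> r0 cf f0.
have [|||c _ h] := @EVT_max_rV R n (fun x => `|f x|) (cube 0 r).
- by exists 0 => i; rewrite !mxE subrr normr0 ltW.
- exact: cube_compact.
- by apply: continuous_subspaceT => x; apply: continuous_comp;
    [exact: cf|exact: norm_continuous].
exists `|f c| => x; have [xr|/existsNP[j /negP]] := pselect (cube 0 r x).
  by apply: h; rewrite inE.
rewrite -ltNge mxE subr0 => jr; rewrite f0 ?normr0//.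
by exists j.
Qed.

(** The extra 1 leaves room for the boundary of the cube, so that every point
    outside has a coordinate of absolute value strictly larger than [r]. *)
Definition qbox n (r : R) : set 'rV[R]_n := box (fun=> - (r + 1)) (fun=> r + 1).

Lemma qbox_off n (r : R) (x : 'rV[R]_n) : 0 < r -> ~ qbox r x -> off_cube r x.
Proof.
move=> r0 /existsNP[j /negP]; rewrite negb_and -ltNge -leNgt => h; exists j.
rewrite ltr_normr; case/orP: h => h; apply/orP; [right|left].
  by rewrite ltrNr (lt_trans h)// ltrN2 ltrDl.
by rewrite (lt_le_trans _ h)// ltrDl.
Qed.

Lemma qbox_finite n (r : R) : 0 < r -> (lebesgue_rV n (qbox r) < +oo)%E.
Proof.
by move=> r0; rewrite lebesgue_box ?ltry// => i; rewrite ge0_cp// addr_ge0// ltW.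
Qed.

Lemma continuous_off_cube_integrable n (f : 'rV[R]_n -> R) (r : R) : 0 < r ->
  continuous f -> (forall x, off_cube r x -> f x = 0) ->
  (lebesgue_rV n).-integrable setT (EFin \o f).
Proof.
move=> r0 cf f0; have [K fK] := continuous_off_cube_bounded r0 cf f0.
apply: (bounded_support_integrable (Q := qbox r) (K := K)) => //.
- exact: measurable_box.
- exact: qbox_finite.
- exact: continuous_measurable_rV.
- by move=> x /(qbox_off r0)/f0.
Qed.

Lemma integral_consrV n (f : 'rV[R]_n.+1 -> \bar R) : measurable_fun setT f ->
  (lebesgue_measure \x lebesgue_rV n)%E.-integrable setT (f \o @consrV R n) ->
  (\int[lebesgue_rV n.+1]_x f x =
   \int[(lebesgue_measure \x lebesgue_rV n)%E]_p f (consrV p))%E.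
Proof.
move=> mf fi; rewrite -[RHS]/(\int[_]_(p in @consrV R n @^-1` setT) (f \o @consrV R n) p)%E.
rewrite -(integral_pushforward (@measurable_consrV R n) mf) ?preimage_setT//.
Qed.

Lemma integral_derive0 (f : R -> R) (r : R) : 0 < r ->
  (forall x, derivable f x 1) -> continuous (derive1 f) ->
  (forall x, r < `|x| -> f x = 0) ->
  (\int[lebesgue_measure]_x (derive1 f x)%:E = 0)%E.
Proof.
move=> r0 df cf f0.
have f0' x : r < `|x| -> derive1 f x = 0.
  move=> xr; apply: (@near_cst_derive1 _ _ _ 0).
  have : \near x, r < `|x|.
    by have := @norm_continuous _ R x => /(_ _ (lt_nbhsr xr)).
  by apply: filterS => y; exact: f0.
have r10 : 0 < r + 1 by rewrite addr_gt0.
have rr : - (r + 1) < r + 1 by rewrite gt0_cp.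
have fc x : {for x, continuous f}.
  exact: is_derive_continuous (is_derive_derive1 (df x)).
transitivity (\int[lebesgue_measure]_(x in `[(- (r + 1))%R, (r + 1)%R]) (derive1 f x)%:E)%E.
  rewrite [RHS]integral_mkcond; apply: eq_integral => x _; rewrite patchE.
  case: ifPn => //; rewrite notin_setE /= in_itv/= => /negP.
  rewrite -ler_norml -ltNge => h; rewrite f0'// (lt_trans _ h)// ltrDl//.
have FTC := @continuous_FTC2 R (derive1 f) f (- (r + 1)) (r + 1) rr.
rewrite FTC.
- have rr1 : r < `|r + 1| by rewrite gtr0_norm// ltrDl.
  by rewrite !f0 ?normrN// sube0.
- by apply: continuous_subspaceT => x; exact: cf.
- split; first by move=> x _; exact: df.
    by apply: cvg_at_right_filter; exact: fc.
  by apply: cvg_at_left_filter; exact: fc.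
- by [].
Qed.

(** By Fubini, the variable [i] is integrated first if it is the first one, and
    the induction hypothesis applies to the slices otherwise. *)
Lemma integral_partial0 n (i : 'I_n) (f : 'rV[R]_n -> R) (r : R) : 0 < r ->
  (forall x, derivable f x (delta_mx ord0 i)) -> continuous (partial i f) ->
  (forall x, off_cube r x -> f x = 0 /\ partial i f x = 0) ->
  (\int[lebesgue_rV n]_x (partial i f x)%:E = 0)%E.
Proof.
elim: n i f => [[]//|n IH] i f r0 df cf f0.
have cp0 x : off_cube r x -> partial i f x = 0 by move=> /f0[].
have fi := continuous_off_cube_integrable r0 cf cp0.
have [K hK] := continuous_off_cube_bounded r0 cf cp0.
have mf := continuous_measurable_rV cf.
have mfc : measurable_fun setT (partial i f \o @consrV R n).
  by apply: measurableT_comp => //; exact: measurable_consrV.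
have off0 (t : R) (x : 'rV[R]_n) : r < `|t| -> off_cube r (@consrV R n (t, x)).
  by move=> tr; exists ord0; rewrite mxE unlift_none.
have offS (t : R) (x : 'rV[R]_n) : off_cube r x -> off_cube r (@consrV R n (t, x)).
  by move=> [j jr]; exists (lift ord0 j); rewrite mxE liftK.
have LI : (lebesgue_measure (`[(- r)%R, r%R]%classic : set (measurableTypeR R)) < +oo)%E.
  by rewrite lebesgue_measure_itv/=; case: ifP; rewrite ?ltry.
have QI : ((lebesgue_measure \x lebesgue_rV n)%E
    ((`[(- r)%R, r%R]%classic : set (measurableTypeR R)) `*` qbox r) < +oo)%E.
  rewrite product_measure1E//; last exact: measurable_box.
  apply: lte_mul_pinfty => //; last exact: qbox_finite.
  by rewrite ge0_fin_numE//; exact: LI.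
have gi : (lebesgue_measure \x lebesgue_rV n)%E.-integrable setT
    ((EFin \o partial i f) \o @consrV R n).
  apply: (bounded_support_integrable
    (Q := (`[- r, r]%classic : set (measurableTypeR R)) `*` qbox r) (K := K)) => //.
  - by apply: measurableX; [exact: measurable_itv|exact: measurable_box].
  - move=> [t x] /not_andP[/negP|] /= h; apply: cp0.
      by apply: off0; move: h; rewrite in_itv/= -ler_norml -ltNge.
    by apply: offS; exact: qbox_off h.
rewrite integral_consrV//; last exact/measurable_EFinP.
case: (unliftP ord0 i) => [j|] iE; rewrite {}iE in df cf f0 cp0 fi hK mf mfc gi *.
  rewrite -integral12_prod_meas1//=.
  apply: integral0_eq => t _.
  have L x := @derive_comp_line _ _ (fun x => consrV (t, x)) f x
    (delta_mx ord0 j) (delta_mx ord0 (lift ord0 j)) (fun h => consrV_lineS t h x j).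
  have E : partial j (fun x => f (consrV (t, x))) =
      (fun x => partial (lift ord0 j) f (consrV (t, x))).
    by apply/funext => x; rewrite /partial (L x).2.
  have := IH j (fun x => f (consrV (t, x))) r0; rewrite E; apply.
  - by move=> x; exact: (L x).1.
  - move=> x; apply: continuous_comp; first exact: consrV_continuousr.
    exact: cf.
  - by move=> x /(offS t)/f0.
rewrite -integral21_prod_meas1//=; apply: integral0_eq => x _.
have L t := @derive_comp_line _ _ (fun t : R => consrV (t, x)) f t
    1 (delta_mx ord0 ord0) (fun h => consrV_line0 t h x).
have E : derive1 (fun t => f (consrV (t, x))) =
    (fun t => partial ord0 f (consrV (t, x))).
  by apply/funext => t; rewrite derive1E (L t).2.
have := @integral_derive0 (fun t => f (consrV (t, x))) r r0; rewrite E; apply.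
- by move=> t; exact: (L t).1.
- move=> t; apply: continuous_comp; first exact: consrV_continuousl.
  exact: cf.
- by move=> t /(off0 _ x)/f0[].
Qed.

End ibp.

(** * Test functions and weak gradients *)

Section ae_bounded.
Context d (T : measurableType d) (R : realType) (mu : {measure set T -> \bar R}).
Implicit Types (D : set T) (f g : T -> R).

Lemma ae_bounded_integrable D f (K : R) : measurable D -> (mu D < +oo)%E ->
  measurable_fun D f -> {ae mu, forall x, D x -> `|f x| <= K} ->
  mu.-integrable D (EFin \o f).
Proof.
move=> mD muD mf fK; apply/integrableP; split; first exact/measurable_EFinP.
apply: (@le_lt_trans _ _ (`|K|%:E * mu D)%E).
  apply: integral_le_bound => //; first exact/measurable_EFinP.
  by apply: filterS fK => x h Dx /=; rewrite lee_fin (le_trans (h Dx))// ler_norm.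
by rewrite lte_mul_pinfty.
Qed.

Lemma ae_bounded_Rintegral D f (K : R) : measurable D -> (mu D < +oo)%E ->
  measurable_fun D f -> 0 <= K -> {ae mu, forall x, D x -> `|f x| <= K} ->
  `|\int[mu]_(x in D) f x| <= K * fine (mu D).
Proof.
move=> mD muD mf K0 fK; have fi := ae_bounded_integrable mD muD mf fK.
rewrite -lee_fin EFin_normr_Rintegral//.
apply: le_trans (le_abse_integral _ mD _) _; first exact/measurable_EFinP.
rewrite EFinM fineK ?ge0_fin_numE//; apply: integral_le_bound => //.
exact/measurable_EFinP.
Qed.

Lemma Lnorm2_bounded_support (Q : set T) (g : T -> R) (K : R) :
  measurable Q -> (mu Q < +oo)%E -> measurable_fun setT g ->
  (forall x, `|g x| <= K) -> (forall x, ~ Q x -> g x = 0) ->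
  ('N[mu]_2%:E[EFin \o g] < +oo)%E.
Proof.
move=> mQ muQ mg gK g0; rewrite unlock; apply: poweR_lty.
rewrite [X in (X < _)%E](_ : _ = (\int[mu]_x (`|g x| `^ 2)%:E)%E)//.
have : mu.-integrable setT (EFin \o (fun x => `|g x| `^ 2)).
  apply: (bounded_support_integrable (Q := Q) (K := K ^+ 2)) => //.
  - under eq_fun do rewrite powR_mulrn//.
    by apply: measurable_funX; exact: measurableT_comp.
  - move=> x; rewrite powR_mulrn// ger0_norm ?sqr_ge0// ler_pXn2r// ?nnegrE//.
    exact: le_trans (gK x).
  - by move=> x /g0 ->; rewrite normr0 powR0.
move=> /integrableP[_]; apply: le_lt_trans; apply: ge0_le_integral => //=.
- apply/measurable_EFinP; under eq_fun do rewrite powR_mulrn//.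
  by apply: measurable_funX; exact: measurableT_comp.
- do 2 apply: measurableT_comp => //.
  under eq_fun do rewrite powR_mulrn//.
  by apply: measurable_funX; exact: measurableT_comp.
- by move=> x _; rewrite lee_fin ler_norm.
Qed.

Lemma Lnorm2_mul_integrable (f g : T -> R) :
  measurable_fun setT f -> measurable_fun setT g ->
  ('N[mu]_2%:E[EFin \o f] < +oo)%E -> ('N[mu]_2%:E[EFin \o g] < +oo)%E ->
  mu.-integrable setT (EFin \o (fun x => f x * g x)) /\
  (\int[mu]_x `|(f x * g x)%:E| <= 'N[mu]_2%:E[EFin \o f] * 'N[mu]_2%:E[EFin \o g])%E.
Proof.
move=> mf mg Nf Ng.
have h : (\int[mu]_x `|(f x * g x)%:E| <=
    'N[mu]_2%:E[EFin \o f] * 'N[mu]_2%:E[EFin \o g])%E.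
  by have := @hoelder _ _ _ mu f g 2 2 mf mg; rewrite Lnorm1; apply => //; lra.
split => //; apply/integrableP; split.
  by apply/measurable_EFinP; exact: measurable_funM.
apply: (le_lt_trans h); apply: lte_mul_pinfty => //; first exact: Lnorm_ge0.
by rewrite ge0_fin_numE// Lnorm_ge0.
Qed.

End ae_bounded.

Section test_functions.
Context {R : realType} {n : nat}.
Local Notation V := 'rV[R]_n.
Local Notation mu := (@lebesgue_rV R n).
Implicit Types (Omega : set V) (phi psi f : V -> R).

Lemma bounded_set_qbox Omega : bounded_set Omega ->
  exists2 r : R, 0 < r & Omega `<=` qbox r.
Proof.
move=> [M [_ h]]; exists (`|M| + 1); first by rewrite ltr_wpDl.
move=> x /(h (`|M| + 1)); rewrite (le_lt_trans (ler_norm M)) ?ltrDl// => /(_ isT) hx i.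
have bx : ball (0 : V) (`|M| + 2) x.
  rewrite mx_norm_ball /ball_/= sub0r normrN (le_lt_trans hx)//.
  by rewrite ltrD2l ltr1n.
have := bx.2 ord0 i; rewrite -ball_normE/= !mxE sub0r normrN ltr_norml.
by move=> /andP[h1 h2]; apply/andP; split; lra.
Qed.

Lemma bounded_set_finite Omega : measurable Omega -> bounded_set Omega ->
  (mu Omega < +oo)%E.
Proof.
move=> mO /bounded_set_qbox[r r0 Or].
apply: le_lt_trans (qbox_finite n r0).
by apply: le_measure; rewrite ?inE//; exact: measurable_box.
Qed.

Lemma test_function_partial Omega phi i : test_function Omega phi ->
  test_function Omega (partial i phi).
Proof.
move=> [sm [K [cK KO] phi0]]; split.
  by move=> s x _; have := sm (s ++ [:: i]) x I; rewrite /partials foldr_cat.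
exists K => // x nKx.
have cl : closed K by apply: compact_closed => //; exact: norm_hausdorff.
have : \near x, cst 0 x = phi x.
  have : nbhs x (~` K) by apply: open_nbhs_nbhs; split => //; exact: closed_openC.
  by apply: filterS => y /phi0 ->.
move=> /near_eq_derive e; rewrite /partial -e.
by rewrite derive_cst.
Qed.

Lemma test_function_continuous Omega phi : test_function Omega phi ->
  continuous phi.
Proof. by move=> [sm _] x; have [] := sm [::] x I. Qed.

Lemma test_function_derivable Omega phi i x : test_function Omega phi ->
  derivable phi x (delta_mx ord0 i).
Proof. by move=> [sm _]; have [_] := sm [::] x I. Qed.

Lemma test_function_off_cube Omega phi : test_function Omega phi ->
  exists2 r : R, 0 < r & forall x, off_cube r x -> phi x = 0.
Proof.
move=> [_ [K [/compact_bounded/bounded_set_qbox[r r0 Kr] _] phi0]].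
exists (r + 1); first by rewrite addr_gt0.
move=> x [j jr]; apply: phi0 => /Kr/(_ j) /andP[h1 h2].
have : `|x ord0 j| <= r + 1 by rewrite ler_norml h1 ltW.
by rewrite leNgt jr.
Qed.

Lemma test_function_out Omega phi x : test_function Omega phi -> ~ Omega x ->
  phi x = 0.
Proof. by move=> [_ [K [_ KO] phi0]] nO; apply: phi0 => /KO. Qed.

Lemma test_function_integrable Omega phi : test_function Omega phi ->
  mu.-integrable setT (EFin \o phi).
Proof.
move=> h; have [r r0 phi0] := test_function_off_cube h.
exact: continuous_off_cube_integrable (test_function_continuous h) phi0.
Qed.

Lemma test_function_bounded Omega phi : test_function Omega phi ->
  exists K, forall x, `|phi x| <= K.
Proof.
move=> h; have [r r0 phi0] := test_function_off_cube h.
exact: continuous_off_cube_bounded r0 (test_function_continuous h) phi0.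
Qed.

Lemma test_function_L2 Omega phi : test_function Omega phi ->
  ('N[mu]_2%:E[EFin \o phi] < +oo)%E.
Proof.
move=> h; have [r r0 phi0] := test_function_off_cube h.
have [K hK] := test_function_bounded h.
apply: (Lnorm2_bounded_support (Q := qbox r) (K := K)) => //.
- exact: measurable_box.
- exact: qbox_finite.
- exact: continuous_measurable_rV (test_function_continuous h).
- by move=> x /(qbox_off r0)/phi0.
Qed.

(** Integrate the partial derivative of the product. *)
Lemma test_function_byparts Omega phi psi i : test_function Omega phi ->
  test_function Omega psi ->
  \int[mu]_x (partial i phi x * psi x) + \int[mu]_x (phi x * partial i psi x) = 0.
Proof.
move=> hp hs; have hp' := test_function_partial i hp.
have hs' := test_function_partial i hs.
have int2 f g : test_function Omega f -> test_function Omega g ->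
    mu.-integrable setT (EFin \o (fun x => f x * g x)).
  move=> hf hg; apply: (Lnorm2_mul_integrable _ _ _ _).1.
  - exact: continuous_measurable_rV (test_function_continuous hf).
  - exact: continuous_measurable_rV (test_function_continuous hg).
  - exact: test_function_L2 hf.
  - exact: test_function_L2 hg.
rewrite -RintegralD//; [|exact: int2..].
have E : partial i (fun x => phi x * psi x) =
    (fun x => partial i phi x * psi x + phi x * partial i psi x).
  apply/funext => x; rewrite /partial.
  rewrite (deriveM (@test_function_derivable Omega phi i x hp)
    (@test_function_derivable Omega psi i x hs)).
  by rewrite /GRing.scale /= addrC mulrC.
have [r r0 phi0] := test_function_off_cube hp.
have [r' r0' phi0'] := test_function_off_cube hp'.
have := @integral_partial0 R n i (fun x => phi x * psi x) (r + r').
rewrite E /Rintegral => ->//.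
- by rewrite addr_gt0.
- by move=> x; apply: derivableM;
    [exact: test_function_derivable hp|exact: test_function_derivable hs].
- move=> x; apply: (@continuousD _ _ _ (fun x => partial i phi x * psi x)
    (fun x => phi x * partial i psi x)).
    apply: (@continuousM _ _ (partial i phi) psi).
      by have /(_ x) := test_function_continuous hp'.
    by have /(_ x) := test_function_continuous hs.
  apply: (@continuousM _ _ phi (partial i psi)).
    by have /(_ x) := test_function_continuous hp.
  by have /(_ x) := test_function_continuous hs'.
- move=> x [j jr]; rewrite phi0 ?phi0' ?mul0r ?addr0//.
    by exists j; rewrite (le_lt_trans _ jr)// lerDr ltW.
  by exists j; rewrite (le_lt_trans _ jr)// lerDl ltW.
Qed.

Lemma L2_pairing_cvg0 Omega psi (u : nat -> V -> R) : measurable Omega ->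
  test_function Omega psi ->
  (forall k, measurable_fun Omega (u k)) ->
  Lp_norm mu 2%:E Omega (u k) @[k --> \oo] --> 0%E ->
  \int[mu]_(x in Omega) (u k x * psi x) @[k --> \oo] --> 0.
Proof.
move=> mO hs mu_ uc; have Ns := test_function_L2 hs.
have ms : measurable_fun setT psi := continuous_measurable_rV (test_function_continuous hs).
set c := fine ('N[mu]_2%:E[EFin \o psi]).
have c0 : 0 <= c by rewrite fine_ge0// Lnorm_ge0.
have cE : (c%:E = 'N[mu]_2%:E[EFin \o psi])%E by rewrite fineK// ge0_fin_numE// Lnorm_ge0.
move: uc => /fine_cvgP[uf uc].
apply/cvgr0Pnorm_lt => e e0.
have e1 : 0 < e / (c + 1) by rewrite divr_gt0// ltr_wpDl.
move/cvgr0_norm_lt: uc => /(_ _ e1); apply: filterS2 uf => k /= uf ue.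
have mr : measurable_fun setT (u k \_ Omega) by apply/(measurable_restrictT _ _).1.
have Nu : ('N[mu]_2%:E[EFin \o (u k \_ Omega)] < +oo)%E.
  by rewrite -ge0_fin_numE// Lnorm_ge0.
have [ii ib] := Lnorm2_mul_integrable mr ms Nu Ns.
have -> : \int[mu]_(x in Omega) (u k x * psi x) =
    \int[mu]_x ((u k \_ Omega) x * psi x).
  rewrite Rintegral_mkcond; apply: eq_Rintegral => x _; rewrite !patchE.
  by case: ifP; rewrite ?mul0r.
rewrite -lte_fin EFin_normr_Rintegral//.
apply: (le_lt_trans (le_abse_integral _ _ _)) => //.
  by apply/measurable_EFinP; exact: measurable_funM.
apply: (@le_lt_trans _ _ (Lp_norm mu 2%:E Omega (u k) * c%:E)%E).
  by rewrite cE.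
rewrite -(fineK uf) -EFinM lte_fin.
move: ue; rewrite ger0_norm ?fine_ge0 ?Lnorm_ge0// ltr_pdivlMr ?ltr_wpDl//.
apply: le_lt_trans; apply: ler_wpM2l; first by rewrite fine_ge0 ?Lnorm_ge0.
by rewrite lerDl.
Qed.

(** Both sides are limits, by the Cauchy-Schwarz inequality, of the same
    identity for the test functions that approximate [f]. *)
Lemma weak_gradient Omega f (g : 'I_n -> V -> R) psi i : measurable Omega ->
  H10_grad Omega f g -> test_function Omega psi ->
  \int[mu]_(x in Omega) (g i x * psi x) =
  - \int[mu]_(x in Omega) (f x * partial i psi x).
Proof.
move=> mO [[mf Lf] Lg [phi [tphi cf cg]]] hs.
have hs' := test_function_partial i hs.
have mphi k : measurable_fun Omega (phi k).
  by apply: measurable_funTS; exact: continuous_measurable_rV (test_function_continuous (tphi k)).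
have mpphi k : measurable_fun Omega (partial i (phi k)).
  apply: measurable_funTS; apply: continuous_measurable_rV.
  exact: test_function_continuous (test_function_partial i (tphi k)).
have [mg Lgi] := Lg i.
have c1 := L2_pairing_cvg0 mO hs (fun k => measurable_funB mg (mpphi k)) (cg i).
have c2 := L2_pairing_cvg0 mO hs' (fun k => measurable_funB mf (mphi k)) cf.
have intL2 (h p : V -> R) : Lp mu 2%:E Omega h -> test_function Omega p ->
    mu.-integrable Omega (EFin \o (fun x => h x * p x)).
  move=> [mh Nh] hp; rewrite (integrable_mkcond _ mO).
  have mr : measurable_fun setT (h \_ Omega) by apply/(measurable_restrictT _ _).1.
  have [+ _] := Lnorm2_mul_integrable mr
    (continuous_measurable_rV (test_function_continuous hp)) Nh (test_function_L2 hp).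
  apply: eq_integrable => // x _ /=; rewrite !patchE.
  by case: ifP; rewrite ?mul0r.
have L2test p : test_function Omega p -> Lp mu 2%:E Omega p.
  move=> hp; split.
    by apply: measurable_funTS; exact: continuous_measurable_rV (test_function_continuous hp).
  rewrite /Lp_norm (_ : p \_ Omega = p); first exact: test_function_L2 hp.
  apply/funext => x; rewrite patchE; case: ifPn => //.
  by rewrite notin_setE => /(test_function_out hp) ->.
apply/eqP; rewrite -subr_eq0 opprK; apply/eqP.
set S := LHS.
suff c3 : (fun=> S) @ \oo --> (0 : R).
  exact: (cvg_unique (@Rhausdorff R) (cvg_cst S) c3).
have -> : (fun=> S) = (fun k : nat =>
    \int[mu]_(x in Omega) ((g i \- partial i (phi k)) x * psi x) +
    \int[mu]_(x in Omega) ((f \- phi k) x * partial i psi x)); last first.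
  by rewrite -[X in _ --> X]addr0; exact: cvgD c1 c2.
apply/funext => k /=.
have B (h1 h2 p : V -> R) : Lp mu 2%:E Omega h1 -> Lp mu 2%:E Omega h2 ->
    test_function Omega p ->
    \int[mu]_(x in Omega) ((h1 \- h2) x * p x) =
    \int[mu]_(x in Omega) (h1 x * p x) - \int[mu]_(x in Omega) (h2 x * p x).
  move=> l1 l2 hp; rewrite -RintegralB//; [|exact: intL2..].
  by apply: eq_Rintegral => x _; rewrite /= mulrBl.
have tp := test_function_partial i (tphi k).
have lp := L2test _ (tphi k); have lp' := L2test _ tp.
have bp := test_function_byparts i (tphi k) hs.
have R2 (h p : V -> R) : test_function Omega p ->
    \int[mu]_(x in Omega) (h x * p x) = \int[mu]_x (h x * p x).
  move=> hp; rewrite Rintegral_mkcond; apply: eq_Rintegral => x _; rewrite patchE.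
  by case: ifPn => //; rewrite notin_setE => /(test_function_out hp) ->; rewrite mulr0.
apply/esym; transitivity ((\int[mu]_(x in Omega) (g i x * psi x) - \int[mu]_(x in Omega) (partial i (phi k) x * psi x)) +
  (\int[mu]_(x in Omega) (f x * partial i psi x) - \int[mu]_(x in Omega) (phi k x * partial i psi x))).
  by congr (_ + _); apply: B.
move: bp; rewrite -(R2 _ _ hs) -(R2 _ _ hs') => bp.
by rewrite addrACA -opprD bp oppr0 addr0.
Qed.

End test_functions.

(** * The state tested against functions of space *)

Section weak_heat.
Context {R : realType} {n : nat}.
Local Notation V := 'rV[R]_n.
Local Notation mu := (@lebesgue_rV R n).
Local Notation leb := (@lebesgue_measure R).
Implicit Types (t s e B K : R) (phi psi z : V -> R).

Definition laplacian (phi : V -> R) (x : V) : R := \sum_i partial i (partial i phi) x.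

(** For the zero measure the norm of exponent [+oo] is 0 by convention, and for
    the others it is the essential supremum. *)
Lemma lebesgue_setT_gt0 : (0 < mu setT)%E.
Proof.
apply: (@lt_le_trans _ _ (mu (box (fun=> 0) (fun=> 1)))).
  by rewrite lebesgue_box// subr0 big1// lte_fin.
by apply: le_measure; rewrite ?inE//; exact: measurable_box.
Qed.

Lemma Linfty_ae (D : set V) (f : V -> R) (e : R) : 0 <= e ->
  (Lp_norm mu +oo%E D f <= e%:E)%E -> {ae mu, forall x, D x -> `|f x| <= e}.
Proof.
move=> e0; rewrite /Lp_norm unlock lebesgue_setT_gt0 => /ess_supP.
apply: filterS => x /= + Dx; rewrite lee_fin patchE mem_set//.
Qed.

Lemma test_function_laplacian Omega phi : test_function Omega phi ->
  [/\ measurable_fun setT (laplacian phi),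
      exists K, forall x, `|laplacian phi x| <= K &
      forall i, mu.-integrable setT (EFin \o (partial i (partial i phi)))].
Proof.
move=> h; have h2 i : test_function Omega (partial i (partial i phi)).
  by do 2 apply: test_function_partial.
split.
- apply: measurable_sum => i.
  exact: continuous_measurable_rV (test_function_continuous (h2 i)).
- have /choice[K hK] := fun i => test_function_bounded (h2 i).
  exists (\sum_i K i) => x; apply: (le_trans (ler_norm_sum _ _ _)).
  by apply: ler_sum => i _; exact: hK.
- by move=> i; exact: test_function_integrable (h2 i).
Qed.

Variables (Omega omega : set V) (F : @feedback R n) (y0 : V -> R) (T : R)
  (y : R -> V -> R).
Hypotheses (mO : measurable Omega) (muO : (mu Omega < +oo)%E).
Hypothesis y_sol : solution Omega omega F y0 T%:E y.
Hypothesis y_cont : C_Linfty Omega T%:E y.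

Let tm t : 0 <= t -> t < T -> times T%:E t.
Proof. by move=> t0 tT; split => //; rewrite lte_fin. Qed.

Lemma state_measurable t : 0 <= t -> t < T -> measurable_fun Omega (y t).
Proof. by move=> t0 tT; have [h _] := y_cont; have [] := h t (tm t0 tT). Qed.

Lemma state_bounded t : 0 <= t -> t < T -> exists2 K : R, 0 <= K &
  {ae mu, forall x, Omega x -> `|y t x| <= K}.
Proof.
move=> t0 tT; have [h _] := y_cont; have [_ fin] := h t (tm t0 tT).
have N0 : (0 <= Lp_norm mu +oo%E Omega (y t))%E by exact: Lnorm_ge0.
exists (fine (Lp_norm mu +oo%E Omega (y t))); first exact: fine_ge0.
by apply: Linfty_ae; [exact: fine_ge0|rewrite fineK// ge0_fin_numE].
Qed.

Lemma state_continuous t e : 0 <= t -> t < T -> 0 < e -> exists2 d : R, 0 < d &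
  forall s, 0 <= s -> s < T -> `|t - s| < d ->
  {ae mu, forall x, Omega x -> `|y s x - y t x| <= e}.
Proof.
move=> t0 tT e0; have [_ /(_ t (tm t0 tT))] := y_cont.
move=> /fine_cvgP[] h1 /cvgr0_norm_lt /(_ _ e0) h2.
have : nbhs t [set s | times T%:E s ->
    Lp_norm mu +oo%E Omega (y s \- y t) \is a fin_num /\
    `|fine (Lp_norm mu +oo%E Omega (y s \- y t))| < e].
  exact: filterI h1 h2.
move=> /nbhs_ballP[d /= d0 hd].
exists d => // s s0 sT ts; have [|fn lt] := hd s _ (tm s0 sT).
  by rewrite -ball_normE.
apply: Linfty_ae; first exact: ltW.
rewrite -(fineK fn) lee_fin ltW//; apply: le_lt_trans lt.
exact: ler_norm.
Qed.

Definition pairing s (phi : V -> R) : R := \int[mu]_(x in Omega) (y s x * phi x).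

Lemma bounded_pair_integrable (z phi : V -> R) K B :
  measurable_fun Omega z -> {ae mu, forall x, Omega x -> `|z x| <= K} ->
  measurable_fun setT phi -> (forall x, `|phi x| <= B) ->
  mu.-integrable Omega (EFin \o (fun x => z x * phi x)).
Proof.
move=> mz zK mphi phiB.
apply: (ae_bounded_integrable (K := `|K| * B)) => //.
  by apply: measurable_funM => //; exact: measurable_funTS.
apply: filterS zK => x zK Ox; rewrite normrM ler_pM//.
exact: le_trans (zK Ox) (ler_norm K).
Qed.

Lemma bounded_pair_le (z phi : V -> R) K B : 0 <= K ->
  measurable_fun Omega z -> {ae mu, forall x, Omega x -> `|z x| <= K} ->
  measurable_fun setT phi -> (forall x, `|phi x| <= B) ->
  `|\int[mu]_(x in Omega) (z x * phi x)| <= K * B * fine (mu Omega).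
Proof.
move=> K0 mz zK mphi phiB.
have B0 : 0 <= B by exact: le_trans (normr_ge0 _) (phiB 0).
apply: ae_bounded_Rintegral => //.
- by apply: measurable_funM => //; exact: measurable_funTS.
- exact: mulr_ge0.
- apply: filterS zK => x zK Ox; rewrite normrM ler_pM//.
  exact: zK.
Qed.

Lemma pair_integrable s phi B : 0 <= s -> s < T ->
  measurable_fun setT phi -> (forall x, `|phi x| <= B) ->
  mu.-integrable Omega (EFin \o (fun x => y s x * phi x)).
Proof.
move=> s0 sT mphi phiB; have [K _ hK] := state_bounded s0 sT.
exact: bounded_pair_integrable (state_measurable s0 sT) hK mphi phiB.
Qed.

Lemma pair_continuous t phi B : 0 <= t -> t < T -> measurable_fun setT phi ->
  (forall x, `|phi x| <= B) -> forall e, 0 < e -> exists2 d : R, 0 < d &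
  forall s, 0 <= s -> s < T -> `|t - s| < d -> `|pairing s phi - pairing t phi| <= e.
Proof.
move=> t0 tT mphi phiB e e0.
have B0 : 0 <= B by exact: le_trans (normr_ge0 _) (phiB 0).
set c := B * fine (mu Omega).
have c0 : 0 <= c by rewrite mulr_ge0// fine_ge0.
have e1 : 0 < e / (c + 1) by rewrite divr_gt0// ltr_wpDl.
have [d d0 hd] := state_continuous t0 tT e1; exists d => // s s0 sT ts.
have -> : pairing s phi - pairing t phi =
    \int[mu]_(x in Omega) ((y s x - y t x) * phi x).
  rewrite /pairing -RintegralB//; [|exact: pair_integrable phiB..].
  by apply: eq_Rintegral => x _; rewrite mulrBl.
have ms := state_measurable s0 sT; have mt := state_measurable t0 tT.
have := bounded_pair_le (ltW e1) (measurable_funB ms mt) (hd s s0 sT ts) mphi phiB.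
move/le_trans; apply; rewrite -mulrA -/c mulrAC ler_pdivrMr ?ltr_wpDl//.
by rewrite ler_pM2l// lerDl.
Qed.

(** Integrating by parts once more removes the gradient of the state, so that
    the right-hand side is continuous in time. *)
Lemma pair_laplacian s phi (g : 'I_n -> V -> R) : 0 <= s -> s < T ->
  test_function Omega phi -> H10_grad Omega (y s) g ->
  - \sum_(i < n) \int[mu]_(x in Omega) (g i x * partial i phi x) =
  pairing s (laplacian phi).
Proof.
move=> s0 sT hphi hg.
have hp i := test_function_partial i hphi.
have hpp i := test_function_partial i (hp i).
rewrite -sumrN (eq_bigr (fun i =>
    \int[mu]_(x in Omega) (y s x * partial i (partial i phi) x))); last first.
  by move=> i _; rewrite (weak_gradient i mO hg (hp i)) opprK.
have int i : mu.-integrable Omega (EFin \o (fun x => y s x * partial i (partial i phi) x)).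
  have [B hB] := test_function_bounded (hpp i).
  apply: pair_integrable hB => //.
  exact: continuous_measurable_rV (test_function_continuous (hpp i)).
rewrite /pairing /laplacian.
rewrite /Rintegral; under [RHS]eq_Rintegral do rewrite big_distrr/=.
rewrite /Rintegral.
under [in RHS]eq_integral do rewrite -sumEFin.
rewrite integral_sum//.
by rewrite sum_fine// => i _; exact: integrable_fin_num (int i).
Qed.

(** Fubini makes the integral over [Omega] a measurable function of time. *)
Lemma pairing_measurable t (g : R -> V -> R) psi : 0 < t ->
  Lp (leb \x mu)%E 2%:E (`]0, t[ `*` Omega) (fun p => g p.1 p.2) ->
  test_function Omega psi ->
  measurable_fun `]0, t[ (fun s => \int[mu]_(x in Omega) (g s x * psi x)).
Proof.
move=> t0 [mg Ng] hpsi.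
have mI : measurable (`]0%R, t[%classic : set (measurableTypeR R)).
  exact: measurable_itv.
have mD : measurable ((`]0%R, t[%classic : set (measurableTypeR R)) `*` Omega).
  exact: measurableX.
have [B hB] := test_function_bounded hpsi.
have mpsi := continuous_measurable_rV (test_function_continuous hpsi).
pose D := (`]0%R, t[%classic : set (measurableTypeR R)) `*` Omega.
pose G := (fun p : measurableTypeR R * V => g p.1 p.2) \_ D.
pose P := (fun p : measurableTypeR R * V => psi p.2) \_ D.
have mG : measurable_fun setT G by exact: (measurable_restrictT _ mD).1 mg.
have mP : measurable_fun setT P.
  apply: (measurable_restrictT _ mD).1; apply: measurable_funTS.
  exact: (measurableT_comp mpsi measurable_snd).
have muD : ((leb \x mu)%E D < +oo)%E.
  rewrite /D product_measure1E//; apply: lte_mul_pinfty => //.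
  rewrite ge0_fin_numE//.
  suff : (leb (`]0%R, t[%classic : set (measurableTypeR R)) < +oo)%E by [].
  by rewrite lebesgue_measure_itv/= lte_fin t0 sube0 ltry.
have NP : ('N[(leb \x mu)%E]_2%:E[EFin \o P] < +oo)%E.
  apply: (Lnorm2_bounded_support (Q := D) (K := `|B|)) => //.
    move=> p; rewrite /P patchE; case: ifP => _; rewrite ?normr0//.
    exact: le_trans (hB _) (ler_norm B).
  by move=> p Dp; rewrite /P patchE memNset.
have [GPi _] := Lnorm2_mul_integrable mG mP Ng NP.
have := measurable_fubini_F GPi => mF.
have : measurable_fun `]0, t[ (fine \o
    (fun s : R => \int[mu]_x (G (s, x) * P (s, x))%:E)%E).
  by apply: measurable_funTS; apply: measurableT_comp => //; exact: measurable_fine.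
apply: eq_measurable_fun => s /set_mem st /=.
rewrite /Rintegral [in RHS]integral_mkcond; congr fine.
apply: eq_integral => x _; rewrite /G /P !patchE /=.
case: ifPn => [|]; rewrite ?inE ?notin_setE => h.
  by rewrite mem_set//; exact: h.2.
by rewrite memNset ?mul0r// => Ox; apply: h.
Qed.

Lemma max0_lipschitz s t : `|Num.max 0 s - Num.max 0 t| <= `|s - t|.
Proof.
have h (a b : R) : a <= b -> `|Num.max 0 a - Num.max 0 b| <= `|a - b|.
  move=> ab; rewrite !ler0_norm ?subr_le0//; last first.
    by rewrite ge_max !le_max lexx ab orbT.
  by case: (leP 0 a) => a0; case: (leP 0 b) => b0; lra.
have [st|/ltW ts] := leP s t; first exact: h.
by rewrite distrC (distrC s); exact: h.
Qed.

(** Time is clipped at 0 to have a function that is continuous on both sides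
    of the initial time. *)
Lemma pair_clip_continuous s phi : s < T -> 0 < T -> test_function Omega phi ->
  {for s, continuous (fun s => pairing (Num.max 0 s) (laplacian phi))}.
Proof.
move=> sT T0 hphi; have [mL [B hB] _] := test_function_laplacian hphi.
have m0 (r : R) : 0 <= Num.max 0 r by rewrite le_max lexx.
have mT (r : R) : r < T -> Num.max 0 r < T by rewrite gt_max T0.
apply/cvgrPdist_lt => e e0; have e20 : 0 < e / 2 by rewrite divr_gt0.
have [d d0 hd] := pair_continuous (m0 s) (mT s sT) mL hB e20.
near=> r; have rT : r < T by near: r; exact: lt_nbhsl.
rewrite distrC (@le_lt_trans _ _ (e / 2))//; last first.
  by rewrite ltr_pdivrMr// ltr_pMr// ltr1n.
apply: hd => //; first exact: mT.
apply: le_lt_trans (max0_lipschitz _ _) _.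
by near: r; exists d.
Unshelve. all: by end_near. Qed.

Lemma pair_integral t phi : 0 < t -> t < T -> test_function Omega phi ->
  (forall x, omega x -> phi x = 0) ->
  pairing t phi = pairing 0 phi +
    \int[leb]_(s in `]0, t[) pairing (Num.max 0 s) (laplacian phi).
Proof.
move=> t0 tT hphi phi0.
have [u [g [_ hLp [_ hH] hw _]]] := y_sol.
have := hw t phi (tm (ltW t0) tT) hphi => /eqP; rewrite subr_eq addrC => /eqP.
rewrite -/(pairing t phi) -/(pairing 0 phi) => ->; congr (_ + _).
have tT' : (t%:E < T%:E)%E by rewrite lte_fin.
have [_ _ hg] := hLp t t0 tT'.
have hp i := test_function_partial i hphi.
transitivity (\int[leb]_(s in `]0, t[)
    (- \sum_(i < n) \int[mu]_(x in Omega) (g i s x * partial i phi x))).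
  apply: eq_Rintegral => s _; rewrite -[RHS]add0r; congr (_ - _).
  rewrite (_ : (fun x => _) = cst 0) ?Rintegral_cst ?mul0r//.
  apply/funext => x; rewrite indicE; have [xo|xo] := boolP (x \in omega).
    by rewrite phi0 ?mulr0//; exact/set_mem.
  by rewrite !mul0r.
rewrite /Rintegral; congr fine.
apply: ae_eq_integral.
- exact: measurable_itv.
- apply/measurable_EFinP; apply: measurable_funN => //.
  apply: measurable_sum => i; exact: pairing_measurable.
- apply/measurable_EFinP; apply: open_continuous_measurable_fun.
    exact: interval_open.
  move=> s /set_mem; rewrite /= in_itv/= => /andP[_ st].
  by apply: pair_clip_continuous => //; [exact: lt_trans tT|exact: lt_trans tT].
- apply: (@filterS _ _ (ae_filter_ringOfSetsType leb) _ _ _ hH) => s hs; rewrite /= in_itv/= => /andP[s0 st].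
  have sT := lt_trans st tT.
  have sT' : (s%:E < T%:E)%E by rewrite lte_fin.
  by rewrite (pair_laplacian (ltW s0) sT hphi (hs s0 sT')) max_r// ltW.
Qed.

(** The weak formulation is an integral identity whose integrand is now
    continuous, so the fundamental theorem of calculus applies. *)
Lemma is_derive_pair t phi : 0 < t -> t < T -> test_function Omega phi ->
  (forall x, omega x -> phi x = 0) ->
  is_derive t 1 (fun s => pairing s phi) (pairing t (laplacian phi)).
Proof.
move=> t0 tT hphi phi0.
pose k s := pairing (Num.max 0 s) (laplacian phi).
have T0 := lt_trans t0 tT.
have kc s : s < T -> {for s, continuous k}.
  by move=> sT; exact: pair_clip_continuous.
pose v := (t + T) / 2.
have tv : t < v by rewrite midf_lt.
have vT : v < T by rewrite midf_lt.
have ki s : s < T -> leb.-integrable `[0, s] (EFin \o k).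
  move=> sT; apply: continuous_compact_integrable; first exact: segment_compact.
  apply: continuous_in_subspaceT => r /set_mem; rewrite /= in_itv/= => /andP[_ rs].
  by apply: kc; exact: le_lt_trans sT.
have [d e] := continuous_FTC1_closed tv (ki v vT) t0 (kc t tT).
have e' : k t = pairing t (laplacian phi) by rewrite /k max_r// ltW.
have := is_derive1D (is_derive_cst (pairing 0 phi) t 1) (is_derive_derive1 d).
rewrite add0r e e'; apply: near_eq_is_derive.
near=> s; have s0 : 0 < s by near: s; exact: lt_nbhsr.
have sT : s < T by near: s; exact: lt_nbhsl.
rewrite (pair_integral s0 sT hphi phi0); congr (_ + _).
have ks := ki s sT.
rewrite Rintegral_itv_obnd_cbnd ?Rintegral_itv_bndo_bndc//.
  apply: integrableS ks => // r; rewrite /= !in_itv/= => /andP[-> h].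
  exact: ltW.
apply: integrableS ks => // r; rewrite /= !in_itv/= => /andP[h1 h2].
by rewrite !ltW.
Unshelve. all: by end_near. Qed.

(** * The state tested against functions of space and time *)

(** Writing [y r * Phi r] as [y r * Phi s + y s * Phi r - y s * Phi s] plus
    [(y r - y s) * (Phi r - Phi s)], the last term is [o(r - s)], by the
    continuity of [y] and the Lipschitz continuity of [Phi] in time. *)
Lemma is_derive_moving_pair (Phi dPhi : R -> V -> R) (c d s L B : R) :
  0 <= c -> d <= T -> c < s < d ->
  (forall r x, c < r < d -> is_derive r 1 (Phi ^~ x) (dPhi r x)) ->
  (forall r, c < r < d -> measurable_fun setT (Phi r)) ->
  measurable_fun setT (dPhi s) ->
  (forall r x, c < r < d -> `|Phi r x| <= B) ->
  (forall r x, c < r < d -> `|dPhi r x| <= L) ->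
  test_function Omega (Phi s) -> (forall x, omega x -> Phi s x = 0) ->
  is_derive s 1 (fun r => pairing r (Phi r))
    (pairing s (fun x => laplacian (Phi s) x + dPhi s x)).
Proof.
move=> c0 dT csd hder mPhi mdPhi hB hL htest hw.
have /andP[cs sd] := csd; have s0 : 0 < s by exact: le_lt_trans cs.
have sT : s < T by exact: lt_le_trans dT.
have [mL [BL hBL] _] := test_function_laplacian htest.
have [K K0 hK] := state_bounded (ltW s0) sT.
have ms := state_measurable (ltW s0) sT.
have L0 : 0 <= L by exact: le_trans (normr_ge0 _) (hL s 0 csd).
have dN := is_derive_pair s0 sT htest hw.
have dM : is_derive s 1 (fun r => pairing s (Phi r)) (pairing s (dPhi s)).
  pose f r x := y s x * Phi r x.
  have fder r x : c < r < d -> is_derive r 1 (f ^~ x) (y s x * dPhi r x).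
    by move=> crd; apply: is_derive1Zl; exact: hder.
  have I : `]c, d[%classic s by rewrite /= in_itv/= cs.
  have intf r : `]c, d[%classic r -> mu.-integrable Omega (EFin \o f r).
    rewrite /= in_itv/= => crd.
    exact: bounded_pair_integrable ms hK (mPhi r crd) (fun x => hB r x crd).
  have derf r x : `]c, d[%classic r -> Omega x -> derivable (f ^~ x) r 1.
    by rewrite /= in_itv/= => crd _; have [] := fder r x crd.
  have Gi : mu.-integrable Omega (EFin \o (fun x => `|y s x| * L)).
    apply: (ae_bounded_integrable (K := K * L)) => //.
      by apply: measurable_funM => //; exact: measurableT_comp.
    by apply: filterS hK => x h Ox; rewrite normrM normr_id (ger0_norm L0) ler_wpM2r// h.
  have Gub r x : `]c, d[%classic r -> Omega x ->
      `|partial1of2 f r x| <= `|y s x| * L.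
    rewrite /= in_itv/= => crd _.
    by rewrite /partial1of2 (derive1_is (fder r x crd)) normrM ler_wpM2l// hL.
  have G0 (x : V) : 0 <= `|y s x| * L by rewrite mulr_ge0.
  have dd := derivable_under_integral mO I intf derf G0 Gi Gub.
  have de := differentiation_under_integral mO I intf derf G0 Gi Gub.
  apply: DeriveDef; first exact: dd.
  rewrite -derive1E de; apply: eq_Rintegral => x _.
  by rewrite /partial1of2 (derive1_is (fder s x csd)).
have Plip r x : c < r < d -> `|Phi r x - Phi s x| <= L * `|r - s|.
  by move=> crd; apply: (derive_bound_lipschitz (fun q => hder q x) (fun q => hL q x)).
(* the remainder of the bilinear expansion at [s] *)
pose rho r := \int[mu]_(x in Omega) ((y r x - y s x) * (Phi r x - Phi s x)).
have dR : is_derive s 1 rho 0.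
  apply: is_derive_little.
    rewrite /rho (_ : (fun x => _) = cst 0) ?Rintegral_cst ?mul0r//.
    by apply/funext => x; rewrite subrr mul0r.
  move=> e e0; set m := fine (mu Omega); have m0 : 0 <= m by exact: fine_ge0.
  have e1 : 0 < e / (L * m + 1) by rewrite divr_gt0// ltr_wpDl// mulr_ge0.
  have [d1 d10 hd1] := state_continuous (ltW s0) sT e1.
  exists (Num.min d1 (Num.min (s - c) (d - s))).
    by rewrite !lt_min d10 !subr_gt0 cs sd.
  move=> h; rewrite !lt_min => /and3P[hd hc hdd].
  have crd : c < h + s < d.
    move: hc hdd; rewrite !ltr_norml => /andP[? ?] /andP[? ?].
    by apply/andP; split; lra.
  have r0 : 0 <= h + s by case/andP: crd => /ltW cr _; exact: le_trans cr.
  have rT : h + s < T by case/andP: crd => _ rd; exact: lt_le_trans rd dT.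
  have hyp := hd1 _ r0 rT.
  have : `|s - (h + s)| < d1 by rewrite opprD addrCA subrr addr0 normrN.
  move=> /hyp hy.
  have mr := state_measurable r0 rT.
  have := bounded_pair_le (ltW e1) (measurable_funB mr ms) hy
    (measurable_funB (mPhi _ crd) (mPhi _ csd)) (B := L * `|h|).
  move=> /(_ _)/le_trans; apply.
    by move=> x; have := Plip _ x crd; rewrite addrK.
  have -> : e / (L * m + 1) * (L * `|h|) * m = e / (L * m + 1) * (L * m) * `|h|.
    by ring.
  rewrite ler_wpM2r// mulrAC ler_pdivrMr ?ltr_wpDl ?mulr_ge0//.
  by rewrite ler_wpM2l ?(ltW e0)// lerDl.
have := is_derive1D (is_derive1B (is_derive1D dN dM) (is_derive_cst (pairing s (Phi s)) s 1)) dR.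
rewrite subr0 addr0 => D.
have E : pairing s (fun x => laplacian (Phi s) x + dPhi s x) =
    pairing s (laplacian (Phi s)) + pairing s (dPhi s).
  rewrite /pairing -RintegralD//; first by apply: eq_Rintegral => x _; rewrite mulrDr.
    exact: bounded_pair_integrable ms hK mL hBL.
  exact: bounded_pair_integrable ms hK mdPhi (fun x => hL s x csd).
rewrite E; apply: near_eq_is_derive D.
near=> r.
have crd : c < r < d.
  by apply/andP; split; near: r; [exact: lt_nbhsr|exact: lt_nbhsl].
have r0 : 0 <= r by case/andP: crd => /ltW cr _; exact: le_trans cr.
have rT : r < T by case/andP: crd => _ rd; exact: lt_le_trans rd dT.
have [Kr _ hKr] := state_bounded r0 rT.
have mr := state_measurable r0 rT.
have mPr := mPhi r crd; have mPs := mPhi s csd.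
have i1 := bounded_pair_integrable mr hKr mPr (fun x => hB r x crd).
have i2 := bounded_pair_integrable mr hKr mPs (fun x => hB s x csd).
have i3 := bounded_pair_integrable ms hK mPr (fun x => hB r x crd).
have i4 := bounded_pair_integrable ms hK mPs (fun x => hB s x csd).
rewrite /cst /rho.
have -> : \int[mu]_(x in Omega) ((y r x - y s x) * (Phi r x - Phi s x)) =
  (pairing r (Phi r) - pairing r (Phi s)) - (pairing s (Phi r) - pairing s (Phi s)).
  rewrite /pairing -!RintegralB//.
  - by apply: eq_Rintegral => x _; ring.
  - by have := integrableB mO i1 i2; apply: eq_integrable.
  - by have := integrableB mO i3 i4; apply: eq_integrable.
ring.
Unshelve. all: by end_near. Qed.

End weak_heat.

(** * The heat flow of a box with a cutoff *)

Section heat_kernel_box.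
Context {R : realType} {n : nat}.
Local Notation V := 'rV[R]_n.
Implicit Types (s q : R) (z : V) (al be : 'I_n -> R) (i j : 'I_n).

Variables (b : R -> R) (r0 r1 r2 B : R) (a : V).
Hypotheses (r0_gt0 : 0 < r0) (r01 : r0 < r1) (r12 : r1 < r2).
Hypothesis b_smooth : forall k, Cn k b.
Hypothesis b01 : forall x, 0 <= b x <= 1.
Hypothesis b1 : forall x, `|x| <= r1 -> b x = 1.
Hypothesis b0 : forall x, r2 <= `|x| -> b x = 0.
Hypothesis B_ge0 : 0 <= B.
Hypothesis bB : forall x, `|derive1 b x| <= B /\ `|derive1 (derive1 b) x| <= B.

Definition hfactor al be s i : R -> R := cuth b (a ord0 i) (al i) (be i) s.
Definition hfactor_t al be s i : R -> R := cuth_t b (a ord0 i) (al i) (be i) s.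
Definition hfactor_c al be s i : R -> R := commut b (a ord0 i) (al i) (be i) s.

Definition heatbox al be s : V -> R := tens (hfactor al be s).
Definition heatbox_t al be s z : R :=
  \sum_i tens (upd (hfactor al be s) i (hfactor_t al be s i)) z.
(** What the truncated evolution lacks to solve the heat equation. *)
Definition heatbox_c al be s z : R :=
  \sum_i tens (upd (hfactor al be s) i (hfactor_c al be s i)) z.

Lemma smooth_hfactor al be s i : smoothR (hfactor al be s i).
Proof. by move=> k; exact: Cn_cuth. Qed.

Lemma laplacian_heatbox al be s z :
  laplacian (heatbox al be s) z = heatbox_t al be s z + heatbox_c al be s z.
Proof.
rewrite /laplacian -big_split/=; apply: eq_bigr => i _.
rewrite partial2_tens => [|j]; last exact: smooth_hfactor.
rewrite -tens_updB; congr (tens (upd _ _ _) z).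
by apply/funext => x; exact: cuth_derive2.
Qed.

Lemma is_derive_heatbox al be s z : 0 < s ->
  is_derive s 1 (fun s => heatbox al be s z) (heatbox_t al be s z).
Proof.
move=> s0; have d i := is_derive_cuth_t b (a ord0 i) (al i) (be i) (z ord0 i) s0.
refine (is_derive_eq (is_derive_prod d) _); apply: eq_bigr => i _.
by apply: eq_bigr => j _; rewrite /upd; case: eqVneq => [->|].
Qed.

Lemma heatbox_test (Omega : set V) al be s : cube a r2 `<=` Omega ->
  test_function Omega (heatbox al be s).
Proof.
move=> aO; apply: tens_test aO _ _ => [i|i x xr]; first exact: smooth_hfactor.
exact: (cuth_eq0 b0 _ _ _ (ltW xr)).
Qed.

Lemma heatbox_out al be s z : ~ cube a r2 z -> heatbox al be s z = 0.
Proof.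
move=> /existsNP[i /negP]; rewrite -ltNge => zr.
by apply/eqP/prodf_eq0; exists i => //; rewrite [X in X == _](cuth_eq0 b0)// ltW.
Qed.

Lemma tens_upd_out (f : 'I_n -> R -> R) i g z :
  (forall j x, r2 < `|x - a ord0 j| -> f j x = 0) ->
  (forall x, r2 < `|x - a ord0 i| -> g x = 0) ->
  ~ cube a r2 z -> tens (upd f i g) z = 0.
Proof.
move=> f0 g0 /existsNP[j /negP]; rewrite -ltNge => zr.
apply/eqP/prodf_eq0; exists j => //; rewrite /upd.
by apply/eqP; move: zr; case: (eqVneq j i) => [->|_ zr]; [exact: g0|exact: f0].
Qed.

(** In each term one factor is a commutator, which is supported in the shell in
    its own variable; the other factors vanish off the cube. *)
Lemma heatbox_c_out al be s z :
  ~ (cube a r2 z /\ exists i, r1 <= `|z ord0 i - a ord0 i|) ->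
  heatbox_c al be s z = 0.
Proof.
move=> h; apply: big1 => i _.
have [zc|zc] := pselect (cube a r2 z); last first.
  apply: tens_upd_out zc => [j x xr|x xr].
    exact: (cuth_eq0 b0 _ _ _ (ltW xr)).
  by apply: (commut_eq0 b1 b0); right.
apply/eqP/prodf_eq0; exists i => //; rewrite /upd eqxx.
rewrite [X in X == _](commut_eq0 b1 b0)//; left; rewrite ltNge; apply/negP => zr.
by apply: h; split => //; exists i.
Qed.

Lemma measurable_heatbox al be s : measurable_fun setT (heatbox al be s).
Proof.
apply: continuous_measurable_rV; apply: continuous_tens => i x.
by apply: smoothR_continuous; exact: smooth_hfactor.
Qed.

Lemma smooth_hfactor_t al be s i : smoothR (hfactor_t al be s i).
Proof.
move=> k; apply: CnM; first exact: Cn_shift.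
have e1 : derive1 (hbox (al i) (be i) (hscale s)) = hbox' (al i) (be i) (hscale s).
  by apply: derive1_funext => x; exact: is_derive_hbox.
have e2 : derive1 (hbox' (al i) (be i) (hscale s)) = hbox'' (al i) (be i) (hscale s).
  by apply: derive1_funext => x; exact: is_derive_hbox'.
rewrite -e2 -e1; have [_] := Cn_hbox k.+2 (al i) (be i) (hscale s).
by case.
Qed.

Lemma measurable_heatbox_t al be s : measurable_fun setT (heatbox_t al be s).
Proof.
apply: measurable_sum => i.
apply: continuous_measurable_rV; apply: continuous_tens => j x.
apply: smoothR_continuous; apply: smoothR_upd; first exact: smooth_hfactor.
exact: smooth_hfactor_t.
Qed.

Lemma measurable_heatbox_c al be s : measurable_fun setT (heatbox_c al be s).
Proof.
have -> : heatbox_c al be s =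
    fun z => laplacian (heatbox al be s) z - heatbox_t al be s z.
  by apply/funext => z; rewrite laplacian_heatbox addrAC subrr add0r.
apply: measurable_funB; last exact: measurable_heatbox_t.
have h : test_function setT (heatbox al be s) by exact: heatbox_test.
by have [] := test_function_laplacian h.
Qed.

Section in_cube.
Variables (al be : 'I_n -> R).
Hypothesis al_ge : forall i, a ord0 i - r0 <= al i.
Hypothesis albe : forall i, al i < be i.
Hypothesis be_le : forall i, be i <= a ord0 i + r0.

Lemma heatbox_bound s z : 0 < s ->
  0 <= heatbox al be s z <= hscale s ^+ n * \prod_i (be i - al i).
Proof.
move=> s0; apply/andP; split.
  by apply: prodr_ge0 => i _; have /andP[] := cuth_bound b01 (a ord0 i) (z ord0 i) s0 (albe i).
rewrite -[X in hscale s ^+ X]card_ord -prodr_const -big_split/=.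
by apply: ler_prod => i _; exact: cuth_bound.
Qed.

Lemma heatbox_le (G : R) s z : 0 < s -> 0 <= G ->
  (forall x u : R, erfR x - erfR u <= G) -> heatbox al be s z <= G ^+ n.
Proof.
move=> s0 G0 hG; rewrite -[X in G ^+ X]card_ord -prodr_const.
apply: ler_prod => i _; have /andP[-> _] := cuth_bound b01 (a ord0 i) (z ord0 i) s0 (albe i).
by rewrite /=; exact: cuth_le.
Qed.

Lemma tens_upd_bound i g s z (X : R) : 0 < s -> `|g (z ord0 i)| <= X ->
  `|tens (upd (hfactor al be s) i g) z| <=
  X * (hscale s ^+ n.-1 * \prod_(j | j != i) (be j - al j)).
Proof.
move=> s0 gX; rewrite /tens (bigD1 i)//= /upd eqxx normrM ler_pM//.
have -> : n.-1 = #|[pred j | j != i]| by rewrite -[in LHS](card_ord n) -(cardC1 i).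
rewrite -prodr_const -big_split/= normr_prod; apply: ler_prod => j ji.
rewrite (negPf ji) normr_ge0/=.
have /andP[h1 h2] := cuth_bound b01 (a ord0 j) (z ord0 j) s0 (albe j).
by rewrite ger0_norm.
Qed.

Lemma heatbox_t_bound s0 : 0 < s0 ->
  exists L, forall s z, s0 <= s -> `|heatbox_t al be s z| <= L.
Proof.
move=> s00; set q := hscale s0.
exists (\sum_i 8 * r2 * q ^+ 3 * (q ^+ n.-1 * \prod_(j | j != i) (be j - al j))).
move=> s z s0s; have sp := lt_le_trans s00 s0s.
apply: (le_trans (ler_norm_sum _ _ _)); apply: ler_sum => i _.
have qs : hscale s <= q by exact: hscale_le.
have q0 := hscale_gt0 sp; have q1 := hscale_gt0 s00.
have r20 : 0 < r2 by rewrite (lt_trans _ r12)// (lt_trans _ r01).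
have pr : 0 <= \prod_(j | j != i) (be j - al j).
  by apply: prodr_ge0 => j _; rewrite subr_ge0 ltW.
have := @tens_upd_bound i (hfactor_t al be s i) s z _ sp
  (cuth_t_bound r0_gt0 r01 r12 b01 b0 (al_ge i) (albe i) (be_le i) (z ord0 i) sp).
move=> /le_trans; apply.
have hq k : hscale s ^+ k <= q ^+ k by rewrite lerXn2r// nnegrE ltW.
rewrite ler_pM ?mulr_ge0 ?exprn_ge0 ?(ltW q0) ?(ltW r20)//.
  by rewrite ler_wpM2l ?mulr_ge0 ?(ltW r20).
by rewrite ler_wpM2r.
Qed.

End in_cube.

(** Each of the other [n - 1] factors of a term is at most [hscale s] times the
    side of the box, and the Gaussian in the commutator absorbs the product of
    all powers of [hscale s]. *)
Lemma heatbox_c_bound : exists2 C : R, 0 <= C & forall al be,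
  (forall i, a ord0 i - r0 <= al i) -> (forall i, al i < be i) ->
  (forall i, be i <= a ord0 i + r0) -> forall s z, 0 < s ->
  `|heatbox_c al be s z| <= C * \prod_i (be i - al i).
Proof.
have c0 : 0 < (r1 - r0) ^+ 2 by rewrite exprn_gt0// subr_gt0.
have [C1 hC1] := expR_pow_gauss_bound (n.-1 + 3) c0.
have [C2 hC2] := expR_pow_gauss_bound (n.-1 + 1) c0.
have r20 : 0 < r2 by rewrite (lt_trans _ r12)// (lt_trans _ r01).
have C10 : 0 <= C1.
  have := hC1 1 ler01; apply: le_trans.
  by rewrite mulr_ge0 ?expR_ge0// exprn_ge0.
have C20 : 0 <= C2.
  have := hC2 1 ler01; apply: le_trans.
  by rewrite mulr_ge0 ?expR_ge0// exprn_ge0.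
exists (n%:R * (B * (8 * r2 * C1 + C2))).
  by rewrite !mulr_ge0// addr_ge0// !mulr_ge0// ltW.
move=> al be al_ge albe be_le s z s0.
apply: (le_trans (ler_norm_sum _ _ _)).
set P := \prod_i _.
apply: (@le_trans _ _ (\sum_(i < n) B * (8 * r2 * C1 + C2) * P)); last first.
  rewrite sumr_const card_ord -[X in X <= _]mulr_natl.
  by rewrite mulrA.
apply: ler_sum => i _; set q := hscale s.
have q0 : 0 <= q by rewrite ltW// hscale_gt0.
have pr : 0 <= \prod_(j | j != i) (be j - al j).
  by apply: prodr_ge0 => j _; rewrite subr_ge0 ltW.
have := @tens_upd_bound al be albe i (hfactor_c al be s i) s z _ s0
  (commut_bound r0_gt0 r01 r12 b1 b0 B_ge0 bB (al_ge i) (albe i) (be_le i) (z ord0 i) s0).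
have PE : P = (be i - al i) * \prod_(j | j != i) (be j - al j).
  by rewrite /P (bigD1 i).
move=> /le_trans; apply; rewrite -/q PE.
have := hC1 q q0; have := hC2 q q0; rewrite !exprD expr1.
set X := expR _; set Q := q ^+ n.-1 => h2 h1.
set D := be i - al i; set E := \prod_(j | _) _ in pr *.
have D0 : 0 <= D by rewrite subr_ge0 ltW.
have -> : D * (B * (8 * r2 * q ^+ 3 + q) * X) * (Q * E) =
  B * (8 * r2 * (Q * q ^+ 3 * X) + Q * q * X) * (D * E) by ring.
rewrite ler_wpM2r ?mulr_ge0// ler_wpM2l// lerD//.
by rewrite ler_wpM2l// mulr_ge0// ltW.
Qed.

End heat_kernel_box.

(** * The interior estimate *)

Section hyperplane.
Context {R : realType} {n : nat}.
Local Notation V := 'rV[R]_n.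
Local Notation mu := (@lebesgue_rV R n).

Lemma hyperplane_negligible (i : 'I_n) (c : R) :
  {ae mu, forall z : V, z ord0 i != c}.
Proof.
pose A (j : 'I_n) : set (measurableTypeR R) := if j == i then [set c] else setT.
have mA j : measurable (A j) by rewrite /A; case: ifP.
pose N : set V := [set z | forall j, A j (z ord0 j)].
have NE : N = (fun z : V => z ord0 i : measurableTypeR R) @^-1` [set c].
  apply/seteqP; split => z /= h; first by have := h i; rewrite /A eqxx.
  by move=> j; rewrite /A; case: eqVneq => // ->.
exists N; split.
- rewrite NE -[X in measurable X]setTI; exact: measurable_rV_coord.
- by rewrite lebesgue_rV_box// (bigD1 i)//= /A eqxx lebesgue_measure_set1 mul0e.
- by move=> z /negP; rewrite negbK => /eqP zc; rewrite NE.
Qed.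

Lemma off_hyperplanes_ae (c : 'I_n -> R) :
  {ae mu, forall z : V, forall i, z ord0 i != c i}.
Proof.
have h : {ae mu, forall z : V, forall k : nat, forall i : 'I_n, i = k :> nat -> z ord0 i != c i}.
  apply: ae_foralln => k; have [kn|nk] := ltnP k n; last first.
    by apply: aeW => z i ik; move: nk; rewrite -ik leqNgt ltn_ord.
  apply: filterS (hyperplane_negligible (Ordinal kn) (c (Ordinal kn))) => z hz i ik.
  by rewrite (_ : i = Ordinal kn)//; exact: val_inj.
by apply: filterS h => z hz i; exact: hz.
Qed.
End hyperplane.

Section box_estimate.
Context {R : realType} {n : nat}.
Local Notation V := 'rV[R]_n.
Local Notation mu := (@lebesgue_rV R n).
Local Notation leb := (@lebesgue_measure R).
Implicit Types (s t eps : R) (z : V) (al be : 'I_n -> R) (i j : 'I_n).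

Variables (Omega omega : set V) (F : @feedback R n) (y0 : V -> R) (T : R)
  (y : R -> V -> R).
Hypotheses (mO : measurable Omega) (muO : (mu Omega < +oo)%E).
Hypothesis y_sol : solution Omega omega F y0 T%:E y.
Hypothesis y_cont : C_Linfty Omega T%:E y.
Variables (b : R -> R) (r0 r1 r2 B : R) (a : V).
Hypotheses (r0_gt0 : 0 < r0) (r01 : r0 < r1) (r12 : r1 < r2).
Hypothesis b_smooth : forall k, Cn k b.
Hypothesis b01 : forall x, 0 <= b x <= 1.
Hypothesis b1 : forall x, `|x| <= r1 -> b x = 1.
Hypothesis b0 : forall x, r2 <= `|x| -> b x = 0.
Hypothesis B_ge0 : 0 <= B.
Hypothesis bB : forall x, `|derive1 b x| <= B /\ `|derive1 (derive1 b) x| <= B.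
Hypothesis cube_sub : cube a r2 `<=` Omega.
Hypothesis cube_omega : forall z, cube a r2 z -> ~ omega z.
Variables (t0 M : R).
Hypotheses (t0_ge0 : 0 <= t0) (M_ge0 : 0 <= M).
Hypothesis annulus : forall s, t0 < s -> s < T ->
  {ae mu, forall z, cube a r2 z -> (exists i, r1 <= `|z ord0 i - a ord0 i|) ->
     `|y s z| <= M}.

Local Notation hb := (heatbox b a).
Let inside al be := [/\ forall i, a ord0 i - r0 <= al i,
  forall i, al i < be i & forall i, be i <= a ord0 i + r0].

Lemma heatbox_abs_bound al be s e z : inside al be -> 0 < e -> e <= s ->
  `|hb al be s z| <= hscale e ^+ n * \prod_i (be i - al i).
Proof.
move=> [_ albe _] e0 es; have s0 := lt_le_trans e0 es.
have /andP[h1 h2] := heatbox_bound a b01 albe z s0.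
rewrite ger0_norm// (le_trans h2)// ler_wpM2r//.
  by apply: prodr_ge0 => i _; rewrite subr_ge0 ltW.
by rewrite lerXn2r// ?nnegrE ?(ltW (hscale_gt0 _))// hscale_le.
Qed.

(** The time of the heat evolution is [t + eps - s], so it runs backwards in
    [s]; up to [t + eps / 2] it stays above [eps / 2], where all the bounds
    needed to differentiate hold. *)
Lemma is_derive_pair_heatbox al be t eps s : inside al be -> 0 < eps ->
  t < T -> t0 < s -> s < Num.min T (t + eps / 2) ->
  is_derive s 1 (fun s => pairing Omega y s (hb al be (t + eps - s)))
    (pairing Omega y s (heatbox_c b a al be (t + eps - s))).
Proof.
move=> ins e0 tT ts sd; have [al_ge albe be_le] := ins.
have e2 : 0 < eps / 2 by rewrite divr_gt0.
have sc r : t0 < r < Num.min T (t + eps / 2) -> eps / 2 <= t + eps - r.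
  by rewrite lt_min => /and3P[_ _ h]; lra.
have [L hL] := heatbox_t_bound r0_gt0 r01 r12 b01 b0 al_ge albe be_le e2.
have := @is_derive_moving_pair _ _ _ _ _ _ _ _ mO muO y_sol y_cont
  (fun r => hb al be (t + eps - r)) (fun r z => - heatbox_t b a al be (t + eps - r) z)
  t0 (Num.min T (t + eps / 2)) s L (hscale (eps / 2) ^+ n * \prod_i (be i - al i))
  t0_ge0.
rewrite ge_min lexx ts sd => /(_ isT isT) h.
rewrite (_ : heatbox_c _ _ _ _ _ = fun x => laplacian (hb al be (t + eps - s)) x -
    heatbox_t b a al be (t + eps - s) x); last first.
  by apply/funext => x; rewrite (laplacian_heatbox _ b_smooth) [RHS]addrC addKr.
apply: h.
- move=> r x /sc h; have s0 := lt_le_trans e2 h.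
  have d : is_derive r 1 (fun r => t + eps - r) (-1).
    refine (is_derive_eq (is_derive1B (is_derive_cst (t + eps) r 1) (is_derive_id r 1)) _).
    by rewrite sub0r.
  refine (is_derive_eq (@is_derive1_chain _ (fun s => hb al be s x) _ r _ _
    (is_derive_heatbox b a al be x s0) d) _).
  by rewrite mulrN1.
- by move=> r _; exact: measurable_heatbox.
- by apply: measurableT_comp => //; exact: measurable_heatbox_t.
- by move=> r x /sc; exact: heatbox_abs_bound.
- by move=> r x /sc h; rewrite normrN hL.
- exact: heatbox_test cube_sub.
- move=> x wx; apply: (heatbox_out b0); by move/cube_omega.
Qed.

(** The mean value inequality between [t] and the fixed time [tm], halfway from
    [t0] to [t1]: at [tm] the heat kernel is bounded since its time is at
    least [t1 - tm], and in between the derivative only sees the shell. *)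
Lemma pair_heatbox_bound t1 : t0 < t1 -> t1 < T -> exists2 C : R, 0 <= C &
  forall al be t eps, inside al be -> t1 <= t -> t < T -> 0 < eps ->
  `|pairing Omega y t (hb al be eps)| <= C * \prod_i (be i - al i).
Proof.
move=> t01 t1T; pose tm := (t0 + t1) / 2.
have [tm0 tm1] : t0 < tm /\ tm < t1 by rewrite /tm; split; lra.
have tm_ge0 : 0 <= tm by rewrite (le_trans t0_ge0)// ltW.
have tmT : tm < T by exact: lt_trans t1T.
have [K K0 hK] := state_bounded y_cont tm_ge0 tmT.
have [Cc Cc0 hCc] := @heatbox_c_bound _ _ b r0 r1 r2 B a r0_gt0 r01 r12 b01 b1 b0 B_ge0 bB.
set m := fine (mu Omega); have m0 : 0 <= m by exact: fine_ge0.
set q := hscale (t1 - tm).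
have q0 : 0 < q by rewrite hscale_gt0// subr_gt0.
exists (M * Cc * m * T + K * q ^+ n * m).
  by rewrite addr_ge0// !mulr_ge0 ?exprn_ge0 ?(ltW q0)// (le_trans tm_ge0)// ltW.
move=> al be t eps ins t1t tT e0; have [al_ge albe be_le] := ins.
set P := \prod_i _; have P0 : 0 <= P.
  by apply: prodr_ge0 => i _; rewrite subr_ge0 ltW.
pose d := Num.min T (t + eps / 2).
pose E s := pairing Omega y s (hb al be (t + eps - s)).
have dE s : t0 < s < d ->
    is_derive s 1 E (pairing Omega y s (heatbox_c b a al be (t + eps - s))).
  by move=> /andP[h1 h2]; exact: is_derive_pair_heatbox.
have bE s : t0 < s < d ->
    `|pairing Omega y s (heatbox_c b a al be (t + eps - s))| <= M * (Cc * P) * m.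
  rewrite lt_min => /and3P[h1 h2 h3].
  have se : 0 < t + eps - s by lra.
  have s_ge0 : 0 <= s by rewrite (le_trans t0_ge0)// ltW.
  apply: ae_bounded_Rintegral => //.
  - apply: measurable_funM; first exact: (state_measurable y_cont s_ge0 h2).
    by apply: measurable_funTS; exact: (measurable_heatbox_c _ _ b0).
  - by rewrite !mulr_ge0.
  apply: filterS (annulus h1 h2) => z hz Oz.
  have [h|h] := pselect (cube a r2 z /\ exists i, r1 <= `|z ord0 i - a ord0 i|).
    rewrite normrM ler_pM//; first by case: h; exact: hz.
    exact: hCc.
  by rewrite (heatbox_c_out b1 b0 _ _ _ h) mulr0 normr0 !mulr_ge0.
have td : t0 < t < d by rewrite (lt_le_trans t01)//= lt_min tT ltrDl divr_gt0.
have tmd : t0 < tm < d.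
  by rewrite tm0/=; case/andP: td => _; apply: lt_trans; exact: lt_le_trans t1t.
have := derive_bound_lipschitz dE bE td tmd.
rewrite {1}/E (addrC t) addrK => lip.
have Em : `|E tm| <= K * (q ^+ n * P) * m.
  apply: (bounded_pair_le mO muO K0 (state_measurable y_cont tm_ge0 tmT) hK).
    exact: measurable_heatbox.
  move=> x; apply: heatbox_abs_bound => //; first by rewrite subr_gt0.
  lra.
have tT' : `|t - tm| <= T.
  by rewrite ger0_norm; lra.
have : `|pairing Omega y t (hb al be eps)| <= M * (Cc * P) * m * T + K * (q ^+ n * P) * m.
  rewrite -[X in `|X|](subrK (E tm)) (le_trans (ler_normD _ _))// lerD//.
  rewrite (le_trans lip)// ler_wpM2l// !mulr_ge0//.
move=> /le_trans; apply; rewrite le_eqVlt; apply/orP; left; apply/eqP; ring.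
Qed.

Lemma box_in_Omega al be : inside al be -> box al be `<=` Omega.
Proof.
move=> [al_ge _ be_le] z zb; apply: cube_sub => i; have /andP[h1 h2] := zb i.
move: r0_gt0 r01 r12 (al_ge i) (be_le i) => ? ? ? ? ?.
by rewrite ler_norml; apply/andP; split; lra.
Qed.

Lemma heatbox_limit (G0 G1 : R) al be z : inside al be ->
  (forall e : R, 0 < e -> exists A : R, 0 < A /\ forall x, A <= x ->
     G1 - e < erfR x /\ erfR (- x) < G0 + e) ->
  (forall x, G0 <= erfR x <= G1) ->
  (forall i, z ord0 i != al i) -> (forall i, z ord0 i != be i) ->
  hb al be k.+1%:R^-1 z @[k --> \oo] --> (G1 - G0) ^+ n * \1_(box al be) z.
Proof.
move=> [al_ge albe be_le] hG hG' zal zbe.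
have -> : (G1 - G0) ^+ n * \1_(box al be) z =
    \prod_i (b (z ord0 i - a ord0 i) * ((G1 - G0) * \1_(`]al i, be i[%classic) (z ord0 i))).
  have [zb|zb] := pselect (box al be z); last first.
    rewrite indicE memNset// mulr0; apply/esym/eqP/prodf_eq0.
    move/existsNP: zb => [i hi]; exists i => //.
    rewrite indicE memNset ?mulr0//= in_itv/= => /andP[h1 h2].
    by apply: hi; rewrite (ltW h1).
  rewrite indicE mem_set// mulr1 -[X in _ ^+ X]card_ord -prodr_const.
  apply: eq_bigr => i _; have /andP[h1 h2] := zb i.
  rewrite b1; last first.
    move: r0_gt0 r01 r12 (al_ge i) (be_le i) => ? ? ? ? ?.
    by rewrite ler_norml; apply/andP; split; lra.
  by rewrite indicE mem_set ?mul1r ?mulr1//= in_itv/= h2 lt_neqAle h1 eq_sym zal.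
rewrite /heatbox /tens; apply: cvg_big => [|i _]; first exact: mul_continuous.
apply: cvgM; first exact: cvg_cst.
apply: (hbox_limit hG hG' (albe i) (s := fun k => k.+1%:R^-1)) => //.
exact: cvg_harmonic.
Qed.

(** Let [eps] tend to 0 in [pair_heatbox_bound].  The limit of the test
    functions is a multiple of the indicator of the box off the hyperplanes
    that bound it. *)
Lemma box_integral_bound t1 : t0 < t1 -> t1 < T -> exists2 C : R, 0 <= C &
  forall al be t, inside al be -> t1 <= t -> t < T ->
  `|\int[mu]_(z in box al be) y t z| <= C * \prod_i (be i - al i).
Proof.
move=> t01 t1T; have [C C0 hC] := pair_heatbox_bound t01 t1T.
have [G0 [G1 [G01 hG' hG]]] := @erfR_limits R.
have D0 : 0 < (G1 - G0) ^+ n by rewrite exprn_gt0// subr_gt0.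
exists (C / (G1 - G0) ^+ n); first by rewrite divr_ge0// ltW.
move=> al be t ins t1t tT; have t_ge0 := le_trans t0_ge0 (ltW (lt_le_trans t01 t1t)).
have [K K0 hK] := state_bounded y_cont t_ge0 tT.
have my := state_measurable y_cont t_ge0 tT.
pose f k z : R := y t z * hb al be k.+1%:R^-1 z.
pose g z : R := (G1 - G0) ^+ n * (y t \_ (box al be)) z.
have [_ albe _] := ins.
have f_g : {ae mu, forall z, Omega z -> (f k z)%:E @[k --> \oo] --> (g z)%:E}.
  have := off_hyperplanes_ae be; apply: filterS2 (off_hyperplanes_ae al).
  move=> z zal zbe Oz; apply: cvg_EFin; first exact: nearW.
  rewrite (_ : g z = y t z * ((G1 - G0) ^+ n * \1_(box al be) z)).
    by apply: cvgM; [exact: cvg_cst|exact: heatbox_limit].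
  by rewrite /g patchE indicE; case: ifP => _; rewrite ?mulr0 ?mulr1 1?mulrC.
have bO := box_in_Omega ins.
have mb : measurable (box al be) by exact: measurable_box.
have mg : measurable_fun Omega g.
  apply: measurable_funM => //; apply/measurable_restrict => //.
  by apply: measurable_funS my => //; exact: subIset; left.
have mf k : measurable_fun Omega (f k).
  apply: measurable_funM => //; apply: measurable_funTS.
  exact: measurable_heatbox.
have mh : measurable_fun Omega (fun z => `|y t z| * (G1 - G0) ^+ n).
  by apply: measurable_funM => //; exact: measurableT_comp.
have ih : mu.-integrable Omega (EFin \o (fun z => `|y t z| * (G1 - G0) ^+ n)).
  apply: (ae_bounded_integrable (K := K * (G1 - G0) ^+ n)) => //.
  apply: filterS hK => z h Oz; rewrite normrM normr_id (ger0_norm (ltW D0)).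
  by rewrite ler_wpM2r ?(ltW D0)// h.
have fh : {ae mu, forall z, forall k, Omega z ->
    (`|(f k z)%:E| <= (`|y t z| * (G1 - G0) ^+ n)%:E)%E}.
  apply: aeW => z k _; rewrite abse_EFin lee_fin normrM ler_wpM2l//.
  have k0 : (0 : R) < k.+1%:R^-1 by rewrite invr_gt0.
  have /andP[h1 _] := heatbox_bound a b01 albe z k0.
  rewrite ger0_norm//; apply: heatbox_le => //; first by rewrite subr_ge0 ltW.
  move=> x u; have /andP[_ h2] := hG' x; have /andP[h3 _] := hG' u.
  exact: lerB.
have [ig _ cv] := dominated_convergence mO (fun k => (measurable_EFinP _ _).2 (mf k))
  ((measurable_EFinP _ _).2 mg) f_g ih fh.
have gE : \int[mu]_(z in Omega) g z = (G1 - G0) ^+ n * \int[mu]_(z in box al be) y t z.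
  rewrite RintegralZl//; last first.
    have h := integrableZl mO ((G1 - G0) ^- n) ig.
    apply: eq_integrable h => // z _; rewrite /= -EFinM /g mulrA mulVf ?mul1r//.
    by rewrite gt_eqF.
  by rewrite -Rintegral_mkcondr setIidr.
have cv' : pairing Omega y t (hb al be k.+1%:R^-1) @[k --> \oo] --> \int[mu]_(z in Omega) g z.
  apply: fine_cvg; rewrite /Rintegral fineK; last exact: integrable_fin_num.
  exact: cv.
have : `|(G1 - G0) ^+ n * \int[mu]_(z in box al be) y t z| <= C * \prod_i (be i - al i).
  rewrite -gE; apply: (cvgr_to_le (cvg_norm cv')).
  by apply: nearW => k; exact: hC.
rewrite normrM (ger0_norm (ltW D0)) mulrAC ler_pdivlMr//.
by rewrite mulrC.
Qed.

(** Both [C + y t] and [C - y t] have nonnegative integrals over all boxes of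
    the cube. *)
Lemma state_ae_bound t1 : t0 < t1 -> t1 < T -> exists2 C : R, 0 <= C &
  forall t, t1 <= t -> t < T ->
  {ae mu, forall z, box (fun i => a ord0 i - r0) (fun i => a ord0 i + r0) z ->
     `|y t z| <= C}.
Proof.
move=> t01 t1T; have [C C0 hC] := box_integral_bound t01 t1T.
exists C => // t t1t tT.
have t_ge0 := le_trans t0_ge0 (ltW (lt_le_trans t01 t1t)).
have [K K0 hK] := state_bounded y_cont t_ge0 tT.
have my := state_measurable y_cont t_ge0 tT.
pose al0 i := a ord0 i - r0; pose be0 i := a ord0 i + r0.
have ab0 i : al0 i < be0 i by move: r0_gt0; rewrite /al0 /be0 => ?; lra.
have ins0 : inside al0 be0 by split => //.
have QO := box_in_Omega ins0; set Q := box al0 be0 in QO *.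
have mQ : measurable Q by exact: measurable_box.
have myQ := measurable_funS mO QO my.
(* [y t] is only bounded almost everywhere, unlike its truncation [w] *)
pose w (z : V) : R := Num.max (- K) (Num.min K (y t z)).
have mw : measurable_fun Q w.
  by apply: measurable_maxr => //; exact: measurable_minr.
have wK z : `|w z| <= K.
  rewrite ler_norml le_max lexx /= ge_max ge_min lexx /=.
  by rewrite (le_trans _ K0)// oppr_le0.
have wy : {ae mu, forall z, Omega z -> w z = y t z}.
  apply: filterS hK => z h Oz; have := h Oz; rewrite ler_norml => /andP[h1 h2].
  by rewrite /w (min_idPr h2) (max_idPr h1).
have half (e : R) : `|e| <= 1 -> {ae mu, forall z, Q z -> 0 <= C + e * w z}.
  move=> e1.
  apply: (@box_nonneg_ae _ _ al0 be0 (fun z => C + e * w z) (C + K)).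
  - by move=> i; exact: ltW.
  - by apply: measurable_funD => //; exact: measurable_funM.
  - move=> z _; rewrite (le_trans (ler_normD _ _))// (ger0_norm C0) lerD2l.
    by rewrite normrM (le_trans (ler_piMl _ e1)).
  move=> al be al_ge albe be_le; have ins : inside al be by split.
  have bO := box_in_Omega ins; have mb : measurable (box al be) by exact: measurable_box.
  have mub : (mu (box al be) < +oo)%E.
    by rewrite lebesgue_box => [|i]; rewrite ?ltry// ltW.
  have bQ : box al be `<=` Q.
    move=> z zb i; have /andP[h1 h2] := zb i.
    by rewrite (le_trans (al_ge i) h1) (lt_le_trans h2 (be_le i)).
  have mwb := measurable_funS mQ bQ mw.
  have iw : mu.-integrable (box al be) (EFin \o w).
    by apply: bounded_integrable mwb _ => // z _; exact: wK.
  have iew : mu.-integrable (box al be) (EFin \o (fun z => e * w z)).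
    have h := integrableZl mb e iw.
    by apply: eq_integrable h => // z _; rewrite /= EFinM.
  have E : \int[mu]_(z in box al be) w z = \int[mu]_(z in box al be) y t z.
    rewrite /Rintegral; congr fine; apply: ae_eq_integral => //.
    - exact/measurable_EFinP.
    - by apply/measurable_EFinP; exact: measurable_funS mO bO my.
    - by apply: filterS wy => z h /bO/h ->.
  rewrite RintegralD//; last exact: integrable_cst.
  have -> : \int[mu]_(z in box al be) C = C * \prod_i (be i - al i).
    rewrite Rintegral_cst//; congr (_ * _).
    by rewrite (_ : \prod_i _ = fine (mu (box al be)))// lebesgue_box// => i; exact: ltW.
  rewrite RintegralZl// E -[X in X <= _](subrr (C * \prod_i (be i - al i))) lerD2l.
  rewrite lerNl -mulrN (le_trans (ler_norm _))// normrM normrN.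
  by rewrite (le_trans (ler_piMl _ e1))//; exact: hC.
have := half 1; rewrite normr1 lexx => /(_ isT) h1.
have := half (-1); rewrite normrN1 lexx => /(_ isT) h2.
apply: filterS3 wy h1 h2 => z h3 h1 h2 Qz.
have := h1 Qz; have := h2 Qz; rewrite (h3 (QO _ Qz)) mul1r mulN1r.
rewrite subr_ge0 ler_norml => -> h4.
by rewrite andbT -subr_ge0 opprK addrC.
Qed.

End box_estimate.

(** * Blowup points *)

Section blowup.
Context {R : realType} {n : nat}.
Local Notation V := 'rV[R]_n.
Local Notation mu := (@lebesgue_rV R n).
Implicit Types (t s r M : R) (x z : V).

Variables (Omega : set V) (T : R) (y : R -> V -> R).

Let bounded_near_T (A : set V) (p : R * R) := forall t, 0 <= t -> t < T -> T - p.1 < t ->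
  {ae mu, forall x, Omega x -> A x -> `|y t x| <= p.2}.

(** If no such neighbourhood and bound existed, sequences witnessing the blowup
    could be chosen.  The bound holds for a representative, hence almost
    everywhere for [y]. *)
Lemma bounded_off_blowup (b : V) : Omega b -> ~ blowup_point Omega T%:E y b ->
  exists r : R * R, 0 < r.1 /\ bounded_near_T (ball b r.1) r.
Proof.
move=> Ob nb.
have [z zy nz] : exists2 z, same_class Omega T%:E z y &
    ~ exists (a_ : nat -> V) (t_ : nat -> R),
    [/\ forall j, Omega (a_ j), forall j, times T%:E (t_ j),
        a_ @ \oo --> b, t_ @ \oo --> T &
        `|z (t_ j) (a_ j)| @[j --> \oo] --> +oo].
  apply: contrapT => h; apply: nb; split => //; exists T => // z zy.
  by apply: contrapT => h'; apply: h; exists z.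
suff [k hk] : exists k : nat, forall t x, times T%:E t -> T - k.+1%:R^-1 < t ->
    Omega x -> ball b k.+1%:R^-1 x -> `|z t x| <= k%:R.
  exists (k.+1%:R^-1, k%:R); split => /=; first by rewrite invr_gt0.
  move=> t t0 tT tk; have tt : times T%:E t by split => //; rewrite lte_fin.
  apply: filterS (zy t tt) => x h Ox bx; rewrite -(h Ox); exact: hk.
apply: contrapT => /forallNP h; apply: nz.
have /choice[p hp] : forall k : nat, exists p : V * R, [/\ times T%:E p.2,
    T - k.+1%:R^-1 < p.2, Omega p.1, ball b k.+1%:R^-1 p.1 & k%:R < `|z p.2 p.1|].
  move=> k; apply: contrapT => h1; apply: (h k) => t x tt tk Ox bx.
  rewrite leNgt; apply/negP => zk; apply: h1.
  by exists (x, t).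
have small e : 0 < e -> \forall k \near \oo, (k.+1%:R^-1 : R) < e.
  move=> e0; have := @cvg_harmonic R.
  move=> /cvgr0_norm_lt/(_ e e0); apply: filterS => k.
  by rewrite /= ger0_norm.
exists (fun k => (p k).1), (fun k => (p k).2); split.
- by move=> k; have [] := hp k.
- by move=> k; have [] := hp k.
- apply/cvg_ballP => e e0; apply: filterS (small e e0) => k ke.
  by have [_ _ _ + _] := hp k; apply: le_ball; exact: ltW.
- apply/cvgrPdist_lt => e e0; apply: filterS (small e e0) => k ke.
  have [[_ +] h1 _ _ _] := hp k; rewrite lte_fin => h2.
  by rewrite gtr0_norm ?subr_gt0// (lt_trans _ ke)// ltrBlDr -ltrBlDl.
- apply: (@ger_cvgy _ _ _ _ (fun k => k%:R)); last exact: cvgr_idn.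
  by apply: nearW => k; have [_ _ _ _ /ltW] := hp k.
Qed.

(** A finite subcover keeps the time interval of positive length, the bound
    finite and the exceptional set null. *)
Lemma compact_bounded_off_blowup (A : set V) : compact A -> A `<=` Omega ->
  (forall b, A b -> ~ blowup_point Omega T%:E y b) ->
  exists r : R * R, 0 < r.1 /\ bounded_near_T A r.
Proof.
move=> cA AO nb.
have /choice[r hr] : forall b : V, exists r : R * R, A b -> 0 < r.1 /\ bounded_near_T (ball b r.1) r.
  move=> b; have [Ab|nAb] := pselect (A b); last by exists (0, 0).
  by have [r ?] := bounded_off_blowup (AO _ Ab) (nb _ Ab); exists r.
have : cover_compact A by rewrite -compact_cover.
move=> /(_ V A (fun b => ball b (r b).1)).
case.
- by move=> b Ab; apply: ball_open; have [] := hr b Ab.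
- by move=> b Ab; exists b => //; apply: ballxx; have [] := hr b Ab.
move=> D DA Acov.
suff [p [p0 hp]] : exists p : R * R, 0 < p.1 /\
    bounded_near_T (\bigcup_(b in [set` finmap.enum_fset D]) ball b (r b).1) p.
  exists p; split => // t t0 tT pt; apply: filterS (hp t t0 tT pt) => x h Ox Ax.
  by apply: h => //; exact: Acov.
have : forall b, b \in finmap.enum_fset D -> A b.
  by move=> b bD; have := DA b bD; rewrite inE.
elim: (finmap.enum_fset D) => [_|b s IH hA].
  exists (1, 0); split => // t _ _ _; apply: aeW => x _ [b /=].
  by rewrite in_nil.
have [|p [p0 hp]] := IH; first by move=> c cs; apply: hA; rewrite inE cs orbT.
have [|rb0 hb] := hr b; first by apply: hA; rewrite inE eqxx.
exists (Num.min p.1 (r b).1, Num.max p.2 (r b).2); split; first by rewrite /= lt_min p0.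
move=> t t0 tT /=; rewrite ltrBlDr -ltrBlDl lt_min => /andP[h1 h2].
have h3 : T - p.1 < t by rewrite ltrBlDr -ltrBlDl.
have h4 : T - (r b).1 < t by rewrite ltrBlDr -ltrBlDl.
apply: filterS2 (hp t t0 tT h3) (hb t t0 tT h4) => x k1 k2 Ox [c /=].
rewrite inE le_max => /orP[/eqP ->|cs] cx; first by rewrite k2 ?orbT.
by rewrite k1//; exists c.
Qed.

(** Setting [y] to 0 where it exceeds the bound changes it on null sets only. *)
Lemma not_blowup_of_ae_bounded (a : V) (U : set V) (t1 C : R) :
  open U -> U a -> t1 < T ->
  (forall t, t1 <= t -> t < T -> {ae mu, forall x, Omega x -> U x -> `|y t x| <= C}) ->
  ~ blowup_point Omega T%:E y a.
Proof.
move=> oU Ua t1T hC [Oa [T' [TT']]]; rewrite -TT' => {T' TT'} h.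
pose z t x := if `[< t1 <= t /\ U x /\ C < `|y t x| >] then 0 else y t x.
have zy : same_class Omega T%:E z y.
  move=> t [t0]; rewrite lte_fin => tT; have [tt|tt] := leP t1 t; last first.
    apply: aeW => x _; rewrite /z asboolF// => -[].
    by rewrite leNgt tt.
  apply: filterS (hC t tt tT) => x hx Ox; rewrite /z asboolF// => -[_ [Ux]].
  by rewrite ltNge hx.
have [a_ [t_ [aO tt ca ct cz]]] := h z zy.
have n1 : \forall j \near \oo, U (a_ j).
  by apply: ca; exact: open_nbhs_nbhs.
have n2 : \forall j \near \oo, t1 < t_ j.
  by have := cvgr_gt T ct; apply.
have n3 : \forall j \near \oo, `|C| + 1 <= `|z (t_ j) (a_ j)|.
  by move/cvgryPge : cz; apply.
near \oo => j.
have : `|z (t_ j) (a_ j)| <= `|C|.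
  rewrite /z; case: asboolP => [_|nz]; first by rewrite normr0.
  rewrite (le_trans _ (ler_norm C))// leNgt; apply/negP => zC; apply: nz.
  split; first by apply: ltW; near: j.
  by split => //; near: j.
apply/negP; rewrite -ltNge (@lt_le_trans _ _ (`|C| + 1))//; first by rewrite ltrDl.
by near: j.
Unshelve. all: by end_near. Qed.

End blowup.

(** * No isolated blowup away from the control *)

Theorem theorem1p2 (R : realType) (n : nat) (n_gt0 : (0 < n)%N)
    (Omega omega : set 'rV[R]_n)
    (Omega_dom : bounded_smooth_domain Omega)
    (omega_open : open omega) (omega_neq0 : omega !=set0)
    (omega_sub : omega `<=` Omega)
    (y0 : 'rV[R]_n -> R)
    (y0_H10 : H10 Omega y0) (y0_Linfty : Lp (lebesgue_rV n) +oo%E Omega y0)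
    (F : feedback) (tmax : \bar R) (tmax_gt0 : (0 < tmax)%E)
    (y : R -> 'rV[R]_n -> R)
    (y_sol : solution Omega omega F y0 tmax y)
    (y_cont : C_Linfty Omega tmax y)
    (y_max : maximal_interval Omega omega F y0 tmax y)
    (a : 'rV[R]_n) (a_notin : (Omega `\` closure omega) a) :
  ~ unique_blowup_point Omega tmax y a.
Proof.
move=> [ablow uniq]; have [Oa [T tmaxT _]] := ablow.
have [oO _ _ bO _] := Omega_dom.
rewrite tmaxT in tmax_gt0 y_sol y_cont ablow uniq; rewrite lte_fin in tmax_gt0.
have mO : measurable Omega by exact: open_measurable_rV.
have muO := bounded_set_finite mO bO.
have [_ na] := a_notin.
have : nbhs a (Omega `&` ~` closure omega).
  apply: open_nbhs_nbhs; split => //; apply: openI => //.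
  by apply: closed_openC; exact: closed_closure.
move=> /nbhs_ballP[e /= e0 he].
(* the cubes have half-sides [r], [2 * r] and [3 * r], all below [e] *)
pose r := e / 4; have r0 : 0 < r by rewrite divr_gt0.
have cube_ball (s : R) : 0 < s -> s < e -> cube a s `<=` ball a e.
  move=> s0 se z zs; split => // i j; rewrite (ord1 i) /ball/= distrC.
  exact: le_lt_trans (zs j) se.
have [r01 r12 r2e] : [/\ r < 2 * r, 2 * r < 3 * r & 3 * r < e].
  by rewrite /r; split; lra.
have r20 : 0 < 3 * r by rewrite mulr_gt0.
have cubeO : cube a (3 * r) `<=` Omega.
  by move=> z /(cube_ball _ r20 r2e)/he[].
have cube_omega z : cube a (3 * r) z -> ~ omega z.
  by move=> /(cube_ball _ r20 r2e)/he[_ nz] wz; apply: nz; exact: subset_closure.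
pose A := cube a (3 * r) `&` ~` ball a (2 * r).
have [|||[d M] /= [d0 hM]] := @compact_bounded_off_blowup R n Omega T y A.
- apply: compact_closedI; first exact: cube_compact.
  by apply: open_closedC; apply: ball_open; rewrite mulr_gt0.
- by move=> z [/cubeO].
- move=> b [_ nb] /uniq ba; apply: nb; rewrite ba; apply: ballxx.
  by rewrite mulr_gt0.
have r1_gt0 : 0 < 2 * r by rewrite mulr_gt0.
have [b [b_smooth b01 b1 b0]] := smooth_plateau r1_gt0 r12.
have [B B0 bB] := cutoff_derive_bounded r0 r01 r12 b_smooth b1 b0.
pose t0 := Num.max 0 (T - d).
have t0T : t0 < T by rewrite gt_max tmax_gt0 /= ltrBlDr ltrDl.
have ann s : t0 < s -> s < T -> {ae lebesgue_rV n, forall z, cube a (3 * r) z ->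
    (exists i, 2 * r <= `|z ord0 i - a ord0 i|) -> `|y s z| <= `|M|}.
  rewrite gt_max => /andP[s0 sd] sT; apply: filterS (hM s (ltW s0) sT sd).
  move=> z h zc [i zi]; rewrite (le_trans _ (ler_norm M))// h//; first exact: cubeO.
  by split => // -[_ /(_ ord0 i)]; rewrite /ball/= distrC ltNge zi.
pose t1 := (t0 + T) / 2.
have [t01 t1T] : t0 < t1 /\ t1 < T by rewrite /t1; split; lra.
have t0_ge0 : 0 <= t0 by rewrite le_max lexx.
have [C C0 hC] := state_ae_bound mO muO y_sol y_cont r0 r01 r12 b_smooth b01 b1 b0
  B0 bB cubeO cube_omega t0_ge0 (normr_ge0 M) ann t01 t1T.
apply: (@not_blowup_of_ae_bounded R n Omega T y a (ball a r) t1 C) ablow => //.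
- exact: ball_open.
- exact: ballxx.
move=> t tt tT; apply: filterS (hC t tt tT) => z h _ bz; apply: h => i.
have [_ /(_ ord0 i)] := bz; rewrite /ball/= distrC ltr_distl => /andP[h1 h2].
by rewrite (ltW h1).
Qed.
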